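(* Let $p$ be an odd prime, $n\ge2$, and $G=G_{p^{n+1}}=\langle a,b\mid a^{p^n}=1,\ b^p=1,\ b^{-1}ab=a^{p^{n-1}+1}\rangle$. Let $\mathbb{F}_qG$ be a finite semisimple group algebra (so $\gcd(q,p)=1$). The strong Shoda pairs of $G$ (a complete set of inequivalent ones), together with the respective primitive central idempotents of $\mathbb{F}_qG$, are as follows: 1. $(G,G)$: $\ e_0=\widehat G$. 2. $(G,\langle a\rangle)$: $\ e_{1,k}=\frac1p\,\widehat{\langle a\rangle}\sum_{i=0}^{p-1}\operatorname{tr}(\xi_p^{ki})\,b^{-i}$. 3. $(G,\langle a^{p^j},a^{ip^{j-1}}b\rangle)$, for $0\le i\le p-1$ and $1\le j\le n-1$: $$e_{(i,j),k}=\begin{cases}\dfrac1{p^j}\,\widehat{\langle a^{p^j},a^{ip^{j-1}}b\rangle}\displaystyle\sum_{r=0}^{p^j-1}\operatorname{tr}(\xi_{p^j}^{kr})\,a^{-r}, & 1\le j\le i_0,\\[2mm] \dfrac1{p^j}\,\widehat{\langle a^{p^j},a^{ip^{j-1}}b\rangle}\displaystyle\sum_{r=0}^{p^{i_0}-1}\operatorname{tr}(\xi_{p^j}^{krp^{j-i_0}})\,a^{-rp^{j-i_0}}, & j>i_0.\end{cases}$$ 4. $(\langle a\rangle,\langle a^{p^n}\rangle)=(\langle a\rangle,\langle 1\rangle)$: $$e_{p^n,k}=\begin{cases}\dfrac1{p^{i_0}}\displaystyle\sum_{t\in T}\sum_{r=0}^{p^{i_0}-1}\operatorname{tr}(\xi_{p^{i_0}}^{krt})\,a^{-r},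 & n=i_0,\\[2mm] \dfrac1{p^n}\displaystyle\sum_{t\in T}\sum_{r=0}^{p^{i_0}-1}\operatorname{tr}(\xi_{p^n}^{krtp^{n-i_0}})\,a^{-rp^{n-i_0}}, & n>i_0,\end{cases}$$ where $T$ is a transversal of $\langle(1+p^{n-1})^{\omega_0}\rangle$ in $\langle1+p^{n-1}\rangle$ (subgroups of $(\mathbb{Z}/p^n)^*$), with $\omega_0$ the least positive integer such that $(1+p^{n-1})^{\omega_0}\in\langle q\rangle\bmod p^n$.
   Context: $q$ is a prime power. $o_m(q)$ is the multiplicative order of $q$ modulo $m$, $\phi$ is Euler's totient. The integer $i_0$ ($1\le i_0\le n$) is defined by $o_{p^n}(q)=\phi(p^n)/\delta$ with $\delta=p^{i_0-1}\delta'$, $\gcd(\delta',p)=1$. For a subgroup $X$, $\widehat X=\frac1{|X|}\sum_{x\in X}x$. $\xi_m$ is a primitive $m$-th root of unity in $\overline{\mathbb{F}}_q$. In each formula $\operatorname{tr}$ is the trace from $\mathbb{F}_q(\xi_{[H:K]})$ to $\mathbb{F}_q$, where $(H,K)$ is the pair in question. In each item $k$ runs over integers coprime to $p$. Definitions: a pair $(H,K)$ of subgroups of $G$ with $H\trianglelefteq G$, $H/K$ cyclic and $H/K$ a maximal abelian subgroup of $N_G(K)/K$ is a strong Shoda pair. For a faithful character $\chi:H/K\to\overline{\mathbb{F}}_q^{\,*}$ with $q$-cyclotomic coset $C=C_q(\chi)=\{\chi^{q^t}:t\ge0\}$, put $$\epsilon_C(H,K)=\frac1{[H:K]}\widehat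 K\sum_{\overline h\in H/K}\operatorname{tr}(\chi(\overline h))h^{-1};$$ the sum $e_C(G,H,K)$ of its distinct $G$-conjugates is a primitive central idempotent of $\mathbb{F}_qG$. The idempotents listed for a pair $(H,K)$ are the $e_C(G,H,K)$, where $C=C_q(\gamma^k)$ for a fixed faithful character $\gamma$ of $H/K$. Two strong Shoda pairs are inequivalent if their corresponding primitive central idempotents are distinct; a complete set of inequivalent pairs yields all primitive central idempotents of $\mathbb{F}_qG$. *)

(* Defs.v *)
From mathcomp Require Export all_boot all_order all_algebra all_fingroup.
From mathcomp Require Export all_solvable all_field all_character.
From mathcomp Require Import boolp.

Set Implicit Arguments.
Unset Strict Implicit.
Unset Printing Implicit Defensive.

Import GroupScope GRing.Theory.
Local Open Scope ring_scope.

(* The class of x in (Z/m)^*, for m > 1 and x coprime to m (1 otherwise), so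
   that the multiplicative order o_m(x) is #[unitZ m x] and <x> mod m is
   <[unitZ m x]>. *)
Definition unitZ (m x : nat) : {unit 'Z_m} := insubd (1%g : {unit 'Z_m}) (x%:R : 'Z_m).

(* The trace of x from F(xi) to F, for x and xi in an overfield Fbar of the
   finite field F. The field F(xi) is realised as the subfield <<1; z>> of some
   finite (automatically normal) extension L of F embedded in Fbar over F. *)
Definition is_trace (F : finFieldType) (Fbar : fieldType)
    (iota : {rmorphism F -> Fbar}) (xi x : Fbar) (c : F) : Prop :=
  exists (L : splittingFieldType F) (emb : {rmorphism L -> Fbar}) (z y : L),
    [/\ forall d : F, emb d%:A = iota d, emb z = xi,
        y \in <<1; z>>%VS, emb y = x & galTrace 1 <<1; z>> y = c%:A].

(* The value is 0, by convention, when x is not in F(xi). *)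
Definition trace (F : finFieldType) (Fbar : fieldType)
    (iota : {rmorphism F -> Fbar}) (xi x : Fbar) : F :=
  odflt 0 [pick c | `[< is_trace iota xi x c >] ].

(* The group algebra FG is the library's [group_ring F G], the matrix algebra
   spanned by the regular representation: x in G is [regular_repr F G x], and
   the product is the matrix product. *)
Notation galg F G := 'M[F]_(gcard G).

Definition hat (F : fieldType) (gT : finGroupType) (G X : {group gT}) :
    galg F G :=
  #|X|%:R^-1 *: gset_mx F G X.

Definition central_idem (F : fieldType) (gT : finGroupType) (G : {group gT})
    (e : galg F G) : Prop :=
  (e \in 'Z(group_ring F G))%MS /\ e *m e = e.

Definition primitive_central_idem (F : fieldType) (gT : finGroupType)
    (G : {group gT}) (e : galg F G) : Prop :=
  [/\ central_idem e, e != 0 &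
      forall f g : galg F G, central_idem f -> central_idem g ->
        f *m g = 0 -> e = f + g -> f = 0 \/ g = 0].

Definition semisimple_galg (F : fieldType) (gT : finGroupType)
    (G : {group gT}) : Type :=
  mx_completely_reducible (regular_repr F G) 1%:M.

Definition strong_shoda_pair (gT : finGroupType) (G H K : {group gT}) : Prop :=
  [/\ H <| G, K <| H, cyclic (H / K) &
      [max (H / K)%g of A | A \subset ('N_G(K) / K)%g & abelian A]].

(* Only the values of chi on H / K matter. *)
Definition faithful_char (Fbar : fieldType) (gT : finGroupType)
    (H K : {group gT}) (chi : coset_of K -> Fbar) : Prop :=
  [/\ {in (H / K)%g &, forall x y, chi (x * y)%g = chi x * chi y},
      {in (H / K)%g, forall x, chi x != 0} &
      {in (H / K)%g &, injective chi}].

(* epsilon_C(H, K) for the q-cyclotomic coset C of chi, given through its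
   representative chi: tr (chi h) only depends on C as the trace is invariant
   under x |-> x ^+ q. The element h of G representing hb in H / K is
   immaterial because of the factor hat K. *)
Definition epsilon (F : finFieldType) (Fbar : fieldType)
    (iota : {rmorphism F -> Fbar}) (xi : nat -> Fbar) (gT : finGroupType)
    (G H K : {group gT}) (chi : coset_of K -> Fbar) : galg F G :=
  #|H : K|%:R^-1 *: (hat F G K *m
    \sum_(hb in (H / K)%g) trace iota (xi #|H : K|) (chi hb) *:
      regular_repr F G (repr hb)^-1%g).

Definition conj_galg (F : fieldType) (gT : finGroupType) (G : {group gT})
    (e : galg F G) (g : gT) : galg F G :=
  regular_repr F G g^-1%g *m e *m regular_repr F G g.

(* e_C(G, H, K): summing over a set of elements of FG counts each of the
   distinct conjugates once. *)
Definition e_ssp (F : finFieldType) (Fbar : fieldType)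
    (iota : {rmorphism F -> Fbar}) (xi : nat -> Fbar) (gT : finGroupType)
    (G H K : {group gT}) (chi : coset_of K -> Fbar) : galg F G :=
  \sum_(e in [set conj_galg (epsilon iota xi G H chi) g | g in G]) e.

(* e is one of the idempotents e_C(G, H, K). *)
Definition idem_of_pair (F : finFieldType) (Fbar : fieldType)
    (iota : {rmorphism F -> Fbar}) (xi : nat -> Fbar) (gT : finGroupType)
    (G H K : {group gT}) (e : galg F G) : Prop :=
  exists2 chi : coset_of K -> Fbar,
    faithful_char H chi & e = e_ssp iota xi G H chi.

Definition inequivalent (F : finFieldType) (Fbar : fieldType)
    (iota : {rmorphism F -> Fbar}) (xi : nat -> Fbar) (gT : finGroupType)
    (G : {group gT}) (P Q : {group gT} * {group gT}) : Prop :=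
  forall e f : galg F G, idem_of_pair iota xi P.1 P.2 e ->
    idem_of_pair iota xi Q.1 Q.2 f -> e <> f.

Definition equivalent (F : finFieldType) (Fbar : fieldType)
    (iota : {rmorphism F -> Fbar}) (xi : nat -> Fbar) (gT : finGroupType)
    (G : {group gT}) (P Q : {group gT} * {group gT}) : Prop :=
  forall e : galg F G,
    idem_of_pair iota xi P.1 P.2 e <-> idem_of_pair iota xi Q.1 Q.2 e.

Inductive label := LabG | LabA | LabIJ of nat & nat | LabMax.

Definition label_ok (p n : nat) (l : label) : bool :=
  if l is LabIJ i j then (i <= p.-1)%N && (1 <= j <= n.-1)%N else true.

Definition pair_of (gT : finGroupType) (G : {group gT}) (a b : gT) (p n : nat)
    (l : label) : {group gT} * {group gT} :=
  match l with
  | LabG => (G, G)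
  | LabA => (G, <[a]>%G)
  | LabIJ i j =>
      (G, <<[set (a ^+ (p ^ j)%N)%g; (a ^+ (i * p ^ j.-1)%N * b)%g]>>%G)
  | LabMax => (<[a]>%G, <[(a ^+ (p ^ n)%N)%g]>%G)
  end.

Definition listed_idem (F : finFieldType) (Fbar : fieldType)
    (iota : {rmorphism F -> Fbar}) (xi : nat -> Fbar) (gT : finGroupType)
    (G : {group gT}) (a b : gT) (p n i0 : nat) (T : {set {unit 'Z_(p ^ n)%N}})
    (l : label) (k : int) : galg F G :=
  let: (H, K) := pair_of G a b p n l in
  let tr := trace iota (xi #|H : K|) in
  let aG := regular_repr F G in
  match l with
  | LabG => hat F G G
  | LabA =>
      p%:R^-1 *: (hat F G <[a]> *m
        \sum_(i < p) tr (xi p ^ (k * i%:Z)) *: aG (b ^- i)%g)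
  | LabIJ i j =>
      if (j <= i0)%N then
        (p ^ j)%:R^-1 *: (hat F G K *m
          \sum_(r < p ^ j) tr (xi (p ^ j)%N ^ (k * r%:Z)) *: aG (a ^- r)%g)
      else
        (p ^ j)%:R^-1 *: (hat F G K *m
          \sum_(r < p ^ i0)
            tr (xi (p ^ j)%N ^ (k * r%:Z * (p ^ (j - i0))%N%:Z)) *:
              aG (a ^- (r * p ^ (j - i0))%N)%g)
  | LabMax =>
      if n == i0 then
        (p ^ i0)%:R^-1 *: (\sum_(t in T) \sum_(r < p ^ i0)
          tr (xi (p ^ i0)%N ^ (k * r%:Z * (val t : nat)%:Z)) *: aG (a ^- r)%g)
      else
        (p ^ n)%:R^-1 *: (\sum_(t in T) \sum_(r < p ^ i0)
          tr (xi (p ^ n)%N ^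
                (k * r%:Z * (val t : nat)%:Z * (p ^ (n - i0))%N%:Z)) *:
            aG (a ^- (r * p ^ (n - i0))%N)%g)
  end.

(* Main.v *)
(* Over the algebraic closure, the irreducible characters of G are the
   linear ones and, for each faithful character th of the cyclic centre
   Z(G), one character of degree p that vanishes outside Z(G). In both cases
   chi / chi 1 is a linear character th of Y = G or Y = Z(G) extended by 0,
   and its primitive central idempotent is |Y|^-1 * sum_(y in Y) th(y^-1) y.
   The primitive central idempotents of F_q G are the sums of these over the
   orbits of the Frobenius.

   Let (H, K) be a strong Shoda pair and lam a faithful character of H / K.
   Either G' <= K, and then H = G since G / K is abelian; or K meets Z(G)
   trivially, as every nontrivial subgroup of Z(G) contains G', and then
   Z(G) <= H. The average of lam over G is lam itself in the first case and
   the restriction of lam to Z(G) extended by 0 in the second one, so e_C(G,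
   H, K) is the sum over the orbit of lam or of this restriction.

   The truncated sums come from the fact that <q> contains 1 + p^(l-1)
   modulo p^l for i_0 < l <= n, so that roots of unity of order p^l have
   trace 0. *)
Require Import Defs.
From mathcomp Require Import boolp.

Set Implicit Arguments.
Unset Strict Implicit.
Unset Printing Implicit Defensive.

Import GroupScope GRing.Theory.
Local Open Scope ring_scope.

(** The idempotents live over [F] and the characters over [Fbar]. An element of the group algebra is
    therefore handled through the images of its coefficients in [Fbar] and tested by the linear
    forms [phi]. On central elements these are multiplicative, and a central idempotent takes the
    value 0 or 1 there, so a primitive one is pinned down by a single character at which [phi] does
    not vanish; completeness then only asks that the characters detect every nonzero central
    element. Two pairs are told apart by left multiplication: the elements of G fixing an idempotent
    of (G, K) form K, whereas G' does not fix an idempotent of (<a>, 1).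

    The orbit of a character of Z(G) does not display the formula listed for (<a>, 1), which is a
    sum over T. That formula comes from the conjugates of epsilon: conjugation by powers of b raises
    the character to powers of 1 + p^(n-1), Frobenius raises it to the power q, and two conjugates
    agree exactly when their exponents differ by a power of q modulo p^n. *)

Lemma big_cycle (R : nmodType) (gT : finGroupType) (x : gT) (f : gT -> R) :
  \sum_(y in <[x]>%g) f y = \sum_(i < #[x]%g) f (x ^+ i)%g.
Proof.
have -> : <[x]>%g = [set (x ^+ i)%g | i : 'I_#[x]%g].
  apply/setP=> y; apply/idP/imsetP=> [/cyclePmin[i ltix ->]|[i _ ->]].
    by exists (Ordinal ltix).
  exact: mem_cycle.
rewrite big_imset //= => i j _ _ /eqP.
by rewrite eq_expg_mod_order !modn_small // => /eqP/val_inj.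
Qed.

(** * Traces over finite fields *)

Section Trace.

Variables (F : finFieldType) (Fbar : fieldType) (iota : {rmorphism F -> Fbar}).
Local Notation q := #|F|.

(** The Galois group of [<<1; z>>] is generated by the [q]-power map, a power of which is trivial as
    soon as it fixes [z]; its order is thus the length [D] of the Frobenius orbit of [xi]. In
    particular the trace does not depend on the extension [L] that witnesses it. *)
Lemma is_traceE (xi x : Fbar) (c : F) (D : nat) :
    (forall d, (xi ^+ (q ^ d) == xi) = (D %| d)%N) ->
  is_trace iota xi x c -> iota c = \sum_(i < D) x ^+ (q ^ i).
Proof.
move=> defD [L [emb [z [y [embF Dz Ey Dy trE]]]]]; subst xi x.
rewrite -embF -trE rmorph_sum /=; set E := <<1; z>>%AS.
have [alpha /eqP genE Dalpha] := finField_galois_generator (sub1v E).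
have alphaX i : {in E, forall u, (alpha ^+ i)%g u = u ^+ (q ^ i)}.
  elim: i => [|i IHi] u Eu; first by rewrite expg0 gal_id expn0 expr1.
  by rewrite expgSr galM // IHi // Dalpha ?rpredX // dimv1 expn1 expnSr exprM.
have oalpha : #[alpha]%g = D.
  apply/eqP; rewrite eqn_dvd -!defD; apply/andP; split; last first.
    rewrite -rmorphXn -alphaX ?memv_adjoin // expg_order gal_id; exact: eqxx.
  have := dvdnn D; rewrite order_dvdn -defD -rmorphXn (inj_eq (fmorph_inj emb)).
  rewrite -alphaX ?memv_adjoin // -{2}(gal_id E z) -gal_adjoin_eq //.
  by rewrite genE mem_cycle.
rewrite genE big_cycle oalpha; apply: eq_bigr => i _.
by rewrite alphaX // rmorphXn.
Qed.

(** A nonzero polynomial of least size vanishing at [xi] is irreducible, and adjoining a root of it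
    gives F(xi) with its embedding; a finite extension of a finite field is a splitting field. *)
Lemma finite_subextension (xi : Fbar) : integralOver iota xi ->
  exists (L : splittingFieldType F) (emb : {rmorphism L -> Fbar}) (z : L),
    (forall d : F, emb d%:A = iota d) /\ emb z = xi.
Proof.
move=> [p0 mon_p0 p0xi].
pose P m := `[< exists p : {poly F},
  [/\ p != 0, root (map_poly iota p) xi & size p = m] >].
have exP : exists m, P m.
  by exists (size p0); apply/asboolP; exists p0; rewrite monic_neq0.
have [m /asboolP[p [nz_p pxi szp]] min_p] := ex_minnP exP.
have irr_p : irreducible_poly p.
  apply/(subfx_irreducibleP pxi nz_p) => r rxi nz_r.
  by rewrite szp min_p //; apply/asboolP; exists r.
suffices [L [emb [z Dz]]] : exists (L : fieldExtType F)
    (emb : {rmorphism L -> Fbar}) (z : L),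
    (forall d : F, emb d%:A = iota d) /\ emb z = xi.
  exists (FinSplittingFieldType F L).
  exists emb, z; exact: Dz.
exists (SubFieldExtType pxi irr_p), (@subfx_inj _ _ iota xi p).
exists (subfx_root iota xi p); split; last exact: subfx_inj_root.
exact: subfx_inj_base.
Qed.

Lemma traceX (xi : Fbar) (D : nat) : integralOver iota xi ->
    (forall d, (xi ^+ (q ^ d) == xi) = (D %| d)%N) ->
  forall s, iota (trace iota xi (xi ^+ s)) = \sum_(i < D) (xi ^+ s) ^+ (q ^ i).
Proof.
move=> alg_xi defD s; rewrite /trace; case: pickP => [c /asboolP|no_c] /=.
  exact: is_traceE.
(* Had nothing been picked, [trace] would take its default value 0. This is excluded by exhibiting
   an extension: the Galois trace of [z ^+ s] lies in [F]. *)
have [L [emb [z [embF embz]]]] := finite_subextension alg_xi.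
have galE : galois 1 <<1; z>> by apply/finField_galois/sub1v.
have Es : z ^+ s \in <<1; z>>%VS by rewrite rpredX ?memv_adjoin.
have /vlineP[c Dc] := mem_galTrace galE Es.
have /asboolP[] := no_c c; exists L, emb, z, (z ^+ s).
by split; rewrite // -embz rmorphXn.
Qed.

End Trace.

(** * Units modulo m and the Frobenius map *)

Lemma val_unitZ (m x : nat) : (1 < m)%N -> coprime m x ->
  val (unitZ m x) = x%:R :> 'Z_m.
Proof.
move=> m1 co_mx; rewrite /unitZ insubdK //.
by rewrite -[_ \in _]/(_ \is a GRing.unit) unitZpE.
Qed.

Lemma eq_unitZX (m x y d : nat) : (1 < m)%N -> coprime m x -> coprime m y ->
  (unitZ m x ^+ d == unitZ m y)%g = (x ^ d == y %[mod m]).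
Proof.
move=> m1 co_mx co_my; rewrite -val_eqE FinRing.val_unitX !val_unitZ //.
by rewrite -natrX -val_eqE /= !val_Zp_nat.
Qed.

Lemma order_unitZ (m x d : nat) : (0 < m)%N -> coprime m x ->
  (#[unitZ m x]%g %| d)%N = (x ^ d == 1 %[mod m]).
Proof.
move=> m0 co_mx; case: (ltngtP m 1) m0 => // [m1 _ | -> _].
  rewrite order_dvdn -eq_unitZX ?coprimen1 //; congr (_ == _).
  by apply: val_inj; rewrite val_unitZ ?coprimen1.
(* ['Z_1] is the ring with two elements; its only unit is 1, so the order is 1 as it should be
   modulo 1. *)
rewrite !modn1 eqxx; set u := unitZ _ _.
have -> : u = 1%g; last by rewrite order1 dvd1n.
by apply: val_inj; case: u => /= -[[|[|k]] ltk] //= uk; apply: val_inj.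
Qed.

Section Frobenius.

Variables (F : finFieldType) (Fbar : fieldType) (iota : {rmorphism F -> Fbar}).
Local Notation q := #|F|.

Lemma frobenius_iota i c : iota c ^+ (q ^ i) = iota c.
Proof.
elim: i => [|i IHi]; first by rewrite expn0 expr1.
by rewrite expnSr exprM IHi -rmorphXn expf_card.
Qed.

Lemma frobenius0 i : 0 ^+ (q ^ i) = 0 :> Fbar.
Proof. by rewrite expr0n expn_eq0 -[q == 0%N]negbK -lt0n (cardD1 (0 : F)). Qed.

Lemma frobenius_sum i (I : Type) (r : seq I) (P : pred I) (f : I -> Fbar) :
  (\sum_(j <- r | P j) f j) ^+ (q ^ i) = \sum_(j <- r | P j) f j ^+ (q ^ i).
Proof.
have [p0 p0_pr charF] := finPcharP F.
have charFbar : p0 \in [pchar Fbar] by rewrite (fmorph_pchar iota).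
apply: (big_morph (fun x : Fbar => x ^+ (q ^ i))) => [x y|];
  last exact: frobenius0.
by apply: exprDn_pchar; rewrite (card_pprimeChar charF) !pnatX pnatE ?charFbar.
Qed.

End Frobenius.

(** * Coefficients in the group algebra *)

Section GroupAlgebra.

Variables (F : finFieldType) (gT : finGroupType) (G : {group gT}).
Local Notation aG := (regular_repr F G).
Local Notation RG := (group_ring F G).

(** In the regular representation the row of 1 in the matrix of [h] has its single 1 in the column
    of [h], so this row carries all the coefficients. *)
Definition gcoef (e : galg F G) (g : gT) : F :=
  e (gring_index G 1) (gring_index G g).

Lemma gcoef_repr : {in G &, forall h g, gcoef (aG h) g = (g == h)%:R}.
Proof.
move=> h g Gh Gg; rewrite /gcoef mxE gring_indexK // mul1g mxE eqxx /=.
by rewrite (inj_in_eq (can_in_inj (@gring_indexK _ G))).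
Qed.

Lemma gcoef_sum (I : Type) (r : seq I) (P : pred I) (e : I -> galg F G) g :
  gcoef (\sum_(i <- r | P i) e i) g = \sum_(i <- r | P i) gcoef (e i) g.
Proof. by rewrite /gcoef summxE. Qed.

Lemma gcoefZ c (e : galg F G) g : gcoef (c *: e) g = c * gcoef e g.
Proof. by rewrite /gcoef mxE. Qed.

Lemma gcoefD (e f : galg F G) g : gcoef (e + f) g = gcoef e g + gcoef f g.
Proof. by rewrite /gcoef mxE. Qed.

Lemma gcoef0 g : gcoef 0 g = 0.
Proof. by rewrite /gcoef mxE. Qed.

Lemma gcoef_lin (a : gT -> F) g : g \in G ->
  gcoef (\sum_(h in G) a h *: aG h) g = a g.
Proof.
move=> Gg; rewrite gcoef_sum (bigD1 g) //= gcoefZ gcoef_repr // eqxx mulr1.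
rewrite big1 ?addr0 // => h /andP[Gh nhg].
by rewrite gcoefZ gcoef_repr // eq_sym (negPf nhg) mulr0.
Qed.

Lemma gring_lin (e : galg F G) : (e \in RG)%MS ->
  e = \sum_(g in G) gcoef e g *: aG g.
Proof.
by case/envelop_mxP=> a ->; apply: eq_bigr => g Gg; rewrite gcoef_lin.
Qed.

Lemma gcoef_inj (e f : galg F G) : (e \in RG)%MS -> (f \in RG)%MS ->
  {in G, gcoef e =1 gcoef f} -> e = f.
Proof.
move=> Re Rf eq_ef; rewrite (gring_lin Re) (gring_lin Rf).
by apply: eq_bigr => g Gg; rewrite eq_ef.
Qed.

Lemma gringM (e f : galg F G) : (e \in RG)%MS -> (f \in RG)%MS ->
  (e *m f \in RG)%MS.
Proof. exact: envelop_mxM. Qed.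

Lemma gring_sum (I : Type) (r : seq I) (P : pred I) (e : I -> galg F G) :
  (forall i, P i -> (e i \in RG)%MS) ->
  (\sum_(i <- r | P i) e i \in RG)%MS.
Proof. by move=> Re; rewrite linear_sum summx_sub. Qed.

Lemma gringZ c (e : galg F G) : (e \in RG)%MS -> (c *: e \in RG)%MS.
Proof. by move=> Re; rewrite linearZ scalemx_sub. Qed.

Lemma gring_repr g : g \in G -> (aG g \in RG)%MS.
Proof. exact: envelop_mx_id. Qed.

Lemma gcoef_mul (e f : galg F G) g : (e \in RG)%MS -> (f \in RG)%MS ->
  g \in G -> gcoef (e *m f) g = \sum_(x in G) gcoef e x * gcoef f (x^-1 * g)%g.
Proof.
move=> Re Rf Gg; rewrite {1}(gring_lin Re) mulmx_suml gcoef_sum.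
apply: eq_bigr => x Gx; rewrite -scalemxAl gcoefZ; congr (_ * _).
rewrite {1}(gring_lin Rf) mulmx_sumr gcoef_sum (bigD1 (x^-1 * g)%g) ?groupM
  ?groupV //=.
rewrite -scalemxAr gcoefZ -repr_mxM ?groupM ?groupV // mulKVg gcoef_repr //
  eqxx.
rewrite mulr1 big1 ?addr0 // => y /andP[Gy nyg].
rewrite -scalemxAr gcoefZ -repr_mxM // gcoef_repr ?groupM //.
by rewrite eq_sym (can2_eq (mulKg x) (mulKVg x)) (negPf nyg) mulr0.
Qed.

Lemma gcoef_mull h (e : galg F G) g : (e \in RG)%MS -> h \in G -> g \in G ->
  gcoef (aG h *m e) g = gcoef e (h^-1 * g)%g.
Proof.
move=> Re Gh Gg; rewrite gcoef_mul ?gring_repr // (bigD1 h) //= gcoef_repr //.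
rewrite eqxx mul1r big1 ?addr0 // => x /andP[Gx nxh].
by rewrite gcoef_repr // (negPf nxh) mul0r.
Qed.

Lemma gcoef_mulr h (e : galg F G) g : (e \in RG)%MS -> h \in G -> g \in G ->
  gcoef (e *m aG h) g = gcoef e (g * h^-1)%g.
Proof.
move=> Re Gh Gg; have Ggh : (g * h^-1)%g \in G by rewrite groupM ?groupV.
rewrite gcoef_mul ?gring_repr // (bigD1 (g * h^-1)%g) //=.
rewrite gcoef_repr ?groupM ?groupV //.
rewrite invMg invgK mulgKV eqxx mulr1 big1 ?addr0 // => x /andP[Gx nxh].
rewrite gcoef_repr ?groupM ?groupV // (can2_eq (mulKVg x) (mulKg x)).
by rewrite eq_sym (can2_eq (mulgK h) (mulgKV h)) (negPf nxh) mulr0.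
Qed.

Lemma center_gringP (e : galg F G) :
  (e \in 'Z(RG))%MS <->
  (e \in RG)%MS /\ {in G &, forall g h, gcoef e (g ^ h)%g = gcoef e g}.
Proof.
rewrite sub_capmx; split=> [/andP[Re /cent_mxP cRe]|[Re eJ]].
  split=> // g h Gg Gh; rewrite conjgE -gcoef_mull ?groupM //.
  by rewrite cRe ?gring_repr // gcoef_mulr ?groupM // mulgK.
rewrite Re; apply/cent_mxP=> f Rf; rewrite (gring_lin Rf).
rewrite mulmx_suml mulmx_sumr; apply: eq_bigr => h Gh.
rewrite -scalemxAl -scalemxAr; congr (_ *: _).
apply: gcoef_inj => [||g Gg]; try by rewrite gringM ?gring_repr.
rewrite gcoef_mulr // gcoef_mull // -[RHS](eJ _ h) ?groupM ?groupV //.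
by rewrite conjgE mulgKV.
Qed.

End GroupAlgebra.

Section GroupSums.

Variables (R : nmodType) (gT : finGroupType) (G : {group gT}) (f : gT -> R).

Lemma sum_mulgl g : g \in G -> \sum_(x in G) f (g * x)%g = \sum_(x in G) f x.
Proof.
move=> Gg; rewrite [RHS](reindex_inj (mulgI g)).
by apply: eq_bigl => x; rewrite groupMl.
Qed.

Lemma sum_mulgr g : g \in G -> \sum_(x in G) f (x * g)%g = \sum_(x in G) f x.
Proof.
move=> Gg; rewrite [RHS](reindex_inj (mulIg g)).
by apply: eq_bigl => x; rewrite groupMr.
Qed.

Lemma sum_conjg g : g \in G -> \sum_(x in G) f (x ^ g)%g = \sum_(x in G) f x.
Proof.
move=> Gg; rewrite [RHS](reindex_inj (conjg_inj g)).
by apply: eq_bigl => x; rewrite groupJr.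
Qed.

End GroupSums.

(** * Linear characters *)

Section LinearCharacters.

Variables (Fbar : fieldType) (gT : finGroupType).
Implicit Types (A Y : {group gT}) (th mu : gT -> Fbar).

Definition lin_char (A : {set gT}) th : Prop :=
  th 1%g = 1 /\ {in A &, forall x y, th (x * y)%g = th x * th y}.

Lemma lin_charS (A B : {set gT}) th :
  A \subset B -> lin_char B th -> lin_char A th.
Proof.
by move=> /subsetP sAB [th1 thM]; split=> // x y /sAB Bx /sAB By; apply: thM.
Qed.

Lemma lin_char_exp (A : {set gT}) th n :
  lin_char A th -> lin_char A (fun x => th x ^+ n).
Proof.
move=> [th1 thM]; split=> [|x y Ax Ay]; first by rewrite th1 expr1n.
by rewrite thM // exprMn.
Qed.

Lemma lin_char_neq0 A th : lin_char A th -> {in A, forall x, th x != 0}.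
Proof.
move=> [th1 thM] x Ax; have: th x * th x^-1%g != 0.
  by rewrite -thM ?groupV // mulgV th1 oner_eq0.
by apply: contra => /eqP->; rewrite mul0r.
Qed.

Lemma lin_charV A th : lin_char A th -> {in A, forall x, th x^-1%g = (th x)^-1}.
Proof.
move=> lin_th x Ax; apply: (mulfI (lin_char_neq0 lin_th Ax)).
by rewrite divff ?(lin_char_neq0 lin_th) // -lin_th.2 ?groupV // mulgV lin_th.1.
Qed.

Lemma lin_charX A th n :
  lin_char A th -> {in A, forall x, th (x ^+ n)%g = th x ^+ n}.
Proof.
move=> lin_th x Ax; elim: n => [|n IHn]; first by rewrite lin_th.1.
by rewrite expgS exprS lin_th.2 ?groupX // IHn.
Qed.

Lemma sum_lin_char A mu a : lin_char A mu -> a \in A -> mu a != 1 ->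
  \sum_(x in A) mu x = 0.
Proof.
move=> lin_mu Aa mua; have: (mu a - 1) * \sum_(x in A) mu x == 0.
  rewrite mulrBl mul1r -{2}(sum_mulgl mu Aa) mulr_sumr subr_eq0; apply/eqP.
  by apply: eq_bigr => x Ax; rewrite lin_mu.2.
by rewrite mulf_eq0 subr_eq0 (negPf mua) => /eqP.
Qed.

(* Conjugation by [g] translates the conjugates of [y] by the central
   element [~y, g]. *)
Lemma sum_conj_central A (u : gT -> Fbar) y g t :
    y \in A -> g \in A -> [~ y, g]%g \in 'C(A)%g ->
    {in A, forall x, u (y ^ x * [~ y, g])%g = u (y ^ x)%g * t} -> t != 1 ->
  \sum_(x in A) u (y ^ x)%g = 0.
Proof.
move=> Ay Ag cAc ut t1; have: (t - 1) * \sum_(x in A) u (y ^ x)%g == 0.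
  rewrite mulrBl mul1r -{2}(sum_mulgl (fun x => u (y ^ x)%g) Ag) mulr_sumr.
  rewrite subr_eq0; apply/eqP/eq_bigr => x Ax; rewrite mulrC -ut //.
  rewrite conjgM (conjg_mulR y g) conjMg; congr (u (_ * _)%g).
  by rewrite /conjg (centP cAc) // mulKg.
by rewrite mulf_eq0 subr_eq0 (negPf t1) => /eqP.
Qed.

Definition ext0 (Y : {set gT}) th x := if x \in Y then th x else 0.

Lemma ext0T (Y : {set gT}) th x : x \in Y -> ext0 Y th x = th x.
Proof. by rewrite /ext0 => ->. Qed.

(* [ext0 Y th] is then the normalised character [chi / chi 1] of an irreducible
   character [chi] of [G] with [chi 1 ^ 2 = |G : Y|]. *)
Definition central_type (G Y : {group gT}) th : Prop :=
  [/\ Y <| G, lin_char Y th, {in Y & G, forall y g, th (y ^ g)%g = th y} &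
      forall y, y \in G -> y \notin Y -> exists2 g, g \in G &
        [/\ [~ y, g]%g \in Y, [~ y, g]%g \in 'C(G)%g & th [~ y, g]%g != 1]].

(** On [Y] the summand is constant; off [Y] translation by a central commutator multiplies the sum
    by a value other than 1. The character may live on a larger [H], but only its restriction to [Y]
    survives the averaging. *)
Lemma central_type_sum (G Y H : {group gT}) th : central_type G Y th ->
    Y \subset H -> H <| G -> lin_char H th ->
  {in H, forall y, \sum_(g in G) th (y ^ g)%g = #|G|%:R * ext0 Y th y}.
Proof.
move=> [nYG _ thJ th_nt] /subsetP sYH nHG lin_th y Hy.
have Gy := subsetP (normal_sub nHG) y Hy.
have HJ g : g \in G -> (y ^ g)%g \in H.
  by move=> Gg; rewrite memJ_norm // (subsetP (normal_norm nHG)).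
rewrite /ext0; case: ifPn => [Yy | nYy].
  by rewrite (eq_bigr _ (fun g Gg => thJ y g Yy Gg)) sumr_const mulr_natl.
have [g Gg [Yc cGc thc]] := th_nt y Gy nYy.
rewrite mulr0; apply: (sum_conj_central Gy Gg cGc) thc => x Gx.
by rewrite lin_th.2 ?HJ ?sYH.
Qed.

(** The functional equation of a normalised irreducible character. It makes [phi] multiplicative on
    central elements without a representation that affords the character. *)
Lemma central_type_spherical (G Y : {group gT}) th : central_type G Y th ->
  {in G &, forall x y, \sum_(g in G) ext0 Y th (x * y ^ g)%g
     = #|G|%:R * (ext0 Y th x * ext0 Y th y)}.
Proof.
move=> [nYG lin_th thJ th_nt] x y Gx Gy; have [sYG nYG'] := andP nYG.
rewrite {3}/ext0; case: ifPn => [Yy | nYy].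
  rewrite mulr_natl -sumr_const; apply: eq_bigr => g Gg.
  have Yyg : (y ^ g)%g \in Y by rewrite memJ_norm // (subsetP nYG').
  rewrite /ext0 groupMr //; case: ifP => [Yx|]; last by rewrite mul0r.
  by rewrite lin_th.2 // thJ.
have [g Gg [Yc cGc thc]] := th_nt y Gy nYy.
rewrite !mulr0.
apply: (sum_conj_central (u := fun z => ext0 Y th (x * z)%g) Gy Gg cGc) thc.
move=> z Gz; rewrite mulgA /ext0 groupMr //; case: ifP => [Yx|];
  last by rewrite mul0r.
by rewrite lin_th.2.
Qed.

End LinearCharacters.

(** * Orbit sums of primitive central idempotents *)

Section OrbitSums.

Variables (F : finFieldType) (Fbar : fieldType) (iota : {rmorphism F -> Fbar}).
Variables (gT : finGroupType) (G : {group gT}).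
Hypothesis nzG : #|G|%:R != 0 :> F.
Implicit Types (e f : galg F G) (Y : {group gT}) (th : gT -> Fbar).
Local Notation q := #|F|.
Local Notation aG := (regular_repr F G).
Local Notation RG := (group_ring F G).

Lemma natr_group_neq0 (R : fieldType) (h : {rmorphism F -> R}) Y :
  Y \subset G -> #|Y|%:R != 0 :> R.
Proof.
move=> sYG; have := nzG; rewrite -(Lagrange sYG) natrM mulf_eq0 negb_or.
by case/andP=> nzY _; rewrite -(rmorph_nat h) fmorph_eq0.
Qed.

(* For [w] as in [central_type], [phi w] restricted to the centre of the group
   algebra is the corresponding central character. *)
Definition phi (w : gT -> Fbar) e : Fbar :=
  \sum_(g in G) iota (gcoef e g) * w g.

Lemma phi0 w : phi w 0 = 0.
Proof. by rewrite /phi big1 // => g _; rewrite gcoef0 rmorph0 mul0r. Qed.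

Lemma phiD w e f : phi w (e + f) = phi w e + phi w f.
Proof.
rewrite /phi -big_split; apply: eq_bigr => g _.
by rewrite gcoefD rmorphD mulrDl.
Qed.

Lemma phi_sum w (I : Type) (r : seq I) (P : pred I) (e : I -> galg F G) :
  phi w (\sum_(i <- r | P i) e i) = \sum_(i <- r | P i) phi w (e i).
Proof. by apply: (big_morph (phi w)); [apply: phiD | apply: phi0]. Qed.

Lemma phi_ext0 Y th e : Y \subset G ->
  phi (ext0 Y th) e = \sum_(g in Y) iota (gcoef e g) * th g.
Proof.
move=> /subsetP sYG; rewrite /phi (bigID (mem Y)) /= addrC big1 ?add0r.
  apply: eq_big => [g|g /andP[_ Yg]]; last by rewrite ext0T.
  by apply/andP/idP => [[]|Yg]; last by rewrite sYG.
by move=> g /andP[_ /negPf nYg]; rewrite /ext0 nYg mulr0.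
Qed.

(** The coefficients of [f] are constant on classes, so the sum can be averaged over the conjugates
    of [x], where the functional equation splits off the factor at [y]. *)
Lemma phi_shift Y th f y : central_type G Y th -> (f \in 'Z(RG))%MS ->
    y \in G ->
  \sum_(x in G) iota (gcoef f x) * ext0 Y th (y * x)%g
    = ext0 Y th y * phi (ext0 Y th) f.
Proof.
move=> thP /center_gringP[_ fJ] Gy.
apply: (mulfI (natr_group_neq0 iota (subxx G))).
have -> : #|G|%:R * \sum_(x in G) iota (gcoef f x) * ext0 Y th (y * x)%g =
    \sum_(g in G) \sum_(x in G) iota (gcoef f x) * ext0 Y th (y * x ^ g)%g.
  rewrite mulr_natl -sumr_const; apply: eq_bigr => g Gg.
  rewrite -(sum_conjg (fun x => iota (gcoef f x) * ext0 Y th (y * x)%g) Gg).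
  by apply: eq_bigr => x Gx; rewrite fJ.
rewrite exchange_big /phi /= !mulr_sumr; apply: eq_bigr => x Gx.
rewrite -mulr_sumr (central_type_spherical thP) // mulrCA; congr (_ * _).
exact: mulrCA.
Qed.

(** The first factor ranges over the whole group ring, so that it can be a single group element when
    stabilisers of idempotents are computed. *)
Lemma phi_mul Y th e f : central_type G Y th -> (e \in RG)%MS ->
    (f \in 'Z(RG))%MS ->
  phi (ext0 Y th) (e *m f) = phi (ext0 Y th) e * phi (ext0 Y th) f.
Proof.
move=> thP Re Zf; have [Rf _] := (center_gringP f).1 Zf.
rewrite {2}/phi mulr_suml.
transitivity (\sum_(y in G) iota (gcoef e y) *
    \sum_(x in G) iota (gcoef f x) * ext0 Y th (y * x)%g); last first.
  by apply: eq_bigr => y Gy; rewrite (phi_shift thP) // mulrA.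
transitivity (\sum_(g in G) \sum_(y in G)
    iota (gcoef e y) * (iota (gcoef f (y^-1 * g)%g) * ext0 Y th g)).
  apply: eq_bigr => g Gg; rewrite gcoef_mul // rmorph_sum mulr_suml.
  by apply: eq_bigr => y Gy; rewrite rmorphM mulrA.
rewrite exchange_big /=; apply: eq_bigr => y Gy; rewrite -mulr_sumr.
rewrite -(sum_mulgl _ Gy); congr (_ * _).
by apply: eq_bigr => x Gx; rewrite mulKg.
Qed.

(* [e] is the sum over [i < D] of the idempotents attached to the Frobenius
   twists [th ^+ (q ^ i)]. Prescribing the coefficients of [e] through [iota]
   avoids any descent from [Fbar] to [F]. *)
Definition orbit_sum Y th D e : Prop :=
  (e \in RG)%MS /\ {in G, forall g, iota (gcoef e g) =
    #|Y|%:R^-1 * ext0 Y (fun y => \sum_(i < D) th y ^+ (q ^ i)) g^-1%g}.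

(** No repetition within the first [D] twists: this is the half of the statement that [D] is the
    orbit length that gives [phi] the value 1 on an orbit sum. *)
Definition frobenius_free Y th D : Prop :=
  forall i, (0 < i < D)%N -> exists2 y, y \in Y & th y ^+ (q ^ i) != th y.

Lemma orbit_sum_uniq Y th D e f :
  orbit_sum Y th D e -> orbit_sum Y th D f -> e = f.
Proof.
move=> [Re De] [Rf Df]; apply: gcoef_inj => // g Gg.
by apply: (fmorph_inj iota); rewrite De // Df.
Qed.

Lemma sum_frobenius_lin_char Y th th' i : lin_char Y th -> lin_char Y th' ->
    (exists2 y, y \in Y & th y ^+ (q ^ i) != th' y) ->
  \sum_(g in Y) th g^-1%g ^+ (q ^ i) * th' g = 0.
Proof.
move=> lin_th lin_th' [y Yy thy].
apply: (@sum_lin_char _ _ _ (fun g => th g^-1%g ^+ (q ^ i) * th' g) y) => //.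
  split=> [|x z Yx Yz]; first by rewrite invg1 lin_th.1 lin_th'.1 expr1n mulr1.
  rewrite !(lin_charV lin_th) ?groupM // lin_th.2 // lin_th'.2 // invfM exprMn.
  by rewrite mulrACA.
have nz_thy := lin_char_neq0 lin_th Yy.
rewrite (lin_charV lin_th) // exprVn; apply: contra thy => /eqP h; apply/eqP.
by rewrite -[LHS]mulr1 -h mulVKf ?expf_neq0.
Qed.

Lemma phi_orbit_sumE Y th th' D e : Y \subset G -> orbit_sum Y th D e ->
  phi (ext0 Y th') e = #|Y|%:R^-1 *
    \sum_(i < D) \sum_(g in Y) th g^-1%g ^+ (q ^ i) * th' g.
Proof.
move=> sYG [Re De]; rewrite phi_ext0 // exchange_big mulr_sumr.
apply: eq_bigr => g Yg; rewrite De ?(subsetP sYG) // ext0T ?groupV //.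
by rewrite -mulrA mulr_suml.
Qed.

Lemma phi_orbit_sum_eq0 Y th th' D e : Y \subset G -> lin_char Y th ->
    lin_char Y th' -> orbit_sum Y th D e ->
    (forall i, (i < D)%N -> exists2 y, y \in Y & th y ^+ (q ^ i) != th' y) ->
  phi (ext0 Y th') e = 0.
Proof.
move=> sYG lin_th lin_th' eP neq_th; rewrite (phi_orbit_sumE _ sYG eP).
rewrite big1 ?mulr0 // => i _; apply: sum_frobenius_lin_char => //.
exact: neq_th.
Qed.

Lemma sum_frobenius_free Y th D : lin_char Y th -> (0 < D)%N ->
    frobenius_free Y th D ->
  \sum_(i < D) \sum_(g in Y) th g^-1%g ^+ (q ^ i) * th g = #|Y|%:R.
Proof.
move=> lin_th D0 freeD.
rewrite (bigD1 (Ordinal D0)) //= [X in _ + X]big1 ?addr0 => [|i ni0].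
  rewrite (eq_bigr (fun=> 1)) => [|g Yg]; first by rewrite sumr_const.
  by rewrite expn0 expr1 (lin_charV lin_th) // mulVf ?(lin_char_neq0 lin_th).
apply: sum_frobenius_lin_char => //.
by apply: freeD; rewrite ltn_ord lt0n andbT.
Qed.

Lemma phi_orbit_sum Y th D e : Y \subset G -> lin_char Y th -> (0 < D)%N ->
  frobenius_free Y th D -> orbit_sum Y th D e -> phi (ext0 Y th) e = 1.
Proof.
move=> sYG lin_th D0 freeD eP; rewrite (phi_orbit_sumE _ sYG eP).
by rewrite sum_frobenius_free // mulVf ?(natr_group_neq0 iota sYG).
Qed.

Lemma orbit_sum_center Y th D e : central_type G Y th ->
  orbit_sum Y th D e -> (e \in 'Z(RG))%MS.
Proof.
move=> [/andP[sYG nYG] lin_th thJ _] [Re De]; apply/center_gringP; split=> //.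
move=> g h Gg Gh; apply: (fmorph_inj iota); rewrite !De ?groupJ //.
rewrite -conjVg /ext0 memJ_norm ?(subsetP nYG) //; case: ifP => // Yg.
by congr (_ * _); apply: eq_bigr => i _; rewrite thJ.
Qed.

(** Each twist is treated by applying Frobenius to [phi_shift]. The scalar [iota s] is fixed by
    Frobenius, hence common to the whole orbit. *)
Lemma central_mul_orbit_sum Y th D e f s : central_type G Y th ->
    orbit_sum Y th D e -> (f \in 'Z(RG))%MS -> phi (ext0 Y th) f = iota s ->
  f *m e = s *: e.
Proof.
move=> thP [Re De] Zf phif; have [Rf _] := (center_gringP f).1 Zf.
apply: gcoef_inj => [||g Gg]; rewrite ?gringM ?gringZ //.
apply: (fmorph_inj iota); rewrite gcoef_mul // rmorph_sum gcoefZ rmorphM De //.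
have ext_frob h i : ext0 Y th h ^+ (q ^ i) = ext0 Y (fun y =>
  th y ^+ (q ^ i)) h.
  by rewrite /ext0; case: ifP => // _; rewrite frobenius0.
have ext_sum h : ext0 Y (fun y => \sum_(i < D) th y ^+ (q ^ i)) h
    = \sum_(i < D) ext0 Y th h ^+ (q ^ i).
  under eq_bigr do rewrite ext_frob.
  by rewrite /ext0; case: ifP => // _; rewrite big1.
rewrite ext_sum mulrCA mulr_sumr.
transitivity (#|Y|%:R^-1 * \sum_(i < D) (\sum_(x in G)
    iota (gcoef f x) * ext0 Y th (g^-1 * x)%g) ^+ (q ^ i)); last first.
  congr (_ * _); apply: eq_bigr => i _; rewrite (phi_shift thP) ?groupV //.
  by rewrite phif exprMn frobenius_iota mulrC.
under [in RHS]eq_bigr do rewrite (frobenius_sum iota).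
rewrite exchange_big mulr_sumr; apply: eq_bigr => x Gx.
rewrite rmorphM De ?groupM ?groupV // ext_sum mulrCA; congr (_ * _).
rewrite mulr_sumr; apply: eq_bigr => i _.
by rewrite exprMn frobenius_iota invMg invgK.
Qed.

Lemma phi_central_idem Y th f : central_type G Y th -> central_idem f ->
  phi (ext0 Y th) f = 0 \/ phi (ext0 Y th) f = 1.
Proof.
move=> thP [Zf ff]; have [Rf _] := (center_gringP f).1 Zf.
have /eqP := phi_mul thP Rf Zf; rewrite ff -subr_eq0 -{1}[phi _ f]mulr1 -mulrBr.
by rewrite mulf_eq0 subr_eq0 eq_sym => /orP[]/eqP; [left | right].
Qed.

(** The values 0 and 1 of [phi] at a central idempotent both come from [F], so every central
    idempotent multiplies [e] to 0 or to [e], which leaves no proper splitting. *)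
Lemma orbit_sum_primitive Y th D e : central_type G Y th -> (0 < D)%N ->
    frobenius_free Y th D -> orbit_sum Y th D e ->
  primitive_central_idem e.
Proof.
move=> thP D0 freeD eP; have [/andP[sYG _] lin_th _ _] := thP.
have Ze := orbit_sum_center thP eP.
have phie := phi_orbit_sum sYG lin_th D0 freeD eP.
split.
- split=> //; rewrite (central_mul_orbit_sum (s := 1) thP eP) ?scale1r //.
  by rewrite rmorph1.
- by apply: contraTneq isT => e0; move: phie; rewrite e0 phi0 => /esym/eqP;
     rewrite oner_eq0.
have mul_e f : central_idem f -> f *m e = 0 \/ f *m e = e.
  move=> fI; have [Zf _] := fI.
  case: (phi_central_idem thP fI) => phif; [left | right].
    by rewrite (central_mul_orbit_sum (s := 0) thP eP) ?scale0r ?rmorph0.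
  by rewrite (central_mul_orbit_sum (s := 1) thP eP) ?scale1r ?rmorph1.
move=> f g fI gI fg0 De;
  have fe : f *m e = f by rewrite De mulmxDr fI.2 fg0 addr0.
case: (mul_e f fI); rewrite fe => Df; first by left.
by right; apply: (addrI f); rewrite -De addr0.
Qed.

(** The value of [phi] at [f] must be 1, so [f] acts as the identity on [e]; then [f] is the
    orthogonal sum of [e] and [f - e], and its primitivity kills the second part. *)
Lemma primitive_eq_orbit_sum Y th D e f : central_type G Y th -> (0 < D)%N ->
    frobenius_free Y th D -> orbit_sum Y th D e ->
  primitive_central_idem f -> phi (ext0 Y th) f != 0 -> f = e.
Proof.
move=> thP D0 freeD eP [fI _ f_prim] phif.
have [[Ze ee] nz_e _] := orbit_sum_primitive thP D0 freeD eP.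
have phif1 : phi (ext0 Y th) f = iota 1.
  by rewrite rmorph1; case: (phi_central_idem thP fI) phif => -> //;
    rewrite eqxx.
have fe := central_mul_orbit_sum thP eP fI.1 phif1; rewrite scale1r in fe.
have cef : e *m f = e.
  move: fI.1; rewrite sub_capmx => /andP[_ /cent_mxP cf].
  by rewrite cf ?fe //; case: eP.
have gI : central_idem (f - e).
  split; first by rewrite linearB addmx_sub ?eqmx_opp ?Ze //; case: fI.
  by rewrite mulmxBl !mulmxBr fI.2 fe cef ee subrr subr0.
case: (f_prim e (f - e)) => // [|||Df].
- by rewrite mulmxBr cef ee subrr.
- by rewrite addrC subrK.
- by move=> e0; rewrite e0 eqxx in nz_e.
by apply/eqP; rewrite -subr_eq0 Df.
Qed.

End OrbitSums.

(** * Frobenius orbits of roots of unity and of characters *)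

Lemma eq_prim_root_frobenius (F : finFieldType) (R : fieldType) (m d : nat)
    (z : R) : coprime m #|F| -> m.-primitive_root z ->
  (z ^+ (#|F| ^ d) == z) = (#[unitZ m #|F|]%g %| d)%N.
Proof.
move=> co_mq prim_z.
rewrite (order_unitZ _ (prim_order_gt0 prim_z)) // -(eq_prim_root_expr prim_z).
by rewrite expr1.
Qed.

Lemma natr_coprime_card (F : finFieldType) m :
  (0 < m)%N -> coprime m #|F| -> m%:R != 0 :> F.
Proof.
move=> m0 co_mq; have [p0 p0_pr charF] := finPcharP F.
rewrite -(dvdn_pcharf charF); apply/negP => p0m.
have := finNzRing_gt1 F; move: co_mq; rewrite (card_pprimeChar charF).
case: (logn _ _) => [|k]; first by rewrite expn0.
by rewrite coprime_sym coprime_pexpl // prime_coprime // p0m.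
Qed.

Lemma sum_periodic (R : nmodType) (f : nat -> R) (D s : nat) :
  (forall i, f (i + D)%N = f i) ->
  \sum_(i < s * D) f i = (\sum_(i < D) f i) *+ s.
Proof.
move=> fD; elim: s => [|s IHs]; first by rewrite mul0n big_ord0.
rewrite mulSn big_split_ord mulrS; congr (_ + _); rewrite -IHs.
by apply: eq_bigr => i _; rewrite -(fD i); congr f; apply: addnC.
Qed.

Lemma sum_shift (R : nmodType) (f : nat -> R) (D j : nat) :
    (forall i, f (i + D)%N = f i) ->
  \sum_(i < D) f (i + j)%N = \sum_(i < D) f i.
Proof.
move=> fD; elim: j => [|j IHj]; first by under eq_bigr do rewrite addn0.
rewrite -{}IHj; case: D fD => [|d] fD; first by rewrite !big_ord0.
rewrite big_ord_recr [RHS]big_ord_recl addrC /=; congr (_ + _).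
  by apply: eq_bigr => i _; rewrite /bump leq0n add1n addSn addnS.
by rewrite addnS -addSn addnC fD.
Qed.

Section PrimitiveCharacters.

Variables (F : finFieldType) (Fbar : fieldType) (gT : finGroupType).
Implicit Types (Y : {group gT}) (th : gT -> Fbar).
Local Notation q := #|F|.

Definition has_order (Y : {set gT}) th m : Prop :=
  (exists2 y, y \in Y & m.-primitive_root (th y)) /\
  {in Y, forall y, th y ^+ m = 1}.

Lemma has_order_frobenius Y th m : coprime m q -> has_order Y th m ->
  [/\ (0 < #[unitZ m q]%g)%N,
      frobenius_free F Y th #[unitZ m q]%g &
      {in Y, forall y, th y ^+ (q ^ #[unitZ m q]%g) = th y}].
Proof.
move=> co_mq [[y Yy prim_y] thm]; split; first exact: order_gt0.
  move=> i /andP[i0 ltiD]; exists y => //.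
  by rewrite (eq_prim_root_frobenius _ co_mq prim_y) gtnNdvd.
move=> x Yx; have [r ->] := prim_rootP prim_y (thm x Yx).
rewrite -exprM mulnC exprM; congr (_ ^+ _).
by apply/eqP; rewrite (eq_prim_root_frobenius _ co_mq prim_y).
Qed.

End PrimitiveCharacters.

(** * Idempotents of strong Shoda pairs *)

Section Epsilon.

Variables (F : finFieldType) (Fbar : fieldType) (iota : {rmorphism F -> Fbar}).
Hypothesis algFbar : integralRange iota.
Variable xi : nat -> Fbar.
Hypothesis xi_prim : forall m, coprime m #|F| -> m.-primitive_root (xi m).
Local Notation q := #|F|.

Lemma trace_root m x : coprime m q -> x ^+ m = 1 ->
  iota (trace iota (xi m) x) = \sum_(i < #[unitZ m q]%g) x ^+ (q ^ i).
Proof.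
move=> co_mq xm; have prim_xi := xi_prim co_mq.
have [r ->] := prim_rootP prim_xi xm; apply: traceX; first exact: algFbar.
by move=> d; apply: eq_prim_root_frobenius.
Qed.

Variables (gT : finGroupType) (G : {group gT}).
Hypothesis coGq : coprime #|G| q.
Local Notation aG := (regular_repr F G).
Local Notation RG := (group_ring F G).
Implicit Types (H K Y : {group gT}).

Lemma coprime_indexg H K : H \subset G -> coprime #|H : K| q.
Proof.
by move=> sHG; apply: coprime_dvdl coGq;
  apply: dvdn_trans (dvdn_indexg H K) (cardSg sHG).
Qed.

Lemma nzG : #|G|%:R != 0 :> F.
Proof. exact: natr_coprime_card. Qed.

Lemma hat_gring K : K \subset G -> (hat F G K \in RG)%MS.
Proof.
move=> /subsetP sKG; apply/gringZ/gring_sum => x Kx.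
by apply: gring_repr; apply: sKG.
Qed.

Lemma gcoef_hat K g : K \subset G -> g \in G ->
  gcoef (hat F G K) g = #|K|%:R^-1 * (g \in K)%:R.
Proof.
move=> /subsetP sKG Gg; rewrite gcoefZ gcoef_sum; congr (_ * _).
have [Kg | nKg] := boolP (g \in K).
  rewrite (bigD1 g) //= gcoef_repr ?(sKG g) // eqxx big1 ?addr0 // =>
    x /andP[Kx nxg].
  by rewrite gcoef_repr ?(sKG x) ?(sKG g) // eq_sym (negPf nxg).
rewrite big1 // => x Kx; rewrite gcoef_repr ?(sKG x) //.
by case: (eqVneq g x) nKg => [->|_ _ //]; rewrite Kx.
Qed.

Lemma gcoef_hat_mul K (I : finType) (P : pred I) (t : I -> F) (h : I -> gT) g :
    K \subset G -> (forall i, P i -> h i \in G) -> g \in G ->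
  gcoef (hat F G K *m \sum_(i | P i) t i *: aG (h i)^-1%g) g =
    #|K|%:R^-1 * \sum_(i | P i && (g * h i \in K)%g) t i.
Proof.
move=> sKG Gh Gg; rewrite mulmx_sumr gcoef_sum mulr_sumr big_mkcondr /=.
apply: eq_bigr => i Pi;
  rewrite -scalemxAr gcoefZ gcoef_mulr ?hat_gring ?groupV ?Gh //.
have Ggh : (g * h i)%g \in G by rewrite groupM ?Gh.
by rewrite invgK gcoef_hat //; case: ifP; rewrite ?mulr1 ?mulr0 // mulrC.
Qed.

Lemma hat_mul_gring K (I : finType) (P : pred I) (t : I -> F) (h : I -> gT) :
    K \subset G -> (forall i, P i -> h i \in G) ->
  (hat F G K *m \sum_(i | P i) t i *: aG (h i)^-1%g \in RG)%MS.
Proof.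
move=> sKG Gh; rewrite gringM ?hat_gring ?gring_sum // => i Pi.
by rewrite gringZ ?gring_repr ?groupV ?Gh.
Qed.

Section Pair.

Variables (H K : {group gT}) (chi : coset_of K -> Fbar).
Hypotheses (nHG : H <| G) (nKH : K <| H) (cHK : cyclic (H / K)%g).
Hypothesis chiP : faithful_char H chi.
Local Notation lam := (fun h => chi (coset K h)).
Local Notation m := #|H : K|.
Local Notation D := #[unitZ m q]%g.
Local Notation eps := (epsilon iota xi G H chi).

Let sHG : H \subset G := normal_sub nHG.
Let sKH : K \subset H := normal_sub nKH.
Let sKG : K \subset G := subset_trans sKH sHG.

Lemma faithful_char_lin : lin_char (H / K)%g chi.
Proof.
case: chiP => chiM chi_neq0 _; split=> //.
by apply: (mulfI (chi_neq0 1%g (group1 _))); rewrite mulr1 -chiM ?mulg1.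
Qed.

Lemma faithful_char_lift : lin_char H lam.
Proof.
have [chi1 chiM] := faithful_char_lin; have /andP[_ nKH'] := nKH.
split=> [|x y Hx Hy]; first by rewrite /= morph1.
by rewrite /= morphM ?(subsetP nKH') // chiM ?mem_quotient.
Qed.

Lemma faithful_char_ker h : h \in H -> (lam h == 1) = (h \in K).
Proof.
move=> Hh; have [chi1 _] := faithful_char_lin; case: chiP => _ _ chiI.
have Nh := subsetP (normal_norm nKH) h Hh.
rewrite /= -chi1 (inj_in_eq chiI) ?mem_quotient ?group1 //.
apply/eqP/idP => [/coset_idr-> // | /coset_id //].
Qed.

Lemma faithful_char_order : has_order H lam m.
Proof.
have lin_chi := faithful_char_lin;
  have om : #|H / K|%g = m by apply: card_quotient; apply: normal_norm.
split; last first.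
  move=> h Hh; rewrite -(lin_charX _ lin_chi) ?mem_quotient // -om.
  by rewrite expg_cardG ?mem_quotient // lin_chi.1.
have [xb defHK] := cyclicP cHK;
  have HKxb : xb \in (H / K)%g by rewrite defHK cycle_id.
have [h _ Hh Dxb] := morphimP HKxb; exists h => //=; rewrite -/(coset K h) -Dxb.
have m_gt0 : (0 < m)%N by rewrite -om.
have chim : chi xb ^+ m = 1 by rewrite -(lin_charX _ lin_chi) // -om expg_cardG
  // lin_chi.1.
have [d prim_d dv_dm] := prim_order_exists m_gt0 chim.
suffices -> : m = d by [].
apply/eqP; rewrite eqn_dvd dv_dm andbT -om defHK -[#|_|]/(#[xb]%g) order_dvdn.
case: chiP => _ _ chiI; apply/eqP/chiI; rewrite ?groupX ?group1 //.
by rewrite (lin_charX _ lin_chi) // (prim_expr_order prim_d) lin_chi.1.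
Qed.

(** For a given [g] at most one coset contributes, that of [g^-1]; the factors 1/[H:K] and 1/|K|
    merge into 1/|H|, and the trace unfolds into the Frobenius orbit. *)
Lemma epsilon_orbit_sum : orbit_sum iota H lam D eps.
Proof.
have [chi1 chiM] := faithful_char_lin; have [_ lam_m] := faithful_char_order.
have om : #|H / K|%g = m by apply: card_quotient; apply: normal_norm.
have NH := subsetP (normal_norm nKH).
have Hrepr hb : hb \in (H / K)%g -> repr hb \in H.
  case/morphimP=> h Nh Hh ->; have := mem_repr_coset (coset K h).
  rewrite val_coset // => /rcosetP[k Kk ->].
  by rewrite groupM // (subsetP sKH).
have Grepr hb : hb \in (H / K)%g -> repr hb \in G by move/Hrepr/(subsetP sHG).
split; first by rewrite gringZ ?hat_mul_gring.
move=> g Gg; rewrite gcoefZ gcoef_hat_mul // !rmorphM !fmorphV !rmorph_nat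
  mulrA.
rewrite -invfM -natrM mulnC Lagrange //; congr (_ * _).
rewrite /ext0 groupV; case: ifPn => [Hg | nHg]; last first.
  rewrite big1 ?rmorph0 // => hb /andP[HKhb] Kgh; case/negP: nHg.
  by rewrite -(groupMr g (Hrepr _ HKhb)) (subsetP sKH).
rewrite (big_pred1 (coset K g^-1%g)) => [|hb].
  rewrite trace_root ?coprime_indexg //.
  by have := lam_m g^-1%g; rewrite groupV; apply.
have Ng : g^-1%g \in 'N(K)%g by rewrite NH ?groupV.
rewrite /= [RHS]eq_sym; apply/andP/eqP=> [[HKhb Kgh] | <-].
  rewrite -(coset_reprK hb).
  apply/rcoset_kercosetP; rewrite ?NH ?groupV ?Hrepr //.
  by rewrite mem_rcoset -groupV invMg !invgK -(memJ_norm _ Ng) conjgE invgK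
    !mulgA mulgK.
rewrite mem_quotient ?groupV //; split=> //.
have := mem_repr_coset (coset K g^-1%g);
  rewrite val_coset // => /rcosetP[k Kk ->].
by move: Kk; rewrite -(memJ_norm k Ng) conjgE invgK.
Qed.

End Pair.

End Epsilon.

(** * Conjugates of an idempotent and their sum *)

Section ConjGalg.

Variables (F : finFieldType) (gT : finGroupType) (G : {group gT}).
Local Notation aG := (regular_repr F G).
Local Notation RG := (group_ring F G).
Implicit Type e : galg F G.

Lemma conj_gring e g : (e \in RG)%MS -> g \in G -> (conj_galg e g \in RG)%MS.
Proof. by move=> Re Gg; rewrite !gringM ?gring_repr ?groupV. Qed.

Lemma gcoef_conj e g x : (e \in RG)%MS -> g \in G -> x \in G ->
  gcoef (conj_galg e g) x = gcoef e (x ^ g^-1)%g.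
Proof.
move=> Re Gg Gx; rewrite gcoef_mulr ?gringM ?gring_repr ?groupV //.
by rewrite gcoef_mull ?groupM ?groupV // conjgE !invgK.
Qed.

Lemma conj_galgM e g h : g \in G -> h \in G ->
  conj_galg (conj_galg e g) h = conj_galg e (g * h).
Proof.
move=> Gg Gh; rewrite /conj_galg invMg !repr_mxM ?groupV //.
by rewrite !mulmxA.
Qed.

Lemma conj_galg1 e : conj_galg e 1 = e.
Proof. by rewrite /conj_galg invg1 !repr_mx1 mul1mx mulmx1. Qed.

End ConjGalg.

Section EssP.

Variables (F : finFieldType) (Fbar : fieldType) (iota : {rmorphism F -> Fbar}).
Hypothesis algFbar : integralRange iota.
Variable xi : nat -> Fbar.
Hypothesis xi_prim : forall m, coprime m #|F| -> m.-primitive_root (xi m).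
Local Notation q := #|F|.
Variables (gT : finGroupType) (G : {group gT}).
Hypothesis coGq : coprime #|G| q.
Local Notation aG := (regular_repr F G).
Local Notation RG := (group_ring F G).
Variables (H K : {group gT}) (chi : coset_of K -> Fbar).
Hypotheses (nHG : H <| G) (nKH : K <| H) (cHK : cyclic (H / K)%g).
Hypothesis chiP : faithful_char H chi.
Local Notation lam := (fun h => chi (coset K h)).
Local Notation D := #[unitZ #|H : K| q]%g.
Local Notation eps := (epsilon iota xi G H chi).
Local Notation S := [set conj_galg eps g | g in G].
Local Notation E := (e_ssp iota xi G H chi).

Let sHG : H \subset G := normal_sub nHG.
Let lin_lam : lin_char H lam := faithful_char_lift nKH chiP.
Let lam_order : has_order H lam #|H : K| := faithful_char_order nKH cHK chiP.
Let coHKq : coprime #|H : K| q := coprime_indexg coGq K sHG.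
Let epsP : orbit_sum iota H lam D eps.
Proof. exact: epsilon_orbit_sum. Qed.

Let Reps : (eps \in RG)%MS. Proof. by case: epsP. Qed.

Lemma conjs_gring e : e \in S -> (e \in RG)%MS.
Proof. by case/imsetP=> g Gg ->; apply: conj_gring. Qed.

Lemma e_ssp_gring : (E \in RG)%MS.
Proof. by apply: gring_sum => e; apply: conjs_gring. Qed.

Lemma e_sspJ g : g \in G -> E = \sum_(e in S) conj_galg e g.
Proof.
move=> Gg; rewrite -(big_imset id) /=; last first.
  move=> _ _ /imsetP[h Gh ->] /imsetP[k Gk ->] eq_hk.
  have := congr1 (fun e => conj_galg e g^-1) eq_hk.
  by rewrite /= !conj_galgM ?groupM ?groupV // mulgV !mulg1.
apply: eq_bigl => e; apply/imsetP/imsetP => [[h Gh ->]|[_ /imsetP[h Gh ->] ->]].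
  exists (conj_galg eps (h * g^-1)); first by rewrite imset_f ?groupM ?groupV.
  by rewrite conj_galgM ?groupM ?groupV // mulgKV.
by exists (h * g)%g; rewrite ?groupM // conj_galgM.
Qed.

Lemma gcoef_e_sspJ x g : x \in G -> g \in G -> gcoef E (x ^ g)%g = gcoef E x.
Proof.
move=> Gx Gg; have Gg' : g^-1%g \in G by rewrite groupV.
rewrite [in RHS](e_sspJ Gg') !gcoef_sum; apply: eq_bigr => e Se.
by rewrite gcoef_conj ?conjs_gring // invgK.
Qed.

(** All conjugates have the same average over the class of [x] as [eps] itself, so only their number
    [#|S|] enters and the stabiliser of [eps] need not be known. *)
Lemma card_coef_e_ssp x : x \in G ->
  #|G|%:R * gcoef E x = #|S|%:R * \sum_(g in G) gcoef eps (x ^ g)%g.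
Proof.
move=> Gx; transitivity (\sum_(g in G) gcoef E (x ^ g)%g).
  rewrite (eq_bigr (fun=> gcoef E x)) ?sumr_const ?mulr_natl // => g Gg.
  exact: gcoef_e_sspJ.
rewrite (eq_bigr (fun g => \sum_(e in S) gcoef e (x ^ g)%g)) => [|g Gg];
  last first.
  by rewrite gcoef_sum.
rewrite exchange_big /= mulr_natl -sumr_const;
  apply: eq_bigr => e /imsetP[h Gh ->].
rewrite -(sum_mulgr (fun g => gcoef eps (x ^ g)%g) (groupVr Gh)).
by apply: eq_bigr => g Gg; rewrite gcoef_conj ?groupJ // conjgM.
Qed.

Let memHJ x g : g \in G -> (x ^ g \in H)%g = (x \in H).
Proof. by move=> Gg; rewrite memJ_norm // (subsetP (normal_norm nHG)). Qed.

Lemma phi_eps : phi iota (ext0 H lam) eps = 1.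
Proof.
have [D0 freeD _] := has_order_frobenius coHKq lam_order.
exact: (phi_orbit_sum (nzG coGq) sHG lin_lam D0 freeD epsP).
Qed.

Lemma frobenius_shift x j : x \in H ->
  \sum_(i < D) lam x ^+ (q ^ (i + j)) = \sum_(i < D) lam x ^+ (q ^ i).
Proof.
have [_ _ lamD] := has_order_frobenius coHKq lam_order => Hx.
apply: (sum_shift j (f := fun i => lam x ^+ (q ^ i))) => i.
by rewrite addnC expnD exprM lamD.
Qed.

(** Either some Frobenius twist of the conjugate character is [lam], and then the two orbits and
    hence the two idempotents coincide, or each of the [D] sums vanishes by orthogonality. *)
Lemma phi_conj_eps e : e \in S -> e != eps -> phi iota (ext0 H lam) e = 0.
Proof.
case/imsetP=> g Gg -> neq_e.
rewrite phi_ext0 //; have Gg' : g^-1%g \in G by rewrite groupV.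
pose mu i h := lam (h^-1 ^ g^-1)%g ^+ (q ^ i) * lam h.
transitivity (#|H|%:R^-1 * \sum_(i < D) \sum_(h in H) mu i h).
  rewrite exchange_big mulr_sumr; apply: eq_bigr => h Hh.
  have Gh := subsetP sHG h Hh; rewrite gcoef_conj // epsP.2 ?groupJ //.
  by rewrite -conjVg ext0T ?memHJ ?groupV // -mulrA mulr_suml.
have lin_mu i : lin_char H (mu i).
  have lamV : {in H, forall h, lam (h^-1 ^ g^-1)%g = (lam (h ^ g^-1)%g)^-1}.
    by move=> h Hh; rewrite conjVg (lin_charV lin_lam) ?memHJ.
  split=> [|x y Hx Hy];
    first by rewrite /mu invg1 conj1g lin_lam.1 expr1n mulr1.
  rewrite /mu !lamV ?groupM // conjMg (lin_lam.2 (x ^ _)%g) ?memHJ //.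
  rewrite (lin_lam.2 x) // invfM exprMn.
  by rewrite -!mulrA; congr (_ * _); rewrite mulrCA.
rewrite big1 ?mulr0 // => i _.
have [/existsP[a /andP[Ha mua]] | /existsPn no_a] :=
  boolP [exists h, (h \in H) && (mu i h != 1)].
  exact: sum_lin_char (lin_mu i) Ha mua.
case/eqP: neq_e; apply: gcoef_inj; rewrite ?conj_gring // => x Gx.
apply: (fmorph_inj iota); rewrite gcoef_conj // !epsP.2 ?groupJ //.
congr (_ * _); rewrite /ext0 -conjVg memHJ // groupV; case: ifP => // Hx.
rewrite -(frobenius_shift i) ?memHJ ?groupV //; apply: eq_bigr => j _.
have := no_a x; rewrite Hx /= negbK => /eqP mux.
have -> : lam x^-1%g = (lam x)^-1 by rewrite (lin_charV lin_lam).
rewrite addnC expnD exprM; congr (_ ^+ _).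
apply: (mulIf (lin_char_neq0 lin_lam Hx)).
by rewrite mulVf ?(lin_char_neq0 lin_lam).
Qed.

Lemma phi_e_ssp : phi iota (ext0 H lam) E = 1.
Proof.
have Seps : eps \in S by apply/imsetP; exists 1%g; rewrite ?conj_galg1.
rewrite phi_sum (bigD1 eps) //= phi_eps big1 ?addr0 // => e /andP[].
exact: phi_conj_eps.
Qed.

(* Averaging over [G] shows that [E] is a scalar multiple of the orbit sum of
  the
   character of [Y]. The scalar is 1 because [E] and this orbit sum both take
     the
   value 1 at [lam], where [eps] is the only conjugate that does not vanish. *)
Lemma e_ssp_orbit_sum (Y : {group gT}) m : central_type G Y lam ->
    Y \subset H -> has_order Y lam m -> coprime m q ->
  orbit_sum iota Y lam #[unitZ m q]%g E.
Proof.
move=> thP sYH lam_m co_mq; split; first exact: e_ssp_gring.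
set D' := #[_]%g; have [D'0 freeD' lamD'] := has_order_frobenius co_mq lam_m.
have sYG := subset_trans sYH sHG; have [_ lin_Y _ _] := thP.
(* Restriction from [H] to [Y] may shorten the Frobenius orbit; [s] counts how often the shorter one
   is run through. *)
have [s Ds] : exists s, D = (s * D')%N.
  apply/dvdnP; have [[y Yy prim_y] _] := lam_m.
  rewrite -(eq_prim_root_frobenius _ co_mq prim_y).
  have [_ _ lamD] := has_order_frobenius coHKq lam_order.
  by rewrite /= lamD // (subsetP sYH).
have nzn (X : {group gT}) : X \subset G -> #|X|%:R != 0 :> Fbar.
  exact: (natr_group_neq0 (nzG coGq) iota).
pose c : F := #|S|%:R * #|H|%:R^-1 * s%:R * #|Y|%:R.
pose h x := #|Y|%:R^-1 * ext0 Y (fun y =>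
  \sum_(i < D') lam y ^+ (q ^ i)) x^-1%g.
have gcoefE x : x \in G -> iota (gcoef E x) = iota c * h x.
  move=> Gx; apply: (mulfI (nzn _ (subxx G))).
  rewrite -{1}(rmorph_nat iota) -rmorphM card_coef_e_ssp // !rmorphM rmorph_sum
    /=.
  rewrite !rmorph_nat !fmorphV !rmorph_nat /h.
  have -> : \sum_(g in G) iota (gcoef eps (x ^ g)%g) = #|H|%:R^-1 *
      (#|G|%:R * (s%:R * ext0 Y (fun y =>
        \sum_(i < D') lam y ^+ (q ^ i)) x^-1%g)).
    rewrite (eq_bigr (fun g => #|H|%:R^-1 *
        ext0 H (fun y => \sum_(i < D) lam y ^+ (q ^ i)) (x^-1 ^ g)%g)) =>
          [|g Gg].
      rewrite -mulr_sumr; congr (_ * _).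
      rewrite (eq_bigr (fun g => \sum_(i < D)
          ext0 H lam (x^-1 ^ g)%g ^+ (q ^ i))) => [|g Gg]; last first.
        rewrite /ext0; case: ifP => // _; rewrite big1 // => i _.
        exact: frobenius0.
      rewrite exchange_big /=.
      have -> : s%:R * ext0 Y (fun y => \sum_(i < D') lam y ^+ (q ^ i)) x^-1%g
          = \sum_(i < D) ext0 Y lam x^-1%g ^+ (q ^ i).
        rewrite Ds; rewrite /ext0; case: ifP => [Yx|_]; last first.
          rewrite mulr0 big1 // => i _.
          exact: frobenius0.
        rewrite (sum_periodic _ (f := fun i =>
          lam x^-1%g ^+ (q ^ i))) ?mulr_natl //.
        by move=> i; rewrite addnC expnD exprM lamD'.
      rewrite mulr_sumr; apply: eq_bigr => i _.
      have fG : #|G|%:R ^+ (q ^ i) = #|G|%:R :> Fbar.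
        by rewrite -(rmorph_nat iota) frobenius_iota.
      rewrite -(frobenius_sum iota) -[in RHS]fG -exprMn; congr (_ ^+ _).
      have [Hx|nHx] := boolP (x^-1%g \in H).
        rewrite -(central_type_sum thP sYH nHG lin_lam Hx).
        by apply: eq_bigr => g Gg; rewrite ext0T ?memHJ.
      rewrite big1 => [|g Gg]; last by rewrite /ext0 memHJ // (negPf nHx).
      by rewrite /ext0 ifN ?mulr0 //; apply: contra nHx; apply: (subsetP sYH).
    by rewrite epsP.2 ?groupJ // conjVg.
  have := nzn _ sYG; move: #|S|%:R #|H|%:R^-1 #|G|%:R s%:R #|Y|%:R =>
    u v w t y nzy.
  rewrite !mulrA mulfK //; congr (_ * _); congr (_ * _).
  by rewrite mulrC mulrA.
have hP : phi iota (ext0 H lam) E = iota c * 1.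
  rewrite phi_ext0 //.
  transitivity (iota c * \sum_(g in Y) h g * lam g).
    rewrite mulr_sumr (bigID (mem Y)) /= addrC big1 ?add0r =>
      [|g /andP[Hg nYg]].
      apply: eq_big => [g|g /andP[Hg Yg]];
        last by rewrite gcoefE ?mulrA // (subsetP sHG).
      by apply/andP/idP => [[]|Yg]; last by rewrite (subsetP sYH).
    by rewrite gcoefE ?(subsetP sHG) // /h /ext0 groupV (negPf nYg) !mulr0
      mul0r.
  congr (_ * _).
  transitivity (#|Y|%:R^-1 *
    \sum_(i < D') \sum_(g in Y) lam g^-1%g ^+ (q ^ i) * lam g).
    rewrite exchange_big mulr_sumr; apply: eq_bigr => g Yg.
    by rewrite /h ext0T ?groupV // -mulrA mulr_suml.
  by rewrite sum_frobenius_free // mulVf ?nzn.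
by move=> g Gg; rewrite gcoefE // -[X in X * _]mulr1 -hP phi_e_ssp mul1r.
Qed.

End EssP.

(* If [char F] divided [|G|], the fixed line spanned by the all-one row would
   have no complement: the sum of all [g] maps any complement into it. *)
Lemma semisimple_coprime (F : finFieldType) (gT : finGroupType) (G : {group
  gT}) :
  semisimple_galg F G -> coprime #|G| #|F|.
Proof.
move=> ssG; have [p0 p0_pr charF] := finPcharP F.
rewrite (card_pprimeChar charF) coprimeXr // coprime_sym prime_coprime //.
rewrite (dvdn_pcharf charF); apply/negP => /eqP G0.
pose s := gset_mx F G G; pose v := gring_row s.
have [W modW defV /mxdirect_addsP UW0] :=
  ssG _ (rfix_mx_module (regular_repr F G)) (submx1 _).
have fix_s u : (u <= rfix_mx (regular_repr F G) G)%MS -> u *m s = 0 :>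
  'rV_(gcard G).
  move/rfix_mxP => fix_u; rewrite mulmx_sumr (eq_bigr _ fix_u) sumr_const.
  by rewrite -scaler_nat G0 scale0r.
have Uv : (v <= rfix_mx (regular_repr F G) G)%MS by rewrite rfix_regular.
have Wv : (v <= W)%MS.
  have /sub_addsmxP[[u w] /= Dr] : (gring_row 1%:M <= rfix_mx (regular_repr F
    G) G + W)%MS.
    by rewrite defV submx1.
  have -> : v = w *m W *m s.
    rewrite /v -{1}[s]mul1mx gring_row_mul Dr mulmxDl.
    by rewrite (fix_s _ (submxMl u _)) add0r.
  rewrite mulmx_sumr summx_sub // => x Gx.
  exact: (mxmodule_trans modW Gx (submxMl _ _)).
have : (v <= (0 : 'M_(gcard G)))%MS by rewrite -UW0 sub_capmx Uv.
rewrite submx0 => /eqP/rowP/(_ (gring_index G 1)); rewrite !mxE.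
rewrite -/(gcoef s 1) gcoef_sum (bigD1 1%g) //= gcoef_repr // eqxx.
rewrite big1 ?addr0 => [/eqP|x /andP[Gx nx1]]; first by rewrite oner_eq0.
by rewrite gcoef_repr // eq_sym (negPf nx1).
Qed.

(** * Characters of cyclic sections *)

Section CyclicCharacters.

Variable Fbar : fieldType.

Lemma expr1_neq0 n (z : Fbar) : (0 < n)%N -> z ^+ n = 1 -> z != 0.
Proof.
move=> n0 zn; apply: contra_neq (oner_neq0 Fbar) => z0.
by rewrite -zn z0 expr0n gtn_eqF.
Qed.

Lemma cyclic_char (gT : finGroupType) (x : gT) (z : Fbar) :
    z ^+ #[x]%g = 1 ->
  exists chi : gT -> Fbar, forall i, chi (x ^+ i)%g = z ^+ i.
Proof.
move=> z1.
exists (fun y => if [pick i : 'I_#[x]%g | (x ^+ i)%g == y] is Some i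
                 then z ^+ i else 1) => i.
case: pickP => [j|/(_ (Ordinal (ltn_pmod i (order_gt0 x))))].
  rewrite eq_expg_mod_order => /eqP ij.
  by rewrite -(expr_mod i z1) -ij expr_mod.
by rewrite /= expg_mod_order eqxx.
Qed.

Lemma faithful_char_ex (gT : finGroupType) (H K : {group gT}) x (z : Fbar) :
    K <| H -> (H / K = <[coset K x]>)%g -> #|H : K|.-primitive_root z ->
  exists2 chi : coset_of K -> Fbar, faithful_char H chi &
    forall i, chi (coset K x ^+ i)%g = z ^+ i.
Proof.
move=> nKH defHK prim_z; have om : #[coset K x]%g = #|H : K|.
  by rewrite orderE -defHK card_quotient ?normal_norm.
have [chi chiX] := cyclic_char (etrans (congr1 _ om) (prim_expr_order prim_z)).
exists chi => //; rewrite /faithful_char defHK; split.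
- move=> _ _ /cycleP[i ->] /cycleP[j ->].
  by rewrite -expgD !chiX exprD.
- move=> _ /cycleP[i ->]; rewrite chiX expf_neq0 //.
  exact: expr1_neq0 (prim_order_gt0 prim_z) (prim_expr_order prim_z).
move=> _ _ /cycleP[i ->] /cycleP[j ->] /eqP.
by rewrite !chiX (eq_prim_root_expr prim_z) -om -eq_expg_mod_order => /eqP.
Qed.

(** Reduction of [k] modulo [N] makes the exponent natural, and keeps it prime to [p] because [p]
    divides [N]. *)
Lemma exprz_nat (p N : nat) (k : int) : (0 < N)%N -> (p %| N)%N -> coprimez k p
  ->
  exists2 k' : nat, coprime k' p & forall x : Fbar, x ^+ N = 1 -> x ^ k = x ^+
    k'.
Proof.
move=> N0 pN co_kp; have nzN : N%:Z != 0 by rewrite -lt0n.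
have [k' Dk] : exists k' : nat, (k %% N)%Z = k'.
  by exists `|(k %% N)%Z|%N; rewrite gez0_abs ?modz_ge0.
have kE : k = (k %/ N)%Z * N + k' by rewrite -Dk -divz_eq.
exists k' => [|x xN].
  move: co_kp; rewrite kE /coprimez /gcdz => co_kp.
  have [c Dc] := dvdnP pN.
  move: co_kp; rewrite Dc PoszM mulrA -[X in (X == 1)%R]/(gcdz _ _) -[gcdz _
    _]gcdzC.
  by rewrite gcdzMDl gcdzC.
rewrite {1}kE expfzDr ?(expr1_neq0 N0) //.
by rewrite mulrC -exprz_exp mulrC exprzAC;
  rewrite -[x ^ N]/(x ^+ N) xN exp1rz mul1r.
Qed.

Variable gT : finGroupType.
Implicit Types (A H K : {group gT}).

Definition faithful (A : {set gT}) (th : gT -> Fbar) : Prop :=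
  {in A, forall x, th x = 1 -> x = 1%g}.

Lemma faithful_prim_root x th : lin_char <[x]> th -> faithful <[x]> th ->
  #[x]%g.-primitive_root (th x).
Proof.
move=> lin_th th1; have thX n : th (x ^+ n)%g = th x ^+ n.
  by rewrite (lin_charX _ lin_th) ?cycle_id.
have thx : th x ^+ #[x]%g = 1 by rewrite -thX expg_order lin_th.1.
have [d prim_d dv_d] := prim_order_exists (order_gt0 x) thx.
suffices -> : #[x]%g = d by [].
apply/eqP; rewrite eqn_dvd dv_d andbT order_dvdn; apply/eqP/th1.
  exact: mem_cycle.
by rewrite thX prim_expr_order.
Qed.

Lemma faithful_has_order A th : cyclic A -> lin_char A th -> faithful A th ->
  has_order A th #|A|.
Proof.
case/cyclicP=> x defA lin_th th1; split; last first.
  by move=> y Ay; rewrite -(lin_charX _ lin_th) // expg_cardG // lin_th.1.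
exists x; first by rewrite defA cycle_id.
by rewrite defA in lin_th th1 *; apply: faithful_prim_root.
Qed.

(** At a generator both values are primitive roots of the same order, so one is a power of the other
    with an exponent prime to that order. *)
Lemma faithful_power A th th0 (p : nat) : cyclic A -> p.-group A ->
    lin_char A th -> lin_char A th0 -> faithful A th -> faithful A th0 ->
  exists2 k, coprime k p & {in A, forall x, th x = th0 x ^+ k}.
Proof.
case/cyclicP=> x -> px lin_th lin_th0 th1 th01.
have prim_x := faithful_prim_root lin_th th1.
have prim0_x := faithful_prim_root lin_th0 th01.
have [k Dx] := prim_rootP prim0_x (prim_expr_order prim_x).
have [p_x | p'x] := boolP (p %| #[x])%N; last first.
  (* Here the [p]-group is trivial, and any exponent prime to [p] serves. *)
  exists 1%N; rewrite ?coprime1n // => y xy; rewrite expr1.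
  have x1 : x = 1%g.
    apply/eqP; rewrite -order_eq1; apply: contraR p'x => nt_x.
    have [e De] := p_natP px; move: nt_x; rewrite orderE De.
    by case: e {De} => // e _; rewrite expnS dvdn_mulr.
  by move: xy; rewrite x1 cycle1 => /set1P->; rewrite lin_th.1 lin_th0.1.
exists k.
  apply: coprime_dvdr p_x _.
  by rewrite -(prim_root_exp_coprime k prim0_x) -Dx.
move=> _ /cycleP[i ->].
by rewrite (lin_charX _ lin_th) ?cycle_id // (lin_charX _ lin_th0) ?cycle_id //
  Dx exprAC.
Qed.

Lemma faithful_char_faithful H K (chi : coset_of K -> Fbar) :
  faithful_char H chi -> {in (H / K)%g, forall x, chi x = 1 -> x = 1%g}.
Proof.
move=> chiP; have [chi1 _] := faithful_char_lin chiP; case: chiP => _ _ chiI.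
by move=> x Hx chix; apply: chiI; rewrite ?group1 // chi1.
Qed.

Lemma faithful_char_exp H K (chi : coset_of K -> Fbar) k :
    coprime k #|(H / K)%g| -> faithful_char H chi ->
  faithful_char H (fun h => chi h ^+ k).
Proof.
move=> co_k chiP; have lin_chi := faithful_char_lin chiP.
have [chiM chi0 chiI] := chiP; split=> [x y Hx Hy|x Hx|x y Hx Hy].
- by rewrite chiM // exprMn.
- by rewrite expf_neq0 ?chi0.
rewrite -!(lin_charX _ lin_chi) // => /chiI eq_xy.
rewrite coprime_sym in co_k.
by rewrite -(expgK co_k Hx) eq_xy ?groupX // expgK.
Qed.

End CyclicCharacters.

(** * Idempotents of linear and of nonlinear pairs *)

Lemma not_center_commg (gT : finGroupType) (G : {group gT}) y :
  y \in G -> y \notin 'Z(G)%g -> exists2 g, g \in G & [~ y, g]%g != 1%g.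
Proof.
move=> Gy nZy; apply/exists_inP; apply: contraR nZy.
rewrite negb_exists_in => /forall_inP cy.
by apply/centerP; split=> // g /cy; rewrite negbK => /commgP.
Qed.

Section IdemOfPair.

Variables (F : finFieldType) (Fbar : fieldType) (iota : {rmorphism F -> Fbar}).
Hypothesis algFbar : integralRange iota.
Variable xi : nat -> Fbar.
Hypothesis xi_prim : forall m, coprime m #|F| -> m.-primitive_root (xi m).
Local Notation q := #|F|.
Variables (gT : finGroupType) (G : {group gT}).
Hypothesis coGq : coprime #|G| q.
Local Notation aG := (regular_repr F G).
Local Notation RG := (group_ring F G).
Implicit Types (H K Y : {group gT}).

Lemma e_ssp_ext H K (chi chi' : coset_of K -> Fbar) :
    {in (H / K)%g, chi =1 chi'} ->
  e_ssp iota xi G H chi = e_ssp iota xi G H chi'.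
Proof.
move=> eq_chi; rewrite /e_ssp;
  suffices -> : epsilon iota xi G H chi = epsilon iota xi G H chi' by [].
by rewrite /epsilon; under eq_bigr => h Hh do rewrite eq_chi //.
Qed.

Lemma orbit_sum_ext Y th th' D e : {in Y, th =1 th'} ->
  orbit_sum iota (G := G) Y th D e -> orbit_sum iota (G := G) Y th' D e.
Proof.
move=> eq_th [Re De]; split=> // g Gg; rewrite De // /ext0.
by case: ifP => // Yg; under eq_bigr do rewrite eq_th //.
Qed.

Lemma central_type_linear (th : gT -> Fbar) : lin_char G th -> central_type G G
  th.
Proof.
move=> lin_th; split=> // [y g Gy Gg|y ->] //.
rewrite conjgE !lin_th.2 ?groupM ?groupV // (lin_charV lin_th) //.
by rewrite mulrC mulfK ?(lin_char_neq0 lin_th).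
Qed.

(** In class 2 a noncentral [y] has a nontrivial commutator, which is central, and a faithful [th]
    is not 1 there. *)
Lemma central_type_center (th : gT -> Fbar) : G^`(1)%g \subset 'Z(G)%g ->
    lin_char 'Z(G)%g th -> faithful 'Z(G)%g th ->
  central_type G 'Z(G) th.
Proof.
move=> sG'Z lin_th th1; split=> // [|y g /centerP[_ cy] Gg|y Gy].
- exact: center_normal.
- by rewrite conjgE cy // mulKg.
move=> nZy; have [g Gg ncyg] := not_center_commg Gy nZy.
have Zc : [~ y, g]%g \in 'Z(G)%g by rewrite (subsetP sG'Z) ?mem_commg.
exists g => //; split=> //; first by case/setIP: Zc.
by apply: contra ncyg => /eqP/(th1 _ Zc)->.
Qed.

Lemma linear_e_ssp K chi : K <| G -> cyclic (G / K)%g -> faithful_char G chi ->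
  orbit_sum iota (G := G) G (fun h => chi (coset K h)) #[unitZ #|G : K| q]%g
    (e_ssp iota xi G G chi).
Proof.
move=> nKG cGK chiP; have lin_chi := faithful_char_lift nKG chiP.
apply: (e_ssp_orbit_sum algFbar xi_prim coGq _ nKG cGK chiP) => //.
- exact: central_type_linear.
- exact: faithful_char_order.
exact: (coprime_indexg coGq K (subxx G)).
Qed.

(** The listed sums run over the powers of a generator instead of coset representatives; each class
    is met once, so the orbit sum is the same. All linear [chi] are allowed, to cover powers of a
    faithful one by arbitrary exponents. *)
Lemma cyclic_sum_orbit_sum H K x (chi : coset_of K -> Fbar) : H \subset G ->
    K <| H -> x \in H -> (H / K = <[coset K x]>)%g -> lin_char (H / K)%g chi ->
  orbit_sum iota (G := G) H (fun h => chi (coset K h)) #[unitZ #|H : K| q]%g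
    (#|H : K|%:R^-1 *: (hat F G K *m \sum_(r < #|H : K|)
       trace iota (xi #|H : K|) (chi (coset K x) ^+ r) *: aG (x ^- r)%g)).
Proof.
move=> sHG nKH Hx defHK lin_chi; set m := #|H : K|.
have [sKH nHK] := andP nKH; have sKG := subset_trans sKH sHG.
have om : #|H / K|%g = m by apply: card_quotient.
have ox : #[coset K x]%g = m by rewrite orderE -defHK.
have co_mq : coprime m q := coprime_indexg coGq K sHG.
have HxX i : (x ^+ i)%g \in H by rewrite groupX.
have GxX (i : 'I_m) : true -> (x ^+ i)%g \in G by move=> _;
  apply: (subsetP sHG).
split; first by rewrite gringZ ?hat_mul_gring.
move=> g Gg; rewrite gcoefZ gcoef_hat_mul // !rmorphM !fmorphV !rmorph_nat
  mulrA.
rewrite -invfM -natrM mulnC Lagrange //; congr (_ * _).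
rewrite /ext0 groupV; case: ifPn => [Hg | nHg]; last first.
  rewrite big1 ?rmorph0 // => i /= Kgh; case/negP: nHg.
  by rewrite -(groupMr g (HxX i)) (subsetP sKH).
have [i ltim Dg] : exists2 i, (i < m)%N & coset K g^-1 = (coset K x ^+ i)%g.
  have : coset K g^-1 \in <[coset K x]>%g by rewrite -defHK mem_quotient
    ?groupV.
  by case/cyclePmin=> i; rewrite ox; exists i.
have Nx : x \in 'N(K)%g by apply: (subsetP nHK).
have Ng : g \in 'N(K)%g by apply: (subsetP nHK).
have HKx : coset K x \in (H / K)%g by rewrite mem_quotient.
have Dg' : ((coset K g)^-1 = coset K x ^+ i)%g by rewrite -Dg morphV.
rewrite (big_pred1 (Ordinal ltim)) => [|j].
  rewrite /= trace_root //; last first.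
    rewrite -(lin_charX _ lin_chi) // -(lin_charX _ lin_chi) ?groupX // -om.
    by rewrite expg_cardG ?groupX // lin_chi.1.
  by apply: eq_bigr => l _; rewrite Dg (lin_charX _ lin_chi).
rewrite -[RHS]/(j == Ordinal ltim) -val_eqE /=; apply/idP/eqP => [Kgx | -> ].
  have : coset K (g * x ^+ j) == 1%g by rewrite coset_id.
  rewrite morphM ?groupX // morphX // -eq_invg_mul Dg'.
  by rewrite eq_expg_mod_order ox !modn_small // => /eqP.
apply: coset_idr; rewrite ?groupM ?groupX // morphM ?groupX // morphX //.
by rewrite -Dg' mulgV.
Qed.

Lemma linear_idem K x (chi : coset_of K -> Fbar) k : K <| G -> x \in G ->
    (G / K = <[coset K x]>)%g -> faithful_char G chi ->
    chi (coset K x) = xi #|G : K| -> coprime k #|G : K| ->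
  e_ssp iota xi G G (fun h => chi h ^+ k) = #|G : K|%:R^-1 *: (hat F G K *m
    \sum_(r < #|G : K|) trace iota (xi #|G : K|) (xi #|G : K| ^+ (k * r))
      *: aG (x ^- r)%g).
Proof.
move=> nKG Gx defGK chiP chix co_k.
have chikP : faithful_char G (fun h => chi h ^+ k).
  by apply: faithful_char_exp chiP; rewrite card_quotient ?normal_norm.
have cGK : cyclic (G / K)%g by rewrite defGK cycle_cyclic.
apply: (orbit_sum_uniq (linear_e_ssp nKG cGK chikP)).
have := cyclic_sum_orbit_sum (subxx G) nKG Gx defGK (faithful_char_lin chikP).
by under eq_bigr do rewrite chix -exprM.
Qed.

Lemma idem_of_faithful_power H K (chi0 : coset_of K -> Fbar) (p : nat) e :
    K <| H -> cyclic (H / K)%g -> p.-group (H / K)%g -> faithful_char H chi0 ->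
  idem_of_pair iota xi H K e <-> exists2 k, coprime k p &
    e = e_ssp iota xi G H (fun h => chi0 h ^+ k).
Proof.
move=> nKH cHK pHK chi0P; split=> [[chi chiP ->] | [k co_kp ->]].
  have [k co_k Dchi] := faithful_power cHK pHK (faithful_char_lin chiP)
    (faithful_char_lin chi0P) (faithful_char_faithful chiP)
    (faithful_char_faithful chi0P).
  by exists k => //; apply: e_ssp_ext.
exists (fun h => chi0 h ^+ k) => //; apply: faithful_char_exp => //.
by have [e' ->] := p_natP pHK; rewrite coprimeXr.
Qed.

Section Nonlinear.

Hypotheses (sG'Z : G^`(1)%g \subset 'Z(G)%g) (cZ : cyclic 'Z(G)%g).

Lemma nonlinear_faithful H K (chi : coset_of K -> Fbar) : K <| H ->
    'Z(G)%g \subset H -> (K :&: 'Z(G) = 1)%g -> faithful_char H chi ->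
  lin_char 'Z(G)%g (fun h => chi (coset K h)) /\
  faithful 'Z(G)%g (fun h => chi (coset K h)).
Proof.
move=> nKH sZH KZ1 chiP; split;
  first exact: lin_charS sZH (faithful_char_lift nKH chiP).
move=> z Zz /eqP; rewrite (faithful_char_ker nKH chiP) ?(subsetP sZH) // => Kz.
by apply/set1P; rewrite -[[set _]]KZ1 inE Kz.
Qed.

Lemma nonlinear_e_ssp H K (chi : coset_of K -> Fbar) : H <| G -> K <| H ->
    cyclic (H / K)%g -> 'Z(G)%g \subset H -> (K :&: 'Z(G) = 1)%g ->
    faithful_char H chi ->
  orbit_sum iota (G := G) 'Z(G) (fun h => chi (coset K h))
    #[unitZ #|'Z(G)%g| q]%g (e_ssp iota xi G H chi).
Proof.
move=> nHG nKH cHK sZH KZ1 chiP.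
have [lin_th th1] := nonlinear_faithful nKH sZH KZ1 chiP.
apply: (e_ssp_orbit_sum algFbar xi_prim coGq nHG nKH cHK chiP) => //.
- exact: central_type_center.
- exact: faithful_has_order.
exact: coprime_dvdl (cardSg (center_sub G)) coGq.
Qed.

(** Any faithful character of H/K restricts to a faithful one of Z(G), of which [th] is a power with
    exponent prime to [p]; the same power upstairs is still faithful and restricts to [th]. *)
Lemma nonlinear_idem_ex (p : nat) H K th : p.-group G -> H <| G -> K <| H ->
    cyclic (H / K)%g -> 'Z(G)%g \subset H -> (K :&: 'Z(G) = 1)%g ->
    lin_char 'Z(G)%g th -> faithful 'Z(G)%g th ->
  exists2 e, idem_of_pair iota xi H K e &
    orbit_sum iota (G := G) 'Z(G) th #[unitZ #|'Z(G)%g| q]%g e.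
Proof.
move=> pG nHG nKH cHK sZH KZ1 lin_th th1.
have [y defHK] := cyclicP cHK.
have [x Nx [Hx Dy]] : exists2 x, x \in 'N(K)%g & x \in H /\ y = coset K x.
  have : y \in (H / K)%g by rewrite defHK cycle_id.
  by case/morphimP=> x Nx Hx Dy; exists x.
have [chi0 chi0P _] := faithful_char_ex nKH (etrans defHK (congr1 _ Dy))
  (xi_prim (coprime_indexg coGq K (normal_sub nHG))).
have [lin0 th0] := nonlinear_faithful nKH sZH KZ1 chi0P.
have [k co_kp Dth] := faithful_power cZ (pgroupS (center_sub G) pG) lin_th lin0
  th1 th0.
have chiP : faithful_char H (fun h => chi0 h ^+ k).
  apply: faithful_char_exp chi0P.
  have [e' ->] := p_natP (quotient_pgroup K (pgroupS (normal_sub nHG) pG)).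
  by rewrite coprimeXr.
exists (e_ssp iota xi G H (fun h => chi0 h ^+ k)).
  by exists (fun h => chi0 h ^+ k).
apply: orbit_sum_ext (nonlinear_e_ssp nHG nKH cHK sZH KZ1 chiP).
by move=> z Zz; rewrite Dth.
Qed.

(** The right-hand side mentions neither [H] nor [K], which makes all pairs of this kind
    equivalent. *)
Lemma nonlinear_idemP (p : nat) H K e : p.-group G -> H <| G -> K <| H ->
    cyclic (H / K)%g -> 'Z(G)%g \subset H -> (K :&: 'Z(G) = 1)%g ->
  idem_of_pair iota xi H K e <-> exists th, [/\ lin_char 'Z(G)%g th,
    faithful 'Z(G)%g th &
    orbit_sum iota (G := G) 'Z(G) th #[unitZ #|'Z(G)%g| q]%g e].
Proof.
move=> pG nHG nKH cHK sZH KZ1; split=> [[chi chiP ->] | [th [lin_th th1 eP]]].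
  have [lin_th th1] := nonlinear_faithful nKH sZH KZ1 chiP.
  by exists (fun h => chi (coset K h)); split=> //; apply: nonlinear_e_ssp.
have [f fI fP] := nonlinear_idem_ex pG nHG nKH cHK sZH KZ1 lin_th th1.
by rewrite (orbit_sum_uniq eP fP).
Qed.

End Nonlinear.

End IdemOfPair.

(** * The modular group of order [p ^ n.+1] *)

(** The structural facts drawn from the presentation. The exact action of [b] on [a] is kept apart,
    since only the explicit formula for the idempotents of (<a>, 1) relies on it. *)
Definition modular_gens (p n : nat) (gT : finGroupType) (G : {group gT})
    (a b : gT) : Prop :=
  [/\ prime p, (2 <= n)%N,
      [/\ #|G| = (p ^ n.+1)%N, #[a]%g = (p ^ n)%N & #[b]%g = p],
      (<[a]> ><| <[b]> = G)%g /\ ~~ abelian G &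
      [/\ 'Z(G) = <[a ^+ p]>, #|'Z(G)| = (p ^ n.-1)%N,
          G^`(1) = <[a ^+ (p ^ n.-1)%N]> & #|G^`(1)| = p]%g].

(** The presentation identifies G with ['Mod_(p ^ n.+1)] and so gives its order. The order forces
    [b] outside [<[a]>] and then [#[a] = p ^ n], which is what the structure theorem for modular
    groups asks of its generators. *)
Lemma modular_generators (p n : nat) (gT : finGroupType) (G : {group gT})
    (a b : gT) : prime p -> odd p -> (2 <= n)%N ->
    G \isog Grp (x : y : x ^+ (p ^ n)%N, y ^+ p,
                         x ^ y = x ^+ ((p ^ n.-1).+1)%N) ->
    <[a]> <*> <[b]> = G :> {set gT} ->
    [/\ a ^+ (p ^ n)%N = 1, b ^+ p = 1 & a ^ b = a ^+ (p ^ n.-1 + 1)%N]%g ->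
  modular_gens p n G a b.
Proof.
move=> p_pr p_odd n_ge2 isoG genG [an bp ab].
have p_gt1 := prime_gt1 p_pr.
have isoMod := @Grp_modular_group p n.+1 p_pr n_ge2.
have isoGM : G \isog 'Mod_(p ^ n.+1).
  by rewrite isogEhom isoMod -isoG homg_refl isoG -isoMod homg_refl.
have oG : #|G| = (p ^ n.+1)%N by rewrite (card_isog isoGM) card_modular_group.
have nab : a \in 'N(<[a]>)%g by rewrite (subsetP (normG _)) ?cycle_id.
have nba : <[b]>%g \subset 'N(<[a]>)%g.
  by rewrite norms_cycle ab mem_cycle.
have defG : (<[a]> * <[b]>)%g = G by rewrite -norm_joinEr.
have p_gt0 := prime_gt0 p_pr.
have oa_dv : (#[a]%g %| p ^ n)%N by rewrite order_dvdn an.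
have nt_b : b \notin <[a]>%g.
  apply: contraL (ltnSn n) => b_a; rewrite -leqNgt -(leq_exp2l _ _ p_gt1) -oG.
  rewrite -defG mulGSid ?cycle_subG // -[#|_|]/#[a]%g.
  by rewrite dvdn_leq ?expn_gt0 ?p_gt0.
have ob : #[b]%g = p by apply: nt_prime_order bp (group1_contra nt_b).
have tiab : (<[a]> :&: <[b]> = 1)%g.
  by rewrite setIC prime_TIg -?orderE ?ob // cycle_subG.
have oa : #[a]%g = (p ^ n)%N.
  apply/eqP; rewrite -(eqn_pmul2r p_gt0) -expnSr -oG -defG TI_cardMg //.
  by rewrite -[#|<[b]>%g|]/#[b]%g ob.
have [Ga Gb] : a \in G /\ b \in G.
  by apply/andP; rewrite -!cycle_subG -mulG_subG defG.
have extG : extremal_generators G p n.+1 (a, b) by split=> //; rewrite inE nt_b.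
have modG : modular_group_generators p n.+1 (a, b) by split; rewrite // -addn1.
have [[sdG nabG _] [defZ _ oZ] [defG' oG' _] _ _] :=
  @modular_group_structure p n.+1 p_pr n_ge2 _ _ _ _ extG isoGM modG.
by split.
Qed.

(** The [f r] are the coefficients of a polynomial of size at most [m] that vanishes at the [m]
    distinct powers of [z]. *)
Lemma fourier_inversion (R : fieldType) m (z : R) (f : nat -> R) :
    m.-primitive_root z -> (forall i, \sum_(r < m) f r * z ^+ (i * r) = 0) ->
  forall r, (r < m)%N -> f r = 0.
Proof.
move=> prim_z f0; pose P := \poly_(r < m) f r.
suffices P0 : P = 0.
  by move=> r ltrm; have := coef_poly m f r; rewrite ltrm -/P P0 coef0.
pose rs := [seq z ^+ i | i <- iota 0 m].
have Urs : uniq rs.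
  rewrite map_inj_in_uniq ?iota_uniq // => i j; rewrite !mem_iota !add0n /=.
  move=> lti ltj /eqP; rewrite (eq_prim_root_expr prim_z) !modn_small //.
  by move/eqP.
apply: (roots_geq_poly_eq0 (rs := rs)) Urs _; last first.
  by rewrite size_map size_iota size_poly.
apply/allP => _ /mapP[i _ ->]; rewrite /root horner_poly.
by apply/eqP; rewrite -[RHS](f0 i); apply: eq_bigr => r _; rewrite exprM.
Qed.

Lemma sum_sdprod (R : nmodType) (gT : finGroupType) (G : {group gT}) (a b : gT)
    (f : gT -> R) : (<[a]> ><| <[b]> = G)%g ->
  \sum_(g in G) f g =
    \sum_(r < #[a]%g) \sum_(s < #[b]%g) f (a ^+ r * b ^+ s)%g.
Proof.
move=> /sdprodP[_ defG _ tiab].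
transitivity (\sum_(u in setX <[a]>%g <[b]>%g) f (u.1 * u.2)%g).
  rewrite -defG -imset_mulgm big_imset /=; first by apply: eq_bigr => -[].
  by apply/imset_injP; rewrite imset_mulgm TI_cardMg // cardsX.
transitivity (\sum_(x in <[a]>%g) \sum_(y in <[b]>%g) f (x * y)%g).
  by rewrite pair_big /=; apply: eq_bigl => -[x y]; rewrite in_setX.
by rewrite big_cycle; apply: eq_bigr => r _; rewrite big_cycle.
Qed.

Section Modular.

Variables (p n : nat) (gT : finGroupType) (G : {group gT}) (a b : gT).
Hypothesis modG : modular_gens p n G a b.

Let p_pr : prime p. Proof. by case: modG. Qed.
Let n_ge2 : (2 <= n)%N. Proof. by case: modG. Qed.
Let oG : #|G| = (p ^ n.+1)%N. Proof. by case: modG => _ _ []. Qed.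
Let oa : #[a]%g = (p ^ n)%N. Proof. by case: modG => _ _ []. Qed.
Let ob : #[b]%g = p. Proof. by case: modG => _ _ []. Qed.
Let sdG : (<[a]> ><| <[b]> = G)%g. Proof. by case: modG => _ _ _ []. Qed.
Let defZ : 'Z(G)%g = <[a ^+ p]>%g. Proof. by case: modG => _ _ _ _ []. Qed.
Let defG' : G^`(1)%g = <[a ^+ (p ^ n.-1)%N]>%g.
Proof. by case: modG => _ _ _ _ []. Qed.
Let oG' : #|G^`(1)%g| = p. Proof. by case: modG => _ _ _ _ []. Qed.
Let p_gt0 : (0 < p)%N := prime_gt0 p_pr.

Lemma modular_pgroup : p.-group G.
Proof. by rewrite /pgroup oG pnatX pnat_id. Qed.

Lemma modular_mem : a \in G /\ b \in G.
Proof.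
have [_ defG _ _] := sdprodP sdG.
by apply/andP; rewrite -!cycle_subG -mulG_subG defG.
Qed.

Let Ga : a \in G. Proof. by case: modular_mem. Qed.
Let Gb : b \in G. Proof. by case: modular_mem. Qed.

Lemma modular_decomp g : g \in G -> exists r s, g = (a ^+ r * b ^+ s)%g.
Proof.
have [_ <- _ _] := sdprodP sdG.
by case/mulsgP=> _ _ /cycleP[r ->] /cycleP[s ->] ->; exists r, s.
Qed.

Lemma der1_sub_center : G^`(1)%g \subset 'Z(G)%g.
Proof.
rewrite defG' defZ cycle_subG -(ltn_predK n_ge2) -(prednK (n := n.-1)) ?expnS
  ?expgM ?mem_cycle //.
by rewrite -subn1 subn_gt0.
Qed.

Lemma center_cyclic : cyclic 'Z(G)%g.
Proof. by rewrite defZ cycle_cyclic. Qed.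

(** Inclusion of subgroups of the cyclic centre is divisibility of orders, and G' has order [p]. *)
Lemma sub_der1_center (K : {group gT}) :
  (K :&: 'Z(G))%g != 1%g -> G^`(1)%g \subset K.
Proof.
move=> ntKZ; have sIZ : (K :&: 'Z(G) \subset 'Z(G))%g := subsetIr _ _.
apply: subset_trans (subsetIl K 'Z(G)).
rewrite -(cardSg_cyclic center_cyclic) ?der1_sub_center //.
rewrite oG'; have := pgroupS (subset_trans sIZ (center_sub G)) modular_pgroup.
case/p_natP=> e oI; move: ntKZ; rewrite -cardG_gt1 oI.
by case: e {oI} => // e _; rewrite expnS dvdn_mulr.
Qed.

(* The kernel of the linear characters [th] of [G] with [th a = z] a primitive
   [p ^ j]-th root of unity and [th b = z ^- (i * p ^ j.-1)]. *)
Definition linear_ker i j : {group gT} :=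
  <<[set (a ^+ (p ^ j)%N)%g; (a ^+ (i * p ^ j.-1)%N * b)%g]>>%G.

Section LinearKer.

Variables i j : nat.
Hypotheses (j_gt0 : (0 < j)%N) (ltjn : (j < n)%N).
Local Notation K := (linear_ker i j).
Local Notation y := (a ^+ (i * p ^ j.-1)%N * b)%g.

Let Ka : (a ^+ (p ^ j)%N)%g \in K.
Proof. by rewrite mem_gen // !inE eqxx. Qed.

Let Ky : y \in K.
Proof. by rewrite mem_gen // !inE eqxx orbT. Qed.

Lemma der1_expn m : (m <= n.-1)%N -> G^`(1)%g \subset <[a ^+ (p ^ m)%N]>%g.
Proof.
move=> lemn; rewrite defG' cycle_subG -(subnKC lemn) expnD expgM.
exact: mem_cycle.
Qed.

Let le_jn : (j <= n.-1)%N. Proof. by rewrite -ltnS (ltn_predK n_ge2). Qed.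

Lemma linear_ker_normal : K <| G.
Proof.
apply: sub_der1_normal.
  by apply: subset_trans (der1_expn le_jn) _; rewrite cycle_subG.
by rewrite gen_subG; apply/subsetP=> x /set2P[]->; rewrite ?groupM ?groupX.
Qed.

Let nGK : G \subset 'N(K)%g := normal_norm linear_ker_normal.

Lemma linear_ker_quotient : (G / K = <[coset K a]>)%g.
Proof.
have Na : a \in 'N(K)%g by apply: (subsetP nGK).
rewrite -quotient_cycle //; apply/eqP; rewrite eqEsubset.
apply/andP; split; last by rewrite quotientS ?cycle_subG.
have -> : (<[a]> / K = (K <*> <[a]>) / K)%g by rewrite quotientYidl ?cycle_subG.
rewrite quotientS //.
have [_ <- _ _] := sdprodP sdG; rewrite mul_subG ?joing_subr // cycle_subG.
have -> : (b = (a ^+ (i * p ^ j.-1)%N)^-1 * y)%g by rewrite mulKg.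
rewrite groupM ?groupV ?groupX //;
  first by rewrite mem_gen // inE cycle_id orbT.
by rewrite mem_gen // inE Ky.
Qed.

(** Two inequalities. [K] contains [a ^+ (p ^ j)], which bounds the order of the cyclic quotient.
    Over [N] it is generated by one element, whose [p]-th power lies in [N] because [G / N] is
    abelian and [b] has order [p]; this bounds [#|K|] by [p * #|N|]. *)
Lemma card_linear_ker : #|G : K| = (p ^ j)%N.
Proof.
pose N := <[a ^+ (p ^ j)%N]>%G.
have nNG : N <| G.
  by apply: sub_der1_normal; rewrite ?der1_expn // cycle_subG groupX.
have sNK : N \subset K by rewrite cycle_subG.
have sKG := normal_sub linear_ker_normal.
have oN : #|N| = (p ^ (n - j))%N.
  rewrite -[#|N|]/(#[a ^+ (p ^ j)%N]%g) orderXdiv oa.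
    by rewrite -{1}(subnK (ltnW ltjn)) expnD mulnK // expn_gt0 p_gt0.
  by rewrite dvdn_exp2l // ltnW.
have leKN : (#|K / N|%g <= p)%N.
  have Gy : y \in G by rewrite groupM ?groupX.
  have NG : {subset G <= 'N(N)%g} by apply/subsetP/normal_norm.
  have defKN : (K / N = <[coset N y]>)%g.
    rewrite -quotient_cycle ?NG //.
    have -> : (<[y]> / N = (N <*> <[y]>) / N)%g.
      by rewrite quotientYidl // cycle_subG NG.
    suffices {1}-> : K = (N <*> <[y]>)%G by [].
    apply/eqP; rewrite -val_eqE eqEsubset; apply/andP; split; last first.
      by rewrite join_subG sNK cycle_subG.
    rewrite gen_subG; apply/subsetP=> x /set2P[]->.
      by rewrite mem_gen // inE cycle_id.
    by rewrite mem_gen // inE cycle_id orbT.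
  rewrite defKN -[#|_|]/(#[_]%g) dvdn_leq // order_dvdn; apply/eqP.
  have abGN : abelian (G / N)%g by rewrite sub_der1_abelian ?der1_expn.
  rewrite morphM ?NG ?groupX // morphX ?NG // expgMn; last first.
    by apply: (centsP abGN); rewrite ?groupX ?mem_quotient.
  rewrite -expgM -!morphX ?NG // -[p in (b ^+ p)%g]ob expg_order morph1 mulg1.
  rewrite -mulnA -expnSr (ltn_predK j_gt0) mulnC expgM.
  by apply: coset_id; rewrite groupX ?cycle_id.
apply/eqP; rewrite eqn_leq; apply/andP; split.
  rewrite -card_quotient // linear_ker_quotient -[#|_|]/(#[_]%g) dvdn_leq
    ?expn_gt0 ?p_gt0 //.
  by rewrite order_dvdn -morphX ?(subsetP nGK) // /= coset_id.
have nNK : K \subset 'N(N)%g := subset_trans sKG (normal_norm nNG).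
rewrite -(leq_pmul2l (cardG_gt0 K)) Lagrange // oG.
rewrite -(Lagrange sNK) oN -card_quotient //.
apply: (@leq_trans (p ^ (n - j) * p * p ^ j)); first by rewrite !leq_mul.
by rewrite -expnSr -expnD addSn subnK // ltnW.
Qed.

End LinearKer.

End Modular.

(** * Linear characters through a cyclic quotient *)

Section CyclicQuotient.

Variables (Fbar : fieldType) (gT : finGroupType) (G N : {group gT}) (x : gT).
Hypotheses (nNG : N <| G) (Gx : x \in G) (defGN : (G / N = <[coset N x]>)%g).

Let NG : {subset G <= 'N(N)%g}. Proof. exact/subsetP/normal_norm. Qed.

Let ox : #[coset N x]%g = #|G : N|.
Proof. by rewrite orderE -defGN card_quotient ?normal_norm. Qed.

Lemma lin_char_cyclic_quotient (z : Fbar) : z ^+ #|G : N| = 1 ->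
  exists th, [/\ lin_char G th, th x = z & {in N, forall h, th h = 1}].
Proof.
rewrite -ox => /cyclic_char[chi chiX]; exists (fun g => chi (coset N g)).
have chi1 : chi 1%g = 1 by rewrite -(expg0 (coset N x)) chiX.
split=> [||h Nh]; last by rewrite coset_id.
  split=> [|g h Gg Gh]; first by rewrite coset_id.
  have cycN g' : g' \in G -> coset N g' \in <[coset N x]>%g.
    by move=> Gg'; rewrite -defGN mem_quotient.
  rewrite morphM ?NG //=; have /cycleP[i ->] := cycN g Gg;
    have /cycleP[j ->] := cycN h Gh.
  by rewrite -expgD !chiX exprD.
by rewrite -[coset N x]expg1 chiX expr1.
Qed.

Lemma lin_char_cyclic_ker (th : gT -> Fbar) : lin_char G th ->
    {in N, forall h, th h = 1} -> #|G : N|.-primitive_root (th x) ->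
  {in G, forall g, (th g == 1) = (g \in N)}.
Proof.
move=> lin_th th1 prim_x g Gg; have sNG := subsetP (normal_sub nNG).
have /cycleP[i Dg] : coset N g \in <[coset N x]>%g by rewrite -defGN
  mem_quotient.
have Nk : (g * (x ^+ i)^-1)%g \in N.
  apply: coset_idr; first by rewrite groupM ?groupV ?groupX ?NG.
  by rewrite morphM ?morphV ?morphX ?groupV ?groupX ?NG //= Dg mulgV.
have -> : th g = th x ^+ i.
  rewrite -(lin_charX _ lin_th) // -[g in LHS](mulgKV (x ^+ i)%g).
  by rewrite lin_th.2 ?(sNG _ Nk) ?groupX // th1 // mul1r.
rewrite -(prim_order_dvd prim_x) -ox order_dvdn -Dg.
by apply/eqP/idP => [/coset_idr-> // | /coset_id //]; apply: NG.
Qed.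

End CyclicQuotient.

(** * Class functions detected by characters *)

Section Completeness.

Variables (p n : nat) (gT : finGroupType) (G : {group gT}) (a b : gT).
Hypothesis modG : modular_gens p n G a b.
Variable Fbar : fieldType.

Let p_pr : prime p. Proof. by case: modG. Qed.
Let p_gt0 : (0 < p)%N := prime_gt0 p_pr.
Let n_ge2 : (2 <= n)%N. Proof. by case: modG. Qed.
Let oa : #[a]%g = (p ^ n)%N. Proof. by case: modG => _ _ []. Qed.
Let ob : #[b]%g = p. Proof. by case: modG => _ _ []. Qed.
Let sdG : (<[a]> ><| <[b]> = G)%g. Proof. by case: modG => _ _ _ []. Qed.
Let oG : #|G| = (p ^ n.+1)%N. Proof. by case: modG => _ _ []. Qed.
Let defZ : 'Z(G)%g = <[a ^+ p]>%g. Proof. by case: modG => _ _ _ _ []. Qed.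
Let oZ : #|'Z(G)%g| = (p ^ n.-1)%N. Proof. by case: modG => _ _ _ _ []. Qed.
Let defG' : G^`(1)%g = <[a ^+ (p ^ n.-1)%N]>%g.
Proof. by case: modG => _ _ _ _ []. Qed.
Let oG' : #|G^`(1)%g| = p. Proof. by case: modG => _ _ _ _ []. Qed.
Let Ga : a \in G. Proof. by have [] := modular_mem modG. Qed.
Let Gb : b \in G. Proof. by have [] := modular_mem modG. Qed.
Let n1_gt0 : (0 < n.-1)%N. Proof. by case: (n) n_ge2 => [|[]]. Qed.
Let n1K : n.-1.+1 = n. Proof. exact: ltn_predK n_ge2. Qed.

Lemma cycle_normal_der1 : <[a]>%g <| G.
Proof. by have [] := sdprod_context sdG. Qed.

Lemma cycle_quotient : (G / <[a]> = <[coset <[a]> b]>)%g.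
Proof.
have [_ defG nab _] := sdprodP sdG.
by rewrite -defG quotientMidl quotient_cycle // -cycle_subG.
Qed.

Lemma card_cycle_index : #|G : <[a]>| = p.
Proof.
rewrite -divgS ?(normal_sub cycle_normal_der1) // -orderE oa oG.
by rewrite expnS mulnK // expn_gt0 p_gt0.
Qed.

(** A product of two characters: one of the quotient by a kernel containing [b], where [a] has order
    [p ^ n.-1], and one of [G / <[a]>]. *)
Lemma modular_lin_char (alpha beta : Fbar) :
    alpha ^+ (p ^ n.-1) = 1 -> beta ^+ p = 1 ->
  exists th, [/\ lin_char G th, th a = alpha & th b = beta].
Proof.
move=> alpha1 beta1; have lt_n1 : (n.-1 < n)%N by rewrite n1K.
pose K := linear_ker p a b 0 n.-1.
have Kb : b \in K by rewrite mem_gen // !inE mul0n expg0 mul1g eqxx orbT.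
have oK : #|G : K| = (p ^ n.-1)%N by apply: (card_linear_ker modG).
have [th1 [lin1 th1a th1K]] := lin_char_cyclic_quotient
  (linear_ker_normal modG 0 lt_n1)
  (linear_ker_quotient modG 0 lt_n1) (etrans (congr1 _ oK) alpha1).
have [th2 [lin2 th2b th2K]] := lin_char_cyclic_quotient cycle_normal_der1
  cycle_quotient (etrans (congr1 _ card_cycle_index) beta1).
exists (fun g => th1 g * th2 g); split.
- split=> [|g h Gg Gh]; first by rewrite lin1.1 lin2.1 mulr1.
  by rewrite lin1.2 // lin2.2 // mulrACA.
- by rewrite th1a th2K ?mulr1 ?cycle_id.
by rewrite th1K // th2b mul1r.
Qed.

Local Notation u := (a ^+ (p ^ n.-1)%N)%g.

(** A nontrivial commutator of [g] generates G', which has prime order, and its powers are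
    commutators of [g] again because it is central: the class of [g] is its whole coset. *)
Lemma conj_der1 g w : g \in G -> g \notin 'Z(G)%g -> w \in <[u]>%g ->
  exists2 h, h \in G & (g ^ h = g * w)%g.
Proof.
move=> Gg nZg uw; have [h Gh ncgh] := not_center_commg Gg nZg.
have G'gh : [~ g, h]%g \in G^`(1)%g by apply: mem_commg.
have : w \in <[[~ g, h]]>%g.
  suffices -> : <[[~ g, h]]>%g = <[u]>%g by [].
  rewrite -defG'; apply/eqP; rewrite eqEcard cycle_subG G'gh oG' /=.
  rewrite -[#|_|]/(#[_]%g) (nt_prime_order p_pr _ ncgh) //.
  by rewrite -oG' expg_cardG.
case/cycleP=> k ->; exists (h ^+ k)%g; rewrite ?groupX // conjg_mulR commgX //.
have /centerP[_ cgh] := subsetP (der1_sub_center modG) _ G'gh.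
by apply: commute_sym; apply: cgh.
Qed.

Variables (zeta eta : Fbar) (c : gT -> Fbar).
Hypotheses (prim_zeta : (p ^ n.-1).-primitive_root zeta).
Hypotheses (prim_eta : p.-primitive_root eta) (nzp : p%:R != 0 :> Fbar).
Hypothesis cJ : {in G &, forall g h, c (g ^ h)%g = c g}.

(* Fourier inversion on [G / G'] kills the sums of [c] over the cosets of [G'],
   hence [c] outside the centre, whose conjugacy classes are such cosets. On the
   cyclic centre, the characters that are not faithful are trivial on [G']. *)
Lemma class_function_eq0 :
    (forall th, lin_char G th -> \sum_(g in G) c g * th g = 0) ->
    (forall th, lin_char 'Z(G)%g th -> faithful 'Z(G)%g th ->
       \sum_(g in 'Z(G)%g) c g * th g = 0) ->
  {in G, forall g, c g = 0}.
Proof.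
move=> c_lin c_center.
have sG'Z := der1_sub_center modG.
have Zu : u \in 'Z(G)%g by rewrite (subsetP sG'Z) // defG' cycle_id.
have Gu : u \in G by rewrite groupX.
have ou : #[u]%g = p by rewrite orderE -defG'.
pose f g := \sum_(w in <[u]>%g) c (g * w)%g.
have fu g k : f (g * u ^+ k)%g = f g.
  rewrite -[RHS](sum_mulgl _ (mem_cycle u k)).
  by apply: eq_bigr => w _; rewrite mulgA.
have sumf (A : {group gT}) th : u \in A -> A \subset G -> lin_char A th -> th u
  = 1 ->
    \sum_(g in A) f g * th g = (\sum_(g in A) c g * th g) *+ p.
  move=> Au sAG lin_th thu; rewrite -[in RHS]ou orderE -sumr_const.
  rewrite (eq_bigr (fun g => \sum_(w in <[u]>%g) c (g * w)%g * th g)) => [|g _].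
    rewrite exchange_big; apply: eq_bigr => _ /cycleP[k ->] /=.
    rewrite -(sum_mulgr (fun g => c g * th g) (groupX k Au)).
    apply: eq_bigr => g Ag; rewrite lin_th.2 ?(groupX k Au) //.
    by rewrite (lin_charX _ lin_th) // thu expr1n mulr1.
  by rewrite /f mulr_suml.
have pK (x : Fbar) : x *+ p = 0 -> x = 0.
  by rewrite -mulr_natl => /eqP; rewrite mulf_eq0 (negPf nzp) => /eqP.
have fr r s : (s < p)%N -> (r < p ^ n.-1)%N -> f (a ^+ r * b ^+ s)%g = 0.
  move=> ltsp ltr.
  apply: (fourier_inversion prim_zeta (f := fun r => f (a ^+ r * b ^+ s)%g)) =>
    // i {r ltr}.
  (* The summand has period [p ^ n.-1] in [r]; [p] copies of the sum run over all powers of [a] and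
     can be compared with a sum over [G]. *)
  apply: pK; rewrite -(sum_periodic p (f := fun r =>
    f (a ^+ r * b ^+ s)%g * zeta ^+ (i * r))) => [|r].
    rewrite -expnS n1K; move: s ltsp.
    apply: (fourier_inversion prim_eta (f := fun s =>
      \sum_(r < p ^ n) f (a ^+ r * b ^+ s)%g * zeta ^+ (i * r))) => j.
    have [th [lin_th tha thb]] : exists th,
      [/\ lin_char G th, th a = zeta ^+ i & th b = eta ^+ j].
      apply: modular_lin_char; rewrite -exprM mulnC exprM.
        by rewrite (prim_expr_order prim_zeta) expr1n.
      by rewrite (prim_expr_order prim_eta) expr1n.
    have : \sum_(g in G) f g * th g = 0.
      rewrite (sumf G) ?c_lin ?mul0rn // (lin_charX _ lin_th) // tha -exprM
        mulnC.
      by rewrite exprM (prim_expr_order prim_zeta) expr1n.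
    rewrite (sum_sdprod _ sdG) oa ob exchange_big /= => S0; rewrite -[RHS]S0.
    apply: eq_bigr => s _; rewrite mulr_suml; apply: eq_bigr => r _.
    rewrite lin_th.2 ?groupX // !(lin_charX _ lin_th) // tha thb -!exprM -mulrA.
    by [].
  rewrite expgD -mulgA mulnDr exprD (exprM _ i (p ^ n.-1)).
  have -> : (zeta ^+ i) ^+ (p ^ n.-1) = 1.
    by rewrite -exprM mulnC exprM (prim_expr_order prim_zeta) expr1n.
  have /centerP[_ ->] := Zu; rewrite ?groupX // mulgA mulr1.
  by rewrite -[in RHS](fu _ 1%N).
have f0 g : g \in G -> f g = 0.
  case/(modular_decomp modG)=> r [s ->].
  have -> : (b ^+ s = b ^+ (s %% p))%g by rewrite -ob expg_mod_order.
  have -> : (a ^+ r * b ^+ (s %% p) = a ^+ (r %% p ^ n.-1) * b ^+ (s %% p) * u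
    ^+ (r %/ p ^ n.-1))%g.
    have /centerP[_ cu] : (u ^+ (r %/ p ^ n.-1))%g \in 'Z(G)%g by rewrite
      groupX.
    rewrite -mulgA -cu ?groupX // mulgA -expgM -expgD; congr (a ^+ _ * _)%g.
    by rewrite addnC mulnC -divn_eq.
  by rewrite fu fr ?ltn_mod // expn_gt0 p_gt0.
have c_notZ g : g \in G -> g \notin 'Z(G)%g -> c g = 0.
  move=> Gg nZg; apply: pK;
    rewrite -[RHS](f0 g Gg) /f -[in LHS]ou orderE -sumr_const.
  apply: eq_bigr => w uw; have [h Gh <-] := conj_der1 Gg nZg uw.
  by rewrite cJ.
move=> g Gg; have [Zg | /(c_notZ g Gg) //] := boolP (g \in 'Z(G)%g).
pose z := (a ^+ p)%g; have oz : #[z]%g = (p ^ n.-1)%N by rewrite orderE -defZ.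
have /cyclePmin[t ltt ->] : g \in <[z]>%g by rewrite -defZ.
rewrite oz in ltt; move: t ltt {g Gg Zg}.
apply: (fourier_inversion prim_zeta (f := fun t => c (z ^+ t)%g)) => i.
have zi1 : zeta ^+ i ^+ #[z]%g = 1.
  by rewrite oz -exprM mulnC exprM (prim_expr_order prim_zeta) expr1n.
have [th thX] := cyclic_char zi1.
have lin_th : lin_char 'Z(G)%g th.
  split=> [|x y]; first by rewrite -(expg0 z) thX.
  by rewrite defZ => /cycleP[k ->] /cycleP[l ->]; rewrite -expgD !thX exprD.
have -> : \sum_(r < p ^ n.-1) c (z ^+ r)%g * zeta ^+ (i * r)
    = \sum_(g in 'Z(G)%g) c g * th g.
  by rewrite defZ big_cycle oz; apply: eq_bigr => r _; rewrite thX exprM.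
have uz : u = (z ^+ (p ^ n.-2))%g.
  by rewrite -expgM -expnS prednK.
have [thu | thu] := eqVneq (th u) 1.
  apply: pK; rewrite -(sumf 'Z(G)%G) ?center_sub //.
  by rewrite big1 // => g Zg; rewrite f0 ?mul0r // (subsetP (center_sub G)).
apply: c_center => // y; rewrite defZ => /cycleP[t ->] /eqP.
have co_ip : coprime i p.
  rewrite coprime_sym prime_coprime //; apply: contra thu => /dvdnP[i' Di].
  rewrite uz thX Di -exprM -mulnA -expnS prednK // mulnC exprM.
  by rewrite (prim_expr_order prim_zeta) expr1n.
rewrite thX -exprM -(prim_order_dvd prim_zeta) Gauss_dvdr; last first.
  by rewrite coprimeXl // coprime_sym.
by rewrite -oz order_dvdn => /eqP.
Qed.

End Completeness.

(** * Vanishing traces of roots of unity *)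

(** The unit group is the automorphism group of a cyclic group of order [p ^ n]; its cyclicity is
    where the oddness of [p] enters. *)
Lemma cyclic_units_Zp_pexp p n : prime p -> odd p -> (2 <= n)%N ->
  cyclic [set: {unit 'Z_(p ^ n)%N}].
Proof.
move=> p_pr p_odd n_ge2; have p_gt1 := prime_gt1 p_pr.
have pn_gt1 : (1 < p ^ n)%N by rewrite -(expn0 p) ltn_exp2l // ltnW.
pose x : 'Z_(p ^ n)%N := Zp1; have ox : #[x]%g = (p ^ n)%N.
  by rewrite order_Zp1 Zp_cast.
have isoA := Zp_unit_isog x; rewrite ox in isoA.
rewrite -[[set: _]]/(units_Zp (p ^ n)) (isog_cyclic isoA).
have ntx : <[x]>%g != 1%g by rewrite -cardG_gt1 -orderE ox.
have px : p.-group <[x]>%g by rewrite /pgroup -orderE ox pnatX pnat_id.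
have [m [_ _]] := cyclic_pgroup_Aut_structure px (cycle_cyclic x) ntx.
have -> : ((logn p #|<[x]>|%g).-1 == 0%N) = false.
  by rewrite -orderE ox pfactorK //; case: (n) n_ge2 => [|[]].
by rewrite p_odd => -[t [_ _ _ [[]]]].
Qed.

(** Each [p]-th power gains one factor [p]: in z^p - 1 = (z - 1)(1 + z + ... + z^(p-1)) the second
    factor has [p] terms, all congruent to 1 modulo [p]. *)
Lemma expn_eq1_mod (p e d y : nat) : (0 < e)%N ->
  y = 1 %[mod p ^ e] -> y ^ (p ^ d) = 1 %[mod p ^ (e + d)].
Proof.
move=> e0 y1; elim: d => [|d IHd]; first by rewrite expn1 addn0.
have {y1} IHp : (y ^ (p ^ d) = 1 %[mod p])%N.
  rewrite -(modn_dvdm (y ^ _) (dvdn_exp e0 (dvdnn p))) -modnXm y1 modnXm exp1n.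
  by rewrite modn_dvdm // dvdn_exp.
move: IHd IHp; rewrite addnS !expnSr expnM; move: (y ^ (p ^ d))%N => z IHd IHp.
(* Differences of natural numbers are truncated, so [z = 0] is set aside; it forces [p = 1], where
   every congruence holds. *)
apply/eqP; have [z0|z0] := posnP z.
  have p1 : (p %| 1)%N by move/eqP: IHp; rewrite z0 eq_sym eqn_mod_dvd.
  by rewrite (eqP (_ : p == 1%N)) -?dvdn1 // exp1n !modn1.
rewrite eqn_mod_dvd ?expn_gt0 ?z0 // -(exp1n p) subn_exp.
rewrite dvdn_mul //; first by rewrite -eqn_mod_dvd //; apply/eqP.
rewrite /dvdn -modn_summ (eq_bigr (fun=> 1 %% p)%N) => [|i _].
  by rewrite sum_nat_const card_ord modnMr.
by rewrite exp1n muln1 -modnXm IHp modnXm exp1n.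
Qed.

Lemma sum_multiples (R : nmodType) (f : nat -> R) (d s : nat) :
    (0 < d)%N -> (forall r, ~~ (d %| r)%N -> f r = 0) ->
  \sum_(r < s * d) f r = \sum_(r < s) f (r * d)%N.
Proof.
move=> d0 f0; elim: s => [|s IHs]; first by rewrite mul0n !big_ord0.
rewrite big_ord_recr /= -IHs mulSnr big_split_ord /=; congr (_ + _).
rewrite (bigD1 (Ordinal d0)) //= addn0 big1 ?addr0 // => i ni0.
apply: f0; rewrite dvdn_addr ?dvdn_mull // gtnNdvd //.
by rewrite lt0n.
Qed.

Lemma geometric_root_eq0 (R : fieldType) (w : R) p :
  w ^+ p = 1 -> w != 1 -> \sum_(k < p) w ^+ k = 0.
Proof.
move=> wp w1; have /eqP := subrX1 w p.
by rewrite wp subrr eq_sym mulf_eq0 subr_eq0 (negPf w1) => /eqP.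
Qed.

(* If [<q>] contains [1 + p ^ (l - 1)] modulo [p ^ l], the orbit of a primitive
   [p ^ l]-th root of unity is a union of cosets of the [p]-th roots of unity.
   *)
Lemma sum_frobenius_eq0 (R : fieldType) (p l q D e : nat) (y : R) :
    prime p -> (1 < l)%N -> coprime p q -> p%:R != 0 :> R ->
    (p ^ l).-primitive_root y -> y ^+ (q ^ D) = y ->
    q ^ e = 1 + p ^ l.-1 %[mod p ^ l] ->
  \sum_(i < D) y ^+ (q ^ i) = 0.
Proof.
move=> p_pr l1 co_pq nzp prim_y yD De; pose w := y ^+ (p ^ l.-1).
have lK : l.-1.+1 = l := ltn_predK l1.
have prim_w : p.-primitive_root w.
  have := dvdn_prim_root prim_y (dvdn_exp (ltnW l1) (dvdnn p)).
  by rewrite -{1}lK expnS mulKn ?prime_gt0.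
have wq : w ^+ (q ^ e) = w.
  apply/eqP; rewrite -[X in _ == X]expr1 (eq_prim_root_expr prim_w).
  have pl : (p %| p ^ l)%N by rewrite dvdn_exp // ltnW.
  rewrite -(modn_dvdm _ pl) De (modn_dvdm _ pl) -modnDmr.
  by rewrite -(prednK (n := l.-1)) ?expnS ?modnMr ?addn0 // -ltnS lK.
have yq k : y ^+ (q ^ (k * e)) = y * w ^+ k.
  elim: k => [|k IHk]; first by rewrite expr1 mulr1.
  rewrite mulSnr expnD exprM IHk exprMn -[w ^+ k ^+ _]exprM mulnC exprM wq.
  rewrite exprS mulrA; congr (_ * _).
  rewrite -(prim_expr_mod prim_y) De (prim_expr_mod prim_y).
  by rewrite exprD expr1.
set S := LHS; suffices : p%:R * S == 0 by rewrite mulf_eq0 (negPf nzp) => /eqP.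
(* A shift of the orbit by [k * e] leaves [S] unchanged and multiplies its terms by [k]-th powers of
   nontrivial [p]-th roots of unity; the sum over [k] then consists of vanishing geometric sums. *)
have Sk k : S = \sum_(i < D) y ^+ (q ^ i) * w ^+ (q ^ i) ^+ k.
  rewrite /S -(sum_shift (k * e) (f := fun i => y ^+ (q ^ i))) => [|i].
    apply: eq_bigr => i _; rewrite addnC expnD exprM yq exprMn.
    by rewrite -[(w ^+ k) ^+ _]exprM mulnC exprM.
  by rewrite addnC expnD exprM yD.
apply/eqP; rewrite mulr_natl -[p in LHS]card_ord -sumr_const.
rewrite (eq_bigr (fun k : 'I_p =>
  \sum_(i < D) y ^+ (q ^ i) * w ^+ (q ^ i) ^+ k))
  => [|k _]; last exact: Sk.
rewrite exchange_big big1 // => i _;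
  rewrite -mulr_sumr geometric_root_eq0 ?mulr0 //.
  by rewrite exprAC (prim_expr_order prim_w) expr1n.
rewrite -(prim_order_dvd prim_w); apply: contraL (prime_gt1 p_pr).
have : coprime p (q ^ i) by rewrite coprimeXr.
by rewrite /coprime => /eqP pq /gcdn_idPl; rewrite pq => <-.
Qed.

Section Vanishing.

Variables (p n i0 delta' : nat) (F : finFieldType).
Local Notation q := #|F|.
Hypotheses (p_pr : prime p) (p_odd : odd p) (n_ge2 : (2 <= n)%N).
Hypotheses (co_pq : coprime p q) (i0_range : (1 <= i0 <= n)%N).
Hypothesis delta'_coprime : coprime delta' p.
Hypothesis i0_def :
  (#[unitZ (p ^ n) q]%g * (p ^ i0.-1 * delta') = totient (p ^ n))%N.

Let p_gt0 : (0 < p)%N := prime_gt0 p_pr.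
Let p_gt1 : (1 < p)%N := prime_gt1 p_pr.
Let pn_gt1 : (1 < p ^ n)%N.
Proof. by rewrite -(expn0 p) ltn_exp2l // ltnW. Qed.

(** Of the factor [p ^ n.-1] of the totient, delta absorbs [p ^ i0.-1], and [delta'] is prime to
    [p]. *)
Lemma order_unitZ_pexp : (p ^ (n - i0) %| #[unitZ (p ^ n) q]%g)%N.
Proof.
have [i0_gt0 le_i0n] := andP i0_range.
rewrite -(@Gauss_dvdl _ _ delta') ?coprimeXl 1?coprime_sym //.
rewrite -(@dvdn_pmul2l (p ^ i0.-1)) ?expn_gt0 ?p_gt0 //.
rewrite mulnCA i0_def totient_pfactor ?(ltnW n_ge2) // -expnD.
rewrite (_ : (i0.-1 + (n - i0) = n.-1)%N) ?dvdn_mull //.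
by case: (i0) i0_gt0 le_i0n => // i _ lein; rewrite -[in RHS](subnKC lein).
Qed.

(** In a cyclic group, membership in <q> is a divisibility of orders: that of [1 + p ^ c] divides
    [p ^ (n - c)], hence [p ^ (n - i0)]. *)
Lemma frobenius_pexp c : (i0 <= c < n)%N ->
  exists e, q ^ e = 1 + p ^ c %[mod p ^ n].
Proof.
have [i0_gt0 le_i0n] := andP i0_range.
case/andP=> le_i0c ltcn; have c0 : (0 < c)%N := leq_trans i0_gt0 le_i0c.
have co_pc : coprime (p ^ n) (1 + p ^ c).
  by rewrite coprimeXl // -(prednK c0) expnSr addnC /coprime gcdnMDl gcdn1.
have co_pnq : coprime (p ^ n) q by rewrite coprimeXl.
suffices : unitZ (p ^ n) (1 + p ^ c) \in <[unitZ (p ^ n) q]>%g.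
  by case/cycleP=> e /esym/eqP; rewrite eq_unitZX // => /eqP; exists e.
rewrite -cycle_subG -(cardSg_cyclic (cyclic_units_Zp_pexp p_pr p_odd n_ge2))
  ?subsetT //.
apply: dvdn_trans order_unitZ_pexp.
apply: (@dvdn_trans (p ^ (n - c))); last by rewrite dvdn_exp2l // leq_sub2l.
rewrite order_unitZ ?expn_gt0 ?p_gt0 //.
have -> : (p ^ n = p ^ (c + (n - c)))%N by rewrite subnKC // ltnW.
by apply/eqP; apply: expn_eq1_mod => //; rewrite modnDr.
Qed.

(** The root [z ^+ s] has order [p ^ l] with [l > i0], precisely because [p ^ (j - i0)] does not
    divide [s]. The number of terms is the orbit length of [z], a period of the orbit of
    [z ^+ s]. *)
Lemma sum_frobenius_root_eq0 (R : fieldType) j s (z : R) :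
    p%:R != 0 :> R -> (i0 < j <= n)%N -> ~~ (p ^ (j - i0) %| s)%N ->
    (p ^ j).-primitive_root z ->
  \sum_(i < #[unitZ (p ^ j) q]%g) (z ^+ s) ^+ (q ^ i) = 0.
Proof.
have [i0_gt0 le_i0n] := andP i0_range.
move=> nzp /andP[lt_i0j le_jn] ndv_s prim_z.
have := exp_prim_root prim_z s.
have [v le_vj Dv] : exists2 v, (v <= j)%N & gcdn s (p ^ j) = (p ^ v)%N.
  by apply/(dvdn_pfactor _ _ p_pr); apply: dvdn_gcdr.
rewrite Dv; have lt_v : (v < j - i0)%N.
  rewrite ltnNge; apply: contra ndv_s => le_v.
  apply: dvdn_trans (dvdn_exp2l p le_v) _; rewrite -Dv; exact: dvdn_gcdl.
rewrite -{1}(subnK le_vj) expnD mulnK ?expn_gt0 ?p_gt0 //.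
set l := (j - v)%N => prim_y.
have lt_i0l : (i0 < l)%N by rewrite ltn_subRL addnC -ltn_subRL.
have [|e De] := frobenius_pexp (c := l.-1).
  rewrite -ltnS (ltn_predK lt_i0l) lt_i0l /=.
  by apply: leq_trans le_jn; apply: leq_subr.
apply: (sum_frobenius_eq0 (e := e) p_pr _ co_pq nzp prim_y).
- exact: leq_ltn_trans lt_i0l.
- rewrite exprAC; congr (_ ^+ _); apply/eqP.
  by rewrite (eq_prim_root_frobenius _ _ prim_z) // coprimeXl.
have dv_l : (p ^ l %| p ^ n)%N.
  by rewrite dvdn_exp2l // (leq_trans (leq_subr v j)).
by rewrite -(modn_dvdm _ dv_l) De modn_dvdm.
Qed.

End Vanishing.

(** * The listed pairs *)

Definition label_gen (gT : finGroupType) (a b : gT) (l : label) : gT :=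
  match l with LabG => 1%g | LabA => b | LabIJ _ _ | LabMax => a end.

Definition label_order (p n : nat) (l : label) : nat :=
  match l with
  | LabG => 1 | LabA => p | LabIJ _ j => (p ^ j)%N | LabMax => (p ^ n)%N
  end.

Definition label_lin (l : label) : bool := if l is LabMax then false else true.

Lemma linear_strong_shoda (gT : finGroupType) (G K : {group gT}) :
  K <| G -> cyclic (G / K)%g -> strong_shoda_pair G G K.
Proof.
move=> nKG cGK; split=> //; have /setIidPl NG := normal_norm nKG.
apply/maxgroupP; rewrite NG subxx cyclic_abelian //;
  split=> // A /andP[sAG _] sGA.
by apply/eqP; rewrite eqEsubset sAG.
Qed.

Section Labels.

Variables (p n : nat) (gT : finGroupType) (G : {group gT}) (a b : gT).
Hypothesis modG : modular_gens p n G a b.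
Local Notation pair := (pair_of G a b p n).
Local Notation gen := (label_gen a b).
Local Notation lord := (label_order p n).

Let p_pr : prime p. Proof. by case: modG. Qed.
Let p_gt0 : (0 < p)%N := prime_gt0 p_pr.
Let p_gt1 : (1 < p)%N := prime_gt1 p_pr.
Let n_ge2 : (2 <= n)%N. Proof. by case: modG. Qed.
Let oa : #[a]%g = (p ^ n)%N. Proof. by case: modG => _ _ []. Qed.
Let ob : #[b]%g = p. Proof. by case: modG => _ _ []. Qed.
Let sdG : (<[a]> ><| <[b]> = G)%g. Proof. by case: modG => _ _ _ []. Qed.
Let nabG : ~~ abelian G. Proof. by case: modG => _ _ _ []. Qed.
Let Ga : a \in G. Proof. by have [] := modular_mem modG. Qed.
Let Gb : b \in G. Proof. by have [] := modular_mem modG. Qed.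

Lemma label_okP i j : label_ok p n (LabIJ i j) -> [/\ (i < p)%N, (0 < j)%N & (j
  < n)%N].
Proof.
move=> /= /and3P[lei j0 lej]; split=> //.
  by rewrite -(prednK p_gt0) ltnS.
by rewrite -(ltn_predK n_ge2) ltnS.
Qed.

Lemma label_max_ker : (pair LabMax).2 = 1%g :> {set gT}.
Proof. by rewrite /= -oa expg_order cycle1. Qed.

Lemma label_pair l : label_ok p n l ->
  [/\ (pair l).1 <| G, (pair l).2 <| (pair l).1, gen l \in (pair l).1,
      ((pair l).1 / (pair l).2 = <[coset (pair l).2 (gen l)]>)%g &
      #|(pair l).1 : (pair l).2| = lord l].
Proof.
case: l => [||i j|] ok_l.
- split=> //=; rewrite ?indexgg //.
  by rewrite trivg_quotient morph1 cycle1.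
- split=> //=; first exact: (cycle_normal_der1 modG).
    exact: (cycle_quotient modG).
  exact: (card_cycle_index modG).
- have [ltip j0 ltjn] := label_okP ok_l; split=> //=.
  + exact: (linear_ker_normal modG).
  + exact: (linear_ker_quotient modG).
  exact: (card_linear_ker modG).
have K1 : <[a ^+ (p ^ n)%N]>%g = 1%g by apply: label_max_ker.
split=> /=; first exact: (cycle_normal_der1 modG).
- by rewrite K1 normal1.
- exact: cycle_id.
- by rewrite quotient_cycle //= K1 (subsetP (norms1 [set: gT])) ?inE.
by rewrite -divgS /= K1 ?sub1G // cards1 divn1 -orderE.
Qed.

Lemma label_cyclic l : label_ok p n l -> cyclic ((pair l).1 / (pair l).2)%g.
Proof. by case/label_pair=> _ _ _ -> _; apply: cycle_cyclic. Qed.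

Lemma label_lin1 l : label_lin l -> (pair l).1 = G.
Proof. by case: l. Qed.

Lemma label_lin_der1 l : label_ok p n l -> label_lin l ->
  G^`(1)%g \subset (pair l).2.
Proof.
move=> ok_l lin_l; have [_ nKG _ defGK _] := label_pair ok_l.
rewrite (label_lin1 lin_l) in nKG defGK.
by rewrite der1_min ?normal_norm // defGK cycle_abelian.
Qed.

(** The index of K gives [j], and membership of [a] separates [LabA] from the labels with [j = 1].
    If [i] and [i'] give the same K, the quotient of the two generators is a power of [a] in K,
    where [a] has order [p ^ j] modulo K; this fixes [i] modulo [p]. *)
Lemma label_lin_inj l1 l2 : label_ok p n l1 -> label_ok p n l2 ->
  label_lin l1 -> label_lin l2 -> (pair l1).2 = (pair l2).2 :> {set gT} -> l1 =
    l2.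
Proof.
move=> ok1 ok2 lin1 lin2 eqK.
have eq_ord : lord l1 = lord l2.
  have [_ _ _ _ <-] := label_pair ok1; have [_ _ _ _ <-] := label_pair ok2.
  by rewrite !label_lin1 // eqK.
have p_neq1 : (p == 1%N) = false by rewrite gtn_eqF.
have pj_neq1 i j : label_ok p n (LabIJ i j) -> (p ^ j == 1)%N = false.
  by case/label_okP=> _ j0 _; rewrite -(expn0 p) eqn_exp2l // gtn_eqF.
have a_notin i j : label_ok p n (LabIJ i j) -> a \notin (pair (LabIJ i j)).2.
  move=> ok_l; have [_ nKG _ defGK oGK] := label_pair ok_l.
  apply/negP=> Ka; have := pj_neq1 _ _ ok_l; rewrite /= in oGK.
  by rewrite -oGK -card_quotient ?normal_norm // defGK coset_id // cycle1
    cards1 eqxx.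
case: l1 l2 ok1 ok2 lin1 lin2 eqK eq_ord => [||i j|] [||i' j'|] //=.
- by move=> _ _ _ _ _ /eqP; rewrite eq_sym p_neq1.
- by move=> _ /pj_neq1 nj _ _ _ /esym/eqP; rewrite nj.
- by move=> _ _ _ _ _ /eqP; rewrite p_neq1.
- by move=> _ /a_notin /= nKa _ _ eqK; rewrite -eqK cycle_id in nKa.
- by move=> /pj_neq1 nj _ _ _ _ /eqP; rewrite nj.
- by move=> /a_notin /= nKa _ _ _ eqK; rewrite eqK cycle_id in nKa.
move=> ok1 ok2 _ _ eqK /eqP; rewrite eqn_exp2l // => /eqP eq_j; subst j'.
have [ltip j0 ltjn] := label_okP ok1; have [lti'p _ _] := label_okP ok2.
suffices -> : i = i' by [].
pose K := linear_ker p a b i j;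
  have nKG : K <| G := linear_ker_normal modG i ltjn.
have NG := subsetP (normal_norm nKG); have ox : #[coset K a]%g = (p ^ j)%N.
  rewrite orderE -(linear_ker_quotient modG i ltjn) card_quotient ?normal_norm
    //.
  exact: (card_linear_ker modG).
have Ky : (a ^+ (i * p ^ j.-1)%N * b)%g \in K by rewrite mem_gen // !inE eqxx
  orbT.
have Ky' : (a ^+ (i' * p ^ j.-1)%N * b)%g \in K.
  by rewrite /K /linear_ker /= eqK mem_gen // !inE eqxx orbT.
have := groupM Ky (groupVr Ky'); rewrite invMg mulgA mulgK => /coset_id.
rewrite morphM ?groupV ?groupX ?NG // morphV ?groupX ?NG // !morphX ?NG //.
move/eqP; rewrite -eq_mulgV1 eq_expg_mod_order ox -(prednK j0) expnS.
by rewrite -?muln_modl eqn_pmul2r ?expn_gt0 ?p_gt0 // !modn_small // => /eqP.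
Qed.

(** [<[a]>] is its own centraliser: if [a ^+ r * b ^+ s] commutes with [a], so does [b ^+ s], which
    generates [<[b]>] unless [p] divides [s], and G would be abelian. *)
Lemma label_max_shoda : strong_shoda_pair G (pair LabMax).1 (pair LabMax).2.
Proof.
have [nHG nKH _ _ _] := label_pair (erefl : label_ok p n LabMax).
have cHK := label_cyclic (erefl : label_ok p n LabMax).
split=> //; move: nHG nKH cHK => /= nHG nKH cHK.
have K1 : <[a ^+ (p ^ n)%N]>%g = 1%g by apply: label_max_ker.
have N1 : 'N_G(<[a ^+ (p ^ n)%N]>)%g = G by rewrite K1; apply/setIidPl/norms1.
apply/maxgroupP; rewrite N1 quotientS ?(normal_sub nHG) // cyclic_abelian //.
split=> // A /andP[sAG abA] sHA; apply/eqP; rewrite eqEsubset sHA andbT.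
apply/subsetP=> y Ay; have /morphimP[x Nx Gx Dy] := subsetP sAG y Ay.
have Na : a \in 'N(<[a ^+ (p ^ n)%N]>)%g by rewrite K1 (subsetP (norms1 [set:
  gT])) ?inE.
have Aa : coset <[a ^+ (p ^ n)%N]> a \in A.
  by rewrite (subsetP sHA) // mem_quotient ?cycle_id.
have cxa : commute a x.
  have := centsP abA _ Aa _ Ay; rewrite Dy /= => cya.
  apply/commgP/eqP/set1P; rewrite -[[set _]]K1; apply: coset_idr;
    first by rewrite groupR.
  by rewrite morphR //; apply/eqP/commgP.
have [r [s Dx]] := modular_decomp modG Gx.
rewrite Dy mem_quotient // Dx groupM ?mem_cycle //.
have cas : commute a (b ^+ s)%g.
  have -> : (b ^+ s = (a ^+ r)^-1 * x)%g by rewrite Dx mulKg.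
  by apply: commuteM cxa; apply/commuteV/commuteX.
have [ps | p's] := boolP (p %| s)%N.
  have /eqP-> : (b ^+ s == 1)%g by rewrite -order_dvdn ob.
  exact: group1.
case/negP: nabG; have [_ <- _ _] := sdprodP sdG.
rewrite abelianM !cycle_abelian /= cent_cycle cycle_subG; apply/cent1P.
have /eqP defb : generator <[b]> (b ^+ s) by rewrite generator_coprime ob
  prime_coprime.
have /cycleP[i Db] : b \in <[b ^+ s]>%g by rewrite -defb cycle_id.
suffices cab : commute a b by first [exact: cab | exact: commute_sym cab].
by rewrite Db; apply: commuteX.
Qed.

End Labels.

(** * Kernels of linear characters *)

Section LinKer.

Variables (Fbar : fieldType) (gT : finGroupType) (G : {group gT}).
Variable th : gT -> Fbar.
Hypothesis lin_th : lin_char G th.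

Lemma lin_ker_group : exists2 N : {group gT}, N \subset G &
  {in G, forall g, (g \in N) = (th g == 1)}.
Proof.
pose N := [set g in G | th g == 1].
have gN : group_set N.
  apply/group_setP; rewrite inE group1 lin_th.1 eqxx; split=> // x y.
  rewrite !inE => /andP[Gx /eqP thx] /andP[Gy /eqP thy].
  by rewrite groupM // lin_th.2 // thx thy mulr1 eqxx.
exists (Group gN); first by apply/subsetP => g; rewrite !inE => /andP[].
by move=> g Gg; rewrite !inE Gg.
Qed.

Lemma lin_char_gen1 (A : {set gT}) : A \subset G ->
  {in A, forall g, th g = 1} -> {in <<A>>%g, forall g, th g = 1}.
Proof.
move=> /subsetP sAG thA g Ag; have [N sNG NP] := lin_ker_group.
have sAN : <<A>>%g \subset N.
  by rewrite gen_subG; apply/subsetP=> x Ax; rewrite NP ?sAG // thA.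
have Ng := subsetP sAN g Ag.
by apply/eqP; rewrite -NP ?(subsetP sNG).
Qed.

Lemma lin_char_der1 : {in G^`(1)%g, forall g, th g = 1}.
Proof.
apply: lin_char_gen1; first by rewrite -gen_subG; apply: (der_sub 1 G).
move=> _ /imset2P[x y Gx Gy ->]; rewrite commgEl conjgE.
rewrite !lin_th.2 ?groupM ?groupV // !(lin_charV lin_th) //.
have thx := lin_char_neq0 lin_th Gx; have thy := lin_char_neq0 lin_th Gy.
by rewrite (mulrC (th x) (th y)) mulKf // mulVf.
Qed.

Lemma lin_char_descend (K : {group gT}) : K <| G ->
    {in G, forall g, (th g == 1) = (g \in K)} ->
  exists2 chi : coset_of K -> Fbar, faithful_char G chi &
    {in G, forall g, chi (coset K g) = th g}.
Proof.
move=> nKG kerK; have [sKG nKG'] := andP nKG.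
pose chi u := th (repr u : gT) : Fbar.
have chiE : {in G, forall g, chi (coset K g) = th g}.
  move=> g Gg; have := mem_repr_coset (coset K g).
  rewrite /chi val_coset ?(subsetP nKG') // => /rcosetP[k Kk ->].
  have Gk := subsetP sKG k Kk; rewrite lin_th.2 //.
  by move: Kk; rewrite -kerK // => /eqP->; rewrite mul1r.
have NG := subsetP nKG'.
exists chi => //; split=> [u v | u | u v].
- move=> /morphimP[x Nx Gx ->] /morphimP[y Ny Gy ->].
  by rewrite -morphM // !chiE ?groupM // lin_th.2.
- by move=> /morphimP[x Nx Gx ->]; rewrite chiE // (lin_char_neq0 lin_th).
move=> /morphimP[x Nx Gx ->] /morphimP[y Ny Gy ->].
rewrite !chiE // => thxy; apply/rcoset_kercosetP; rewrite // mem_rcoset.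
rewrite -kerK ?groupM ?groupV // lin_th.2 ?groupV // (lin_charV lin_th) // thxy.
by rewrite divff ?(lin_char_neq0 lin_th).
Qed.

Variables (p n : nat) (a b : gT).
Hypothesis modG : modular_gens p n G a b.
Local Notation pair := (pair_of G a b p n).
Local Notation gen := (label_gen a b).

Let p_pr : prime p. Proof. by case: modG. Qed.
Let p_gt0 : (0 < p)%N := prime_gt0 p_pr.
Let ob : #[b]%g = p. Proof. by case: modG => _ _ []. Qed.
Let defG' : G^`(1)%g = <[a ^+ (p ^ n.-1)%N]>%g.
Proof. by case: modG => _ _ _ _ []. Qed.
Let Ga : a \in G. Proof. by have [] := modular_mem modG. Qed.
Let Gb : b \in G. Proof. by have [] := modular_mem modG. Qed.

(** The order of [th a] decides, at most [p ^ n.-1] since [th] is trivial on G'. If it is 1, [th b]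
    separates [LabG] from [LabA]. If it is [p ^ j] with [j > 0], the inverse of [th b] is a power of
    the primitive [p]-th root [th a ^+ (p ^ j.-1)], and the exponent is [i]. *)
Lemma label_of_lin_char : exists l, [/\ label_ok p n l, label_lin l &
  {in G, forall g, (th g == 1) = (g \in (pair l).2)}].
Proof.
suffices [l [ok_l lin_l th1 prim_l]] : exists l, [/\ label_ok p n l, label_lin
  l,
    {in (pair l).2, forall g, th g = 1} &
    (label_order p n l).-primitive_root (th (gen l))].
  exists l; split=> // g Gg; have [_ nKG Gx defGK oGK] := label_pair modG ok_l.
  rewrite (label_lin1 _ _ _ _ _ lin_l) in nKG Gx defGK oGK.
  by apply: (lin_char_cyclic_ker nKG Gx defGK) => //; rewrite oGK.
have thX x i : x \in G -> th (x ^+ i)%g = th x ^+ i.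
  by move=> Gx; rewrite (lin_charX _ lin_th).
have tha : th a ^+ (p ^ n.-1) = 1.
  by rewrite -thX // lin_char_der1 // defG' cycle_id.
have thb : th b ^+ p = 1 by rewrite -thX // -ob expg_order lin_th.1.
have pn_gt0 : (0 < p ^ n.-1)%N by rewrite expn_gt0 p_gt0.
have [d prim_a /(dvdn_pfactor _ _ p_pr)[j lejn Dd]] := prim_order_exists pn_gt0
  tha.
subst d.
case: j => [|j] in lejn prim_a *.
  have tha1 : th a = 1 by apply/eqP;
    rewrite -[th a]expr1 -(prim_order_dvd prim_a).
  have th_a : {in <[a]>%g, forall g, th g = 1}.
    by move=> _ /cycleP[i ->]; rewrite thX // tha1 expr1n.
  have [thb1 | thb1] := eqVneq (th b) 1.
    exists LabG; split=> //= [g Gg|]; last first.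
      by rewrite lin_th.1; apply/andP; split=> //; apply/forallP=> i;
         rewrite ord1 unity_rootE expr1n !eqxx.
    have [r [s ->]] := modular_decomp modG Gg.
    by rewrite lin_th.2 ?groupX // !thX // tha1 thb1 !expr1n mulr1.
  exists LabA; split=> //=.
  have [d prim_b dv_d] := prim_order_exists p_gt0 thb.
  case/primeP: p_pr => _ /(_ d dv_d)/orP[]/eqP Dd; subst d => //.
  by case/eqP: thb1; rewrite -[th b]expr1 (prim_expr_order prim_b).
have prim_p : p.-primitive_root (th a ^+ (p ^ j)).
  have := dvdn_prim_root prim_a (dvdn_exp (ltn0Sn j) (dvdnn p)).
  by rewrite expnS mulKn.
have thbV : (th b)^-1 ^+ p = 1 by rewrite exprVn thb invr1.
have [i Di] := prim_rootP prim_p thbV.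
exists (LabIJ i j.+1); split=> //=.
  by rewrite -ltnS prednK // ltn_ord.
apply: lin_char_gen1.
  by apply/subsetP=> g /set2P[]->; rewrite ?groupM ?groupX.
move=> g /set2P[]->; first by rewrite thX // (prim_expr_order prim_a).
rewrite lin_th.2 ?groupX // thX // mulnC exprM -Di.
by rewrite mulVf ?(lin_char_neq0 lin_th).
Qed.

End LinKer.

Section OrbitSumsMore.

Variables (F : finFieldType) (Fbar : fieldType) (iota : {rmorphism F -> Fbar}).
Variables (gT : finGroupType) (G : {group gT}).
Implicit Types (e : galg F G) (Y : {group gT}) (th : gT -> Fbar).
Local Notation q := #|F|.
Local Notation aG := (regular_repr F G).

Lemma orbit_sum_frobenius Y th D e i :
    {in Y, forall y, th y ^+ (q ^ D) = th y} ->
  orbit_sum iota (G := G) Y th D e ->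
  orbit_sum iota (G := G) Y (fun y => th y ^+ (q ^ i)) D e.
Proof.
move=> thD [Re De]; split=> // g Gg; rewrite De // /ext0; case: ifP => // Yg.
congr (_ * _); rewrite -(sum_shift i (f := fun j => th g^-1%g ^+ (q ^ j))) =>
  [|j].
  by apply: eq_bigr => j _; rewrite addnC expnD exprM.
by rewrite addnC expnD exprM thD.
Qed.

Lemma hat_trivial (K : {group gT}) : K :=: 1%g -> hat F G K = 1%:M.
Proof.
move=> K1; rewrite /hat /gset_mx (eq_bigl (pred1 1%g)) => [|x].
  by rewrite big_pred1_eq repr_mx1 K1 cards1 invr1 scale1r.
by rewrite K1 inE.
Qed.

End OrbitSumsMore.

Lemma unit_Zp_coprime (p n : nat) (t : {unit 'Z_(p ^ n)%N}) :
  prime p -> (0 < n)%N -> coprime (val t) p.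
Proof.
move=> p_pr n_gt0; have m_gt1 : (1 < p ^ n)%N.
  by rewrite -(expn0 p) ltn_exp2l // prime_gt1.
have : (val t : 'Z_(p ^ n)) \is a GRing.unit := valP t.
by rewrite -{1}(natr_Zp (val t)) unitZpE // coprime_pexpl // coprime_sym.
Qed.

(** * The idempotents of the pair [(<[a]>, 1)] *)

Section MaxPair.

Variables (p n : nat) (gT : finGroupType) (G : {group gT}) (a b : gT).
Hypothesis modG : modular_gens p n G a b.
Hypothesis ab : (a ^ b = a ^+ (1 + p ^ n.-1)%N)%g.
Variables (F : finFieldType) (Fbar : fieldType) (iota : {rmorphism F -> Fbar}).
Hypothesis algFbar : integralRange iota.
Variable xi : nat -> Fbar.
Hypothesis xi_prim : forall m, coprime m #|F| -> m.-primitive_root (xi m).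
Hypothesis coGq : coprime #|G| #|F|.
Local Notation q := #|F|.
Local Notation aG := (regular_repr F G).
Local Notation pair := (pair_of G a b p n).
Local Notation H := (pair LabMax).1.
Local Notation K := (pair LabMax).2.
Local Notation m := (p ^ n)%N.
Local Notation D := #[unitZ m q]%g.

Let p_pr : prime p. Proof. by case: modG. Qed.
Let p_gt1 : (1 < p)%N := prime_gt1 p_pr.
Let n_ge2 : (2 <= n)%N. Proof. by case: modG. Qed.
Let m_gt1 : (1 < m)%N. Proof. by rewrite -(expn0 p) ltn_exp2l // ltnW. Qed.
Let oa : #[a]%g = m. Proof. by case: modG => _ _ []. Qed.
Let Ga : a \in G. Proof. by have [] := modular_mem modG. Qed.
Let Gb : b \in G. Proof. by have [] := modular_mem modG. Qed.
Let nHG : H <| G. Proof. exact: (cycle_normal_der1 modG). Qed.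
Let sHG : H \subset G := normal_sub nHG.
Let nKH : K <| H. Proof.
by have [] := label_pair modG (erefl : label_ok p n LabMax). Qed.
Let K1 : K :=: 1%g. Proof. exact: label_max_ker. Qed.
Let oHK : #|H : K| = m.
Proof. by have [] := label_pair modG (erefl : label_ok p n LabMax). Qed.
Let defHK : (H / K = <[coset K a]>)%g.
Proof. by have [] := label_pair modG (erefl : label_ok p n LabMax). Qed.
Let Ha : a \in H. Proof. exact: cycle_id. Qed.
Let co_mq : coprime m q. Proof. by rewrite -oHK (coprime_indexg coGq). Qed.

Variable gamma : coset_of K -> Fbar.
Hypotheses (gammaP : faithful_char H gamma) (gamma_a : gamma (coset K a) = xi
  m).
Local Notation lam := (fun h => gamma (coset K h)).

(** The summand of the listed idempotent for the exponent [t], before its vanishing terms are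
    dropped. *)
Definition eps_max (t : nat) : galg F G := m%:R^-1 *:
  \sum_(r < m) trace iota (xi m) (xi m ^+ (t * r)) *: aG (a ^- r)%g.

Let lin_lam : lin_char H lam := faithful_char_lift nKH gammaP.

Let lamX t : lin_char H (fun h => lam h ^+ t) := lin_char_exp t lin_lam.

Let lam_m x : x \in H -> lam x ^+ m = 1.
Proof.
move=> Hx; rewrite -(lin_charX _ lin_lam) // -oHK.
rewrite -[X in _ = X]lin_lam.1; congr (gamma (coset K _)).
case/cycleP: Hx => i ->; rewrite -expgM oHK mulnC expgM -oa.
by rewrite expg_order expg1n.
Qed.

Let lamD t x : x \in H -> lam x ^+ t ^+ (q ^ D) = lam x ^+ t.
Proof.
move=> Hx; have [r ->] := prim_rootP (xi_prim co_mq) (lam_m Hx).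
rewrite exprAC [_ ^+ r ^+ (q ^ D)]exprAC; congr (_ ^+ _ ^+ _); apply/eqP.
by rewrite (eq_prim_root_frobenius _ co_mq (xi_prim co_mq)).
Qed.

Lemma eps_max_orbit_sum t : orbit_sum iota H (fun h =>
  lam h ^+ t) D (eps_max t).
Proof.
have lin_gt : lin_char (H / K)%g (fun u => gamma u ^+ t).
  exact: lin_char_exp (faithful_char_lin gammaP).
have := cyclic_sum_orbit_sum algFbar xi_prim coGq sHG nKH Ha defHK lin_gt.
rewrite (hat_trivial _ _ K1) mul1mx gamma_a oHK.
by under eq_bigr do rewrite -exprM.
Qed.

Lemma eps_max_frobenius t t' i : t = (t' * q ^ i)%N %[mod m] ->
  eps_max t = eps_max t'.
Proof.
move=> tt'; apply: (orbit_sum_uniq (eps_max_orbit_sum t)).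
have lamDt : {in H, forall y, lam y ^+ t' ^+ (q ^ D) = lam y ^+ t'}.
  by move=> y; apply: lamD.
apply: orbit_sum_ext (orbit_sum_frobenius i lamDt (eps_max_orbit_sum t')).
move=> y Hy /=; rewrite -exprM -(expr_mod _ (lam_m Hy)) -tt'.
exact: (expr_mod _ (lam_m Hy)).
Qed.

Lemma cycle_conj s x : x \in H -> (x ^ (b ^+ s) = x ^+ ((1 + p ^ n.-1) ^
  s)%N)%g.
Proof.
case/cycleP=> r ->; rewrite conjXg -expgM mulnC expgM; congr (_ ^+ _)%g.
elim: s => [|s IHs]; first by rewrite conjg1.
by rewrite expgSr conjgM IHs conjXg ab -expgM -expnS.
Qed.

Variable k : nat.
Hypothesis co_kp : coprime k p.

(** At [lam ^+ (k * t)] the form [phi] is 1 on the first element, and 0 on the second unless the two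
    characters are Frobenius conjugate, which can be read at [a]. *)
Lemma eps_max_eq t t' : coprime t p -> eps_max (k * t) = eps_max (k * t') ->
  exists i, t = (t' * q ^ i)%N %[mod m].
Proof.
move=> co_tp eq_eps.
have prim_xik : m.-primitive_root (xi m ^+ k).
  by rewrite prim_root_exp_coprime ?xi_prim // coprimeXr.
have ord_t : has_order H (fun h => lam h ^+ (k * t)) m.
  split; first exists a => //=.
    rewrite gamma_a exprM.
    by rewrite prim_root_exp_coprime // coprimeXr.
  by move=> x Hx /=; rewrite exprAC lam_m // expr1n.
have [D0 freeD _] := has_order_frobenius co_mq ord_t.
have phi1 := phi_orbit_sum (nzG coGq) sHG (lamX _) D0 freeD (eps_max_orbit_sum
  _).
have [/existsP[i /eqP Di] | /existsPn no_i] :=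
  boolP [exists i : 'I_D, xi m ^+ (k * t') ^+ (q ^ i) == xi m ^+ (k * t)].
  exists i; apply/eqP; rewrite -(eq_prim_root_expr prim_xik).
  by rewrite -!exprM mulnA !(exprM _ (k * _)) Di.
have phi0 := phi_orbit_sum_eq0 sHG (lamX _) (lamX _) (eps_max_orbit_sum (k *
  t')).
move/eqP: phi1; rewrite eq_eps phi0 ?(eq_sym 0) ?oner_eq0 // => i ltiD.
by exists a => //=; rewrite gamma_a (no_i (Ordinal ltiD)).
Qed.

Local Notation eps := (epsilon iota xi G H (fun h => gamma h ^+ k)).

(** The coefficient of the conjugate at [x] is that of [eps] at [x ^ g^-1], whence the decomposition
    of the inverse; the factor [a ^+ r] acts trivially on [<[a]>]. *)
Lemma conj_eps_max g r s : g^-1%g = (a ^+ r * b ^+ s)%g ->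
  conj_galg eps g = eps_max (k * (1 + p ^ n.-1) ^ s).
Proof.
move=> Dg; have Gg : g \in G by rewrite -groupV Dg groupM ?groupX.
have gkP : faithful_char H (fun h => gamma h ^+ k).
  apply: faithful_char_exp gammaP; rewrite card_quotient ?normal_norm // oHK.
  by rewrite coprimeXr.
have cHK : cyclic (H / K)%g by rewrite defHK cycle_cyclic.
have [Reps Deps] := epsilon_orbit_sum algFbar xi_prim coGq nHG nKH cHK gkP.
apply: (fun h => orbit_sum_uniq h (eps_max_orbit_sum _)).
split; first exact: conj_gring.
move=> x Gx; rewrite gcoef_conj // Deps ?groupJ ?groupV // -conjVg oHK.
have HJ y : (y ^ g^-1 \in H)%g = (y \in H).
  by rewrite memJ_norm // (subsetP (normal_norm nHG)) ?groupV.
rewrite /ext0 HJ; case: ifP => // Hx; congr (_ * _); apply: eq_bigr => i _.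
have -> : (x^-1 ^ g^-1 = x^-1 ^+ ((1 + p ^ n.-1) ^ s)%N)%g.
  rewrite Dg conjgM; have -> : (x^-1 ^ (a ^+ r) = x^-1)%g.
    apply/conjg_fixP/commgP; case/cycleP: Hx => c ->.
    exact/commuteX2.
  exact: cycle_conj.
rewrite (lin_charX _ lin_lam) //; congr (_ ^+ _).
by rewrite -exprM mulnC.
Qed.

Variables (w0 : nat) (T : {set {unit 'Z_m}}).
Local Notation u := (unitZ m (1 + p ^ n.-1)).
Local Notation qq := (unitZ m q).
Hypotheses (w0_gt0 : (0 < w0)%N) (w0_in : (u ^+ w0 \in <[qq]>)%g).
Hypothesis w0_min : forall w, (0 < w)%N -> (u ^+ w \in <[qq]>)%g -> (w0 <= w)%N.
Hypothesis trT : is_transversal T (lcosets <[u ^+ w0]>%g <[u]>%g) <[u]>%g.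

Let sT : T \subset <[u]>%g. Proof. by case/and3P: trT. Qed.

Let T_coset x : x \in <[u]>%g -> exists2 t, t \in T &
  forall t', t' \in T -> ((x^-1 * t')%g \in <[u ^+ w0]>%g) = (t' == t).
Proof.
move=> ux; have /and3P[_ _ /forall_inP trTB] := trT.
have /cards1P[t Tt] := trTB _ (imset_f (lcoset <[u ^+ w0]>%g) ux).
have memT t' : ((t' \in T) && ((x^-1 * t')%g \in <[u ^+ w0]>%g)) = (t' == t).
  by move/setP/(_ t'): Tt; rewrite !inE lcosetE mem_lcoset.
exists t; first by have := memT t; rewrite eqxx => /andP[].
by move=> t' Tt'; rewrite -memT Tt'.
Qed.

Let val_unitM (t t' : {unit 'Z_m}) :
  (val (t * t')%g : nat) = (val t * val t')%N %[mod m].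
Proof.
have modE d x : d = m -> x %% d = x %[mod m] by move=> ->; apply: modn_mod.
exact: modE (Zp_cast m_gt1).
Qed.

Let eq_unit_mod (t t' : {unit 'Z_m}) :
  (val t : nat) = (val t' : nat) %[mod m] -> t = t'.
Proof.
move=> eq_tt; apply: val_inj; apply: val_inj => /=.
have small (x : 'Z_m) : (x %% m)%N = x by rewrite modn_small // -[X in (_ <
  X)%N](Zp_cast m_gt1).
by rewrite -(small (val t)) eq_tt small.
Qed.

Let val_unitX x s : coprime m x -> (val (unitZ m x ^+ s)%g : nat) = (x ^ s)%N
  %[mod m].
Proof.
move=> co_mx; rewrite FinRing.val_unitX val_unitZ // -natrX val_Zp_nat //.
by rewrite modn_mod.
Qed.

Let co_m1p : coprime m (1 + p ^ n.-1).
Proof.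
rewrite coprimeXl // -(ltn_predK n_ge2) /= -(prednK (n := n.-1)) 1?addnC
  ?expnSr.
  by rewrite /coprime gcdnMDl gcdn1.
by case: (n) n_ge2 => [|[]].
Qed.

(** The conjugates are indexed by the powers of [u]. Such a power differs from its representative in
    [T] by an element of [<[u ^+ w0]>], that is, by a power of [q], which [eps_max] does not see. *)
Lemma conj_eps_max_transversal :
  [set conj_galg eps g | g in G] = [set eps_max (k * val t) | t : {unit 'Z_m}
    in T].
Proof.
have powT s : exists2 t, t \in T & eps_max (k * (1 + p ^ n.-1) ^ s) = eps_max
  (k * val t).
  have [t Tt cosT] := T_coset (mem_cycle u s); exists t => //.
  have : ((u ^+ s)^-1 * t \in <[qq]>)%g.
    have := cosT t Tt; rewrite eqxx; move: (_ * t)%g => v.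
    by apply: subsetP; rewrite cycle_subG.
  case/cycleP=> i /(canRL (mulKVg _)) Dt;
    apply/esym/(eps_max_frobenius (i := i)).
  rewrite -mulnA -modnMmr; apply/eqP; rewrite -modnMmr -[X in _ == X]modnMmr.
  apply/eqP; congr (_ * _ %% _)%N; rewrite modn_mod Dt val_unitM.
  by rewrite -modnMm !val_unitX // modnMm.
apply/setP=> e; apply/imsetP/imsetP => [[g Gg ->] | [t Tt ->]].
  have [r [s Dg]] := modular_decomp modG (groupVr Gg).
  have [t Tt eq_t] := powT s; exists t => //.
  by rewrite (conj_eps_max Dg).
have /cycleP[s Dt] := subsetP sT t Tt.
exists (b ^+ s)^-1%g; first by rewrite groupV groupX.
rewrite (@conj_eps_max _ 0 s) ?expg0 ?mul1g ?invgK //.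
by apply: (eps_max_frobenius (i := 0));
  rewrite muln1 Dt -modnMmr val_unitX // modnMmr.
Qed.

(** Equal values put [t'^-1 * t = u ^+ c] into <q>. The remainder of [c] modulo [w0] would be a
    smaller exponent with this property, so [w0] divides [c] and both lie in one coset. *)
Lemma eps_max_inj :
  {in T &, injective (fun t : {unit 'Z_m} => eps_max (k * val t))}.
Proof.
move=> t t' Tt Tt' /(eps_max_eq (unit_Zp_coprime t p_pr (ltnW n_ge2)))[i Dt].
have uT := subsetP sT; have [t1 _ cosT] := T_coset (uT t' Tt').
have Dtt : (t'^-1 * t = qq ^+ i)%g.
  apply: (canLR (mulKg _)); apply: eq_unit_mod.
  by rewrite Dt val_unitM -modnMmr -val_unitX // modnMmr.
have /cycleP[c Dc] : (t'^-1 * t \in <[u]>)%g by rewrite groupM ?groupV ?uT.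
have c0 : (c %% w0 = 0)%N.
  have [//|c_gt0] := posnP (c %% w0).
  have /(w0_min c_gt0) : (u ^+ (c %% w0) \in <[qq]>)%g.
    rewrite -(groupMl _ (groupX (c %/ w0) w0_in)) -expgM -expgD.
    by rewrite mulnC -divn_eq -Dc Dtt mem_cycle.
  by rewrite leqNgt ltn_mod w0_gt0.
have : (t'^-1 * t \in <[u ^+ w0]>)%g.
  by rewrite Dc (divn_eq c w0) c0 addn0 mulnC expgM mem_cycle.
rewrite cosT // => /eqP->; apply/esym/eqP.
by rewrite -cosT // mulVg group1.
Qed.

Lemma e_ssp_max : e_ssp iota xi G H (fun h => gamma h ^+ k) =
  \sum_(t in T) eps_max (k * val t).
Proof.
by rewrite /e_ssp conj_eps_max_transversal big_imset //; apply: eps_max_inj.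
Qed.

End MaxPair.

(** * The listed idempotents *)

Section ListedIdempotents.

Variables (p n : nat) (gT : finGroupType) (G : {group gT}) (a b : gT).
Hypothesis modG : modular_gens p n G a b.
Hypothesis ab : (a ^ b = a ^+ (1 + p ^ n.-1)%N)%g.
Hypothesis p_odd : odd p.
Variables (F : finFieldType) (Fbar : fieldType) (iota : {rmorphism F -> Fbar}).
Hypothesis algFbar : integralRange iota.
Variable xi : nat -> Fbar.
Hypothesis xi_prim : forall m, coprime m #|F| -> m.-primitive_root (xi m).
Hypothesis coGq : coprime #|G| #|F|.
Local Notation q := #|F|.
Local Notation m := (p ^ n)%N.
Local Notation u := (unitZ m (1 + p ^ n.-1)).
Local Notation qq := (unitZ m q).
Variables (i0 delta' : nat).
Hypothesis i0_range : (1 <= i0 <= n)%N.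
Hypothesis delta'_coprime : coprime delta' p.
Hypothesis i0_def : (#[qq]%g * (p ^ i0.-1 * delta') = totient m)%N.
Variables (w0 : nat) (T : {set {unit 'Z_m}}).
Hypotheses (w0_gt0 : (0 < w0)%N) (w0_in : (u ^+ w0 \in <[qq]>)%g).
Hypothesis w0_min : forall w, (0 < w)%N -> (u ^+ w \in <[qq]>)%g -> (w0 <= w)%N.
Hypothesis trT : is_transversal T (lcosets <[u ^+ w0]>%g <[u]>%g) <[u]>%g.

Local Notation aG := (regular_repr F G).
Local Notation pair := (pair_of G a b p n).
Local Notation gen := (label_gen a b).
Local Notation lord := (label_order p n).
Local Notation idem := (@listed_idem F Fbar iota xi gT G a b p n i0 T).

Let p_pr : prime p. Proof. by case: modG. Qed.
Let p_gt0 : (0 < p)%N := prime_gt0 p_pr.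
Let p_gt1 : (1 < p)%N := prime_gt1 p_pr.
Let n_ge2 : (2 <= n)%N. Proof. by case: modG. Qed.
Let oG : #|G| = (p ^ n.+1)%N. Proof. by case: modG => _ _ []. Qed.
Let defZ : 'Z(G)%g = <[a ^+ p]>%g. Proof. by case: modG => _ _ _ _ []. Qed.
Let defG' : G^`(1)%g = <[a ^+ (p ^ n.-1)%N]>%g.
Proof. by case: modG => _ _ _ _ []. Qed.
Let oG' : #|G^`(1)%g| = p. Proof. by case: modG => _ _ _ _ []. Qed.
Let Ga : a \in G. Proof. by have [] := modular_mem modG. Qed.
Let pG : p.-group G := modular_pgroup modG.

Let co_pq : coprime p q.
Proof. by move: coGq; rewrite oG coprime_pexpl. Qed.

Let nzp : p%:R != 0 :> Fbar.
Proof. by rewrite -(rmorph_nat iota) fmorph_eq0 natr_coprime_card. Qed.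

Let xi_exp (d : nat) (k : int) (k' c : nat) : (d %| p ^ n.+1)%N ->
    (forall x : Fbar, x ^+ (p ^ n.+1) = 1 -> x ^ k = x ^+ k') ->
  xi d ^ (k * c%:Z) = xi d ^+ (k' * c).
Proof.
move=> dv_d kk'; rewrite mulrC -exprz_exp -[xi d ^ c]/(xi d ^+ c).
rewrite kk' -?exprM 1?mulnC //.
have co_dq : coprime d q by apply: coprime_dvdl dv_d _; rewrite coprimeXl.
apply/eqP; rewrite -(prim_order_dvd (xi_prim co_dq)).
exact: dvdn_mulr.
Qed.

Let trace_xi_eq0 j (k r : nat) : (i0 < j <= n)%N -> coprime k p ->
  ~~ (p ^ (j - i0) %| r)%N -> trace iota (xi (p ^ j)) (xi (p ^ j) ^+ (k * r)) =
    0.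
Proof.
move=> range_j co_kp ndv_r; apply: (fmorph_inj iota); rewrite rmorph0.
have co_jq : coprime (p ^ j) q by rewrite coprimeXl.
rewrite trace_root //; last first.
  by rewrite exprAC (prim_expr_order (xi_prim co_jq)) expr1n.
apply: (sum_frobenius_root_eq0 (n := n) (i0 := i0) (delta' := delta')) => //.
  by rewrite Gauss_dvdr // coprimeXl // coprime_sym.
exact: xi_prim.
Qed.

(** The exponent [p ^ n.+1], the order of G, serves all labels at once. In the truncated cases only
    the multiples of [p ^ (j - i0)] are kept among the exponents [r], with [j = n] for the last
    label. *)
Lemma listed_idemE l (gamma : coset_of (pair l).2 -> Fbar) (k : int) (k' : nat)
  :
    label_ok p n l -> faithful_char (pair l).1 gamma ->
    gamma (coset (pair l).2 (gen l)) = xi (lord l) -> coprime k' p ->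
    (forall x : Fbar, x ^+ (p ^ n.+1) = 1 -> x ^ k = x ^+ k') ->
  e_ssp iota xi G (pair l).1 (fun h => gamma h ^+ k') = idem l k.
Proof.
move=> ok_l; have [_ nKH Hx defHK oHK] := label_pair modG ok_l.
case: l ok_l gamma nKH Hx defHK oHK =>
  [||i j|] ok_l gamma nKH Hx defHK oHK gammaP
  gamma_x co_k kk'.
- rewrite /= in nKH Hx defHK gammaP gamma_x *.
  rewrite (linear_idem algFbar xi_prim coGq nKH Hx defHK gammaP) ?indexgg
    ?coprimen1 //.
  rewrite big_ord1 muln0 expr0 expg0 invg1 repr_mx1.
  rewrite (_ : trace _ _ _ = 1) ?scale1r ?mulmx1 ?invr1 ?scale1r //.
  apply: (fmorph_inj iota); rewrite rmorph1 trace_root ?coprime1n ?expr1n //.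
  have o1 : #[unitZ 1 q]%g = 1%N.
    by apply/eqP; rewrite -dvdn1 order_unitZ ?coprime1n // !modn1.
  by rewrite o1 big_ord1 expr1n.
- rewrite /= in nKH Hx defHK oHK gammaP gamma_x *.
  rewrite (linear_idem algFbar xi_prim coGq nKH Hx defHK gammaP) ?oHK //.
  rewrite /listed_idem /= oHK.
  congr (_ *: (_ *m _)); apply: eq_bigr => r _.
  by rewrite (xi_exp r _ kk') // expnS dvdn_mulr.
- have [_ j0 ltjn] := label_okP modG ok_l.
  rewrite /= in nKH Hx defHK oHK gammaP gamma_x *.
  rewrite (linear_idem algFbar xi_prim coGq nKH Hx defHK gammaP) ?oHK
    ?coprimeXr //.
  rewrite /listed_idem /= oHK.
  have xiE c : xi (p ^ j) ^ (k * c%:Z) = xi (p ^ j) ^+ (k' * c).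
    by apply: xi_exp kk'; rewrite dvdn_exp2l // ltnW // ltnW.
  case: leqP => [_ | lt_i0j]; congr (_ *: (_ *m _)).
    by apply: eq_bigr => r _; rewrite xiE.
  have Dj : (p ^ j = p ^ i0 * p ^ (j - i0))%N by rewrite -expnD subnKC // ltnW.
  transitivity (\sum_(r < p ^ i0 * p ^ (j - i0))
      trace iota (xi (p ^ j)) (xi (p ^ j) ^+ (k' * r)) *: aG (a ^- r)%g).
    by rewrite -Dj.
  rewrite (sum_multiples _ (f := fun r =>
      trace iota (xi (p ^ j)) (xi (p ^ j) ^+ (k' * r)) *: aG (a ^- r)%g)) //.
  + by apply: eq_bigr => r _; rewrite -mulrA -PoszM xiE.
  + by rewrite expn_gt0 p_gt0.
  move=> r ndv_r; rewrite trace_xi_eq0 ?scale0r //.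
  by rewrite lt_i0j ltnW.
rewrite (e_ssp_max modG ab algFbar xi_prim coGq gammaP gamma_x co_k w0_gt0
  w0_in w0_min trT).
rewrite /= in oHK; rewrite /listed_idem /= oHK.
have xiE c : xi m ^ (k * c%:Z) = xi m ^+ (k' * c).
  by apply: xi_exp kk'; rewrite dvdn_exp2l.
have [n_i0 | n_i0] := eqVneq n i0.
  rewrite -n_i0 -scaler_sumr; congr (_ *: _); apply: eq_bigr => t _.
  by apply: eq_bigr => r _; rewrite -mulrA -PoszM xiE -mulnA (mulnC r).
have lt_i0n : (i0 < n)%N by rewrite ltn_neqAle eq_sym n_i0; case/andP: i0_range.
rewrite -scaler_sumr; congr (_ *: _); apply: eq_bigr => t _.
pose f r := trace iota (xi m) (xi m ^+ (k' * val t * r)) *: aG (a ^- r)%g.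
have Dm : m = (p ^ i0 * p ^ (n - i0))%N by rewrite -expnD subnKC // ltnW.
transitivity (\sum_(r < p ^ i0 * p ^ (n - i0)) f r); first by rewrite -Dm.
rewrite (sum_multiples _ (f := f)) ?expn_gt0 ?p_gt0 //.
  apply: eq_bigr => r _; rewrite /f -!mulrA -!PoszM xiE;
    congr (trace _ _ (_ ^+ _) *: _).
  by rewrite -mulnA (mulnCA r).
move=> r ndv_r; rewrite /f trace_xi_eq0 ?scale0r ?lt_i0n ?leqnn //.
by rewrite coprimeMl co_k unit_Zp_coprime // ltnW.
Qed.

Lemma label_gamma l : label_ok p n l ->
  exists2 gamma : coset_of (pair l).2 -> Fbar, faithful_char (pair l).1 gamma &
    gamma (coset (pair l).2 (gen l)) = xi (lord l).
Proof.
move=> ok_l; have [nHG nKH _ defHK oHK] := label_pair modG ok_l.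
have co_ord := coprime_indexg coGq (pair l).2 (normal_sub nHG).
have [gamma gammaP gammaX] := faithful_char_ex nKH defHK (xi_prim co_ord).
by exists gamma => //; rewrite -[coset _ _]expg1 gammaX expr1 oHK.
Qed.

Let exp_int (k : int) : coprimez k p -> exists2 k' : nat, coprime k' p &
  forall x : Fbar, x ^+ (p ^ n.+1) = 1 -> x ^ k = x ^+ k'.
Proof. by apply: exprz_nat; rewrite ?expn_gt0 ?p_gt0 // expnS dvdn_mulr. Qed.

Lemma pgroup_index_exp (H K : {group gT}) (chi : coset_of K -> Fbar) h :
    H <| G -> faithful_char H chi -> h \in (H / K)%g ->
  chi h ^+ (p ^ n.+1) = 1.
Proof.
move=> nHG chiP Hh; have lin_chi := faithful_char_lin chiP.
rewrite -(lin_charX _ lin_chi) // -[RHS]lin_chi.1; congr chi.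
apply/eqP; rewrite -order_dvdn -oG (dvdn_trans (order_dvdG Hh)) //.
exact: dvdn_trans (dvdn_quotient _ _) (cardSg (normal_sub nHG)).
Qed.

Lemma label_shoda l : label_ok p n l -> strong_shoda_pair G (pair l).1 (pair
  l).2.
Proof.
move=> ok_l; have [_ nKH _ _ _] := label_pair modG ok_l.
have := label_cyclic modG ok_l; case: l ok_l nKH => [||i j|] ok_l nKH cHK;
  first [exact: linear_strong_shoda | exact: label_max_shoda].
Qed.

Lemma label_idem l : label_ok p n l ->
  exists2 gamma : coset_of (pair l).2 -> Fbar, faithful_char (pair l).1 gamma &
    forall k : int, coprimez k p ->
      e_ssp iota xi G (pair l).1 (fun h => gamma h ^ k) = idem l k.
Proof.
move=> ok_l; have [nHG _ _ _ _] := label_pair modG ok_l.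
have [gamma gammaP gamma_x] := label_gamma ok_l; exists gamma => // k co_kp.
have [k' co_k'p kk'] := exp_int co_kp.
rewrite -(listed_idemE ok_l gammaP gamma_x co_k'p kk');
  apply: e_ssp_ext => h Hh.
by rewrite kk' // (pgroup_index_exp nHG gammaP Hh).
Qed.

Lemma label_idem_of_pair l e : label_ok p n l ->
  idem_of_pair iota xi (pair l).1 (pair l).2 e <->
  exists2 k : int, coprimez k p & e = idem l k.
Proof.
move=> ok_l; have [nHG nKH _ _ _] := label_pair modG ok_l.
have [gamma gammaP gammaE] := label_idem ok_l.
have pHK : p.-group ((pair l).1 / (pair l).2)%g.
  exact: quotient_pgroup (pgroupS (normal_sub nHG) pG).
apply: iff_trans (idem_of_faithful_power iota xi e nKH (label_cyclic modG ok_l)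
  pHK gammaP) _.
split=> [[k co_kp ->] | [k co_kp ->]].
  by exists k%:Z; rewrite // -gammaE.
rewrite -gammaE //.
have [k' co_k'p kk'] := exp_int co_kp.
exists k' => //; apply: e_ssp_ext => h Hh.
by rewrite kk' // (pgroup_index_exp nHG gammaP Hh).
Qed.

(** Applying [phi] to g e = e gives [th g = 1], as [phi] is 1 at [e]: an idempotent remembers the
    kernel of its character. *)
Lemma orbit_sum_stabilizer (Y : {group gT}) th D e g : central_type G Y th ->
    (0 < D)%N -> frobenius_free F Y th D -> orbit_sum iota (G := G) Y th D e ->
    g \in Y ->
  aG g *m e = e <-> th g = 1.
Proof.
move=> thP D0 freeD eP Yg; have [/andP[sYG _] lin_th _ _] := thP.
have Gg := subsetP sYG g Yg; have Rg := gring_repr F Gg.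
split=> [ge | thg].
  have Ze := orbit_sum_center thP eP.
  have := phi_mul iota (nzG coGq) thP Rg Ze; rewrite ge.
  rewrite (phi_orbit_sum (nzG coGq) sYG lin_th D0 freeD eP) mulr1 => ->.
  rewrite /phi (bigD1 g) //= gcoef_repr // eqxx rmorph1 mul1r ext0T //.
  rewrite big1 ?addr0 // => x /andP[Gx nxg].
  by rewrite gcoef_repr // (negPf nxg) rmorph0 mul0r.
have [Re De] := eP; apply: gcoef_inj; rewrite ?gringM // => x Gx.
apply: (fmorph_inj iota); rewrite gcoef_mull // !De ?groupM ?groupV //.
rewrite invMg invgK /ext0 groupMr // groupV; case: ifP => // Yx.
by congr (_ * _); apply: eq_bigr => i _; rewrite lin_th.2 ?groupV // thg mulr1.
Qed.

Lemma linear_idem_orbit_sum (K : {group gT}) e : K <| G -> cyclic (G / K)%g ->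
    idem_of_pair iota xi G K e ->
  exists th, [/\ lin_char G th, {in G, forall g, (th g == 1) = (g \in K)},
    frobenius_free F G th #[unitZ #|G : K| q]%g &
    orbit_sum iota (G := G) G th #[unitZ #|G : K| q]%g e].
Proof.
move=> nKG cGK [chi chiP ->]; exists (fun h => chi (coset K h)); split.
- exact: faithful_char_lift.
- exact: faithful_char_ker.
- have co_m := coprime_indexg coGq K (subxx G).
  by have [] := has_order_frobenius co_m (faithful_char_order nKG cGK chiP).
exact: linear_e_ssp.
Qed.

Lemma linear_idem_stabilizer (K : {group gT}) e g : K <| G -> cyclic (G / K)%g
  ->
  idem_of_pair iota xi G K e -> g \in G -> aG g *m e = e <-> g \in K.
Proof.
move=> nKG cGK eI Gg.
have [th [lin_th kerK freeD eP]] := linear_idem_orbit_sum nKG cGK eI.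
rewrite -kerK //; apply: iff_trans (rwP eqP).
exact: orbit_sum_stabilizer (central_type_linear lin_th) (order_gt0 _) freeD eP
  Gg.
Qed.

Let sG'Z : G^`(1)%g \subset 'Z(G)%g := der1_sub_center modG.
Let cZ : cyclic 'Z(G)%g := center_cyclic modG.
Let co_Zq : coprime #|'Z(G)%g| q.
Proof. exact: coprime_dvdl (cardSg (center_sub G)) coGq. Qed.

Lemma max_pair_center : 'Z(G)%g \subset (pair LabMax).1 /\
  ((pair LabMax).2 :&: 'Z(G) = 1)%g.
Proof.
split; first by rewrite defZ cycle_subG mem_cycle.
by rewrite (label_max_ker modG); apply/setIidPl/sub1G.
Qed.

Lemma central_orbit_sum_stabilizer th e : lin_char 'Z(G)%g th ->
    faithful 'Z(G)%g th ->
    orbit_sum iota (G := G) 'Z(G) th #[unitZ #|'Z(G)%g| q]%g e ->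
  aG (a ^+ (p ^ n.-1)%N)%g *m e <> e.
Proof.
move=> lin_th th1 eP; have thP := central_type_center sG'Z lin_th th1.
have Zu : (a ^+ (p ^ n.-1)%N)%g \in 'Z(G)%g by rewrite (subsetP sG'Z) // defG'
  cycle_id.
have [D0 freeD _] := has_order_frobenius co_Zq (faithful_has_order cZ lin_th
  th1).
move/(orbit_sum_stabilizer thP D0 freeD eP Zu) => /(th1 _ Zu) u1.
by move: oG' p_gt1; rewrite defG' u1 cycle1 cards1 => <-.
Qed.

Lemma labels_inequivalent l1 l2 : label_ok p n l1 -> label_ok p n l2 ->
  l1 <> l2 -> inequivalent iota xi G (pair l1) (pair l2).
Proof.
move=> ok1 ok2 neq_l e f eI fI eq_ef; subst f.
have linP l : label_ok p n l -> label_lin l ->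
    idem_of_pair iota xi (pair l).1 (pair l).2 e ->
    {in G, forall g, aG g *m e = e <-> g \in (pair l).2}.
  move=> ok_l lin_l lI g; have [_ nKG _ _ _] := label_pair modG ok_l.
  have := label_cyclic modG ok_l;
    rewrite (label_lin1 _ _ _ _ _ lin_l) in nKG lI * => cGK.
  exact: linear_idem_stabilizer.
have maxP : idem_of_pair iota xi (pair LabMax).1 (pair LabMax).2 e ->
    aG (a ^+ (p ^ n.-1)%N)%g *m e <> e.
  have [nHG nKH _ _ _] := label_pair modG (erefl : label_ok p n LabMax).
  have [sZH KZ1] := max_pair_center.
  case/(nonlinear_idemP algFbar xi_prim coGq sG'Z cZ e pG nHG nKH
    (label_cyclic modG (erefl : label_ok p n LabMax)) sZH KZ1) =>
      th [lin_th th1 eP].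
  exact: central_orbit_sum_stabilizer eP.
have lin_u l : label_ok p n l -> label_lin l ->
    idem_of_pair iota xi (pair l).1 (pair l).2 e -> aG (a ^+ (p ^ n.-1)%N)%g *m
      e = e.
  move=> ok_l lin_l lI; apply/(linP l ok_l lin_l lI); first by rewrite groupX.
  by rewrite (subsetP (label_lin_der1 modG ok_l lin_l)) // defG' cycle_id.
have [lin1 | max1] := boolP (label_lin l1);
  have [lin2 | max2] := boolP (label_lin l2).
- apply: neq_l; apply: (label_lin_inj modG) => //; apply/setP=> g.
  have sKG l : label_ok p n l -> {subset (pair l).2 <= G}.
    move=> /(label_pair modG)[nHG nKH _ _ _]; apply/subsetP.
    exact: subset_trans (normal_sub nKH) (normal_sub nHG).
  apply/idP/idP => Kg.
    have Gg := sKG _ ok1 g Kg.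
    exact/(linP _ ok2 lin2 fI g Gg)/(linP _ ok1 lin1 eI g Gg).
  have Gg := sKG _ ok2 g Kg.
  exact/(linP _ ok1 lin1 eI g Gg)/(linP _ ok2 lin2 fI g Gg).
- by case: l2 max2 fI {ok2 neq_l} => // _ /maxP[]; apply: lin_u eI.
- by case: l1 max1 eI {ok1 neq_l} => // _ /maxP[]; apply: lin_u fI.
by case: l1 l2 max1 max2 neq_l {ok1 ok2 eI fI} => [||? ?|] [||? ?|].
Qed.

(** The image of Z(G) is central in N_G(K)/K, so with H/K it generates an abelian subgroup, which by
    maximality is H/K. *)
Lemma shoda_center (H K : {group gT}) : strong_shoda_pair G H K ->
  ~~ (G^`(1)%g \subset K) -> 'Z(G)%g \subset H /\ (K :&: 'Z(G) = 1)%g.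
Proof.
move=> [nHG nKH cHK maxH] nG'K; split; last first.
  by apply: contraNeq nG'K; apply: (sub_der1_center modG).
have [sHG sKH] := (normal_sub nHG, normal_sub nKH).
have sKG := subset_trans sKH sHG.
have nZK : 'Z(G)%g \subset 'N(K)%g.
  by rewrite cents_norm // subIset // orbC centS // (subset_trans sKG).
have /maxgroupP[_ H_max] := maxH.
have cHZ : ((H / K) <*> ('Z(G) / K))%G = (H / K)%G.
  apply: val_inj; apply: H_max; last exact: joing_subl.
  apply/andP; split.
    rewrite join_subG !quotientS // subsetI ?center_sub ?nZK //.
    by rewrite sHG normal_norm.
  rewrite abelianY cyclic_abelian // quotient_abelian ?center_abelian //=.
  by rewrite quotient_cents // subIset // orbC centS.
have sZHK : ('Z(G) / K \subset ((H / K) <*> ('Z(G) / K))%G)%g := joing_subr _ _.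
by rewrite cHZ quotientSGK in sZHK.
Qed.

Lemma shoda_equivalent (H K : {group gT}) : strong_shoda_pair G H K ->
  exists2 l, label_ok p n l & equivalent iota xi G (H, K) (pair l).
Proof.
move=> HK; have [nHG nKH cHK maxH] := HK.
have [sG'K | nG'K] := boolP (G^`(1)%g \subset K); last first.
  have [sZH KZ1] := shoda_center HK nG'K; exists LabMax => // e.
  have [nHG' nKH' _ _ _] := label_pair modG (erefl : label_ok p n LabMax).
  have [sZH' KZ1'] := max_pair_center.
  apply: iff_trans (nonlinear_idemP algFbar xi_prim coGq sG'Z cZ e pG nHG nKH
    cHK sZH KZ1) _.
  apply: iff_sym; apply: (nonlinear_idemP algFbar xi_prim coGq sG'Z cZ e pG
    nHG' nKH' _ sZH' KZ1').
  exact: (label_cyclic modG (erefl : label_ok p n LabMax)).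
have sKG := subset_trans (normal_sub nKH) (normal_sub nHG).
have nKG : K <| G by apply: sub_der1_normal.
have defH : H = G.
  have /maxgroupP[_ H_max] := maxH; apply: val_inj.
  apply: (quotient_inj nKH nKG); apply/esym/H_max;
    last by rewrite quotientS ?normal_sub.
  by rewrite /= (setIidPl (normal_norm nKG)) subxx sub_der1_abelian.
subst H; have [x defGK] := cyclicP cHK.
have [chi chiP] : exists chi : coset_of K -> Fbar, faithful_char G chi.
  have : x \in (G / K)%g by rewrite defGK cycle_id.
  case/morphimP=> y Ny Gy Dx; rewrite Dx in defGK.
  have [chi chiP _] := faithful_char_ex nKH defGK (xi_prim (coprime_indexg coGq
    K (subxx G))).
  by exists chi.
(* A faithful character of G/K has kernel K, so the label of this character gives the very pair (G,
   K). *)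
have [l [ok_l lin_l kerl]] := label_of_lin_char (faithful_char_lift nKH chiP)
  modG.
exists l => //; suffices -> : pair l = (G, K) by [].
have [_ nKl _ _ _] := label_pair modG ok_l.
rewrite (label_lin1 _ _ _ _ _ lin_l) in nKl.
rewrite [LHS]surjective_pairing (label_lin1 _ _ _ _ _ lin_l); congr (_, _).
apply: val_inj; apply/setP=> g; have [Gg | nGg] := boolP (g \in G).
  by rewrite -[g \in _]/(g \in (pair l).2) -kerl // -(faithful_char_ker nKH
    chiP).
by rewrite !(contraNF (subsetP (normal_sub _) g) nGg).
Qed.

Lemma listed_primitive l k : label_ok p n l -> coprimez k p ->
  primitive_central_idem (idem l k).
Proof.
move=> ok_l co_kp; have [nHG nKH _ _ _] := label_pair modG ok_l.
have lI : idem_of_pair iota xi (pair l).1 (pair l).2 (idem l k).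
  by apply/label_idem_of_pair => //; exists k.
have cHK := label_cyclic modG ok_l.
have [lin_l | max_l] := boolP (label_lin l).
  rewrite (label_lin1 _ _ _ _ _ lin_l) in nKH cHK lI.
  have [th [lin_th _ freeD eP]] := linear_idem_orbit_sum nKH cHK lI.
  exact: (orbit_sum_primitive (nzG coGq) (central_type_linear lin_th)
    (order_gt0 _) freeD eP).
case: l max_l ok_l nHG nKH cHK lI => // _ ok_l nHG nKH cHK.
have [sZH KZ1] := max_pair_center.
case/(nonlinear_idemP algFbar xi_prim coGq sG'Z cZ _ pG nHG nKH cHK sZH KZ1).
move=> th [lin_th th1 eP]; have thP := central_type_center sG'Z lin_th th1.
have [D0 freeD _] := has_order_frobenius co_Zq (faithful_has_order cZ lin_th
  th1).
exact: (orbit_sum_primitive (nzG coGq) thP D0 freeD eP).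
Qed.

(** The coefficients of [e] form a class function with values in [Fbar]; if all these forms vanished
    on it, Fourier inversion would make it zero. *)
Lemma central_nonzero_phi e : (e \in 'Z(group_ring F G))%MS -> e != 0 ->
  (exists2 th, lin_char G th & phi iota (ext0 G th) e != 0) \/
  (exists th, [/\ lin_char 'Z(G)%g th, faithful 'Z(G)%g th &
     phi iota (ext0 'Z(G)%g th) e != 0]).
Proof.
move=> Ze nz_e; apply: contrapT => /not_orP[no_lin no_center].
case/eqP: nz_e; have [Re eJ] := (center_gringP e).1 Ze.
apply: gcoef_inj => // [|g Gg]; first by rewrite linear0 sub0mx.
apply: (fmorph_inj iota); rewrite gcoef0 rmorph0.
have co_n1 : coprime (p ^ n.-1) q by rewrite coprimeXl.
apply: (class_function_eq0 modG (c := fun g => iota (gcoef e g)) (xi_prim co_n1)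
  (xi_prim co_pq) nzp) Gg => [x y Gx Gy | th lin_th | th lin_th th1].
- by rewrite eJ.
- rewrite -(phi_ext0 iota) //; apply/eqP; apply: contra_notT no_lin => phie.
  by exists th.
rewrite -(phi_ext0 iota) ?center_sub //; apply/eqP.
by apply: contra_notT no_center => phie; exists th.
Qed.

(** Some [phi] is nonzero at [e]; the orbit sum of its character is an idempotent of a listed pair,
    and primitivity makes [e] equal to it. *)
Lemma primitive_listed e : primitive_central_idem e ->
  exists l k, [/\ label_ok p n l, coprimez k p & e = idem l k].
Proof.
move=> e_prim; have [eI nz_e _] := e_prim.
suffices [l ok_l lI] : exists2 l, label_ok p n l &
    idem_of_pair iota xi (pair l).1 (pair l).2 e.
  have [k co_kp De] := (label_idem_of_pair e ok_l).1 lI.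
  by exists l, k.
case: (central_nonzero_phi eI.1 nz_e) =>
  [[th lin_th phie] | [th [lin_th th1 phie]]].
  have [l [ok_l lin_l kerl]] := label_of_lin_char lin_th modG.
  exists l => //; have [_ nKG _ _ _] := label_pair modG ok_l.
  have cGK := label_cyclic modG ok_l.
  rewrite (label_lin1 _ _ _ _ _ lin_l) in nKG cGK *.
  have [chi chiP chiE] := lin_char_descend lin_th nKG kerl.
  exists chi => //.
  have eP := orbit_sum_ext chiE (linear_e_ssp algFbar xi_prim coGq nKG cGK
    chiP).
  have co_m := coprime_indexg coGq (pair l).2 (subxx G).
  have [D0 freeD _] := has_order_frobenius co_m (faithful_char_order nKG cGK
    chiP).
  apply: (primitive_eq_orbit_sum (nzG coGq) (central_type_linear lin_th) D0 _
    eP e_prim phie).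
  by move=> i /freeD[y Gy]; rewrite chiE //; exists y.
exists LabMax => //.
have [nHG nKH _ _ _] := label_pair modG (erefl : label_ok p n LabMax).
have cHK := label_cyclic modG (erefl : label_ok p n LabMax).
have [sZH KZ1] := max_pair_center.
have [f fI fP] := nonlinear_idem_ex algFbar xi_prim coGq sG'Z cZ pG nHG nKH cHK
  sZH KZ1 lin_th th1.
have [D0 freeD _] := has_order_frobenius co_Zq (faithful_has_order cZ lin_th
  th1).
have thP := central_type_center sG'Z lin_th th1.
by rewrite (primitive_eq_orbit_sum (nzG coGq) thP D0 freeD fP e_prim phie).
Qed.

End ListedIdempotents.

Theorem theorem4p1
  (p n : nat) (p_prime : prime p) (p_odd : odd p) (n_ge2 : (2 <= n)%N)
  (* G with its generators a, b *)
  (gT : finGroupType) (G : {group gT}) (a b : gT)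
  (isoG : G \isog Grp (x : y : x ^+ (p ^ n)%N, y ^+ p,
                               x ^ y = x ^+ ((p ^ n.-1).+1)%N))
  (genG : <[a]> <*> <[b]> = G :> {set gT})
  (relG : [/\ a ^+ (p ^ n)%N = 1, b ^+ p = 1 &
              a ^ b = a ^+ (p ^ n.-1 + 1)%N]%g)
  (* the finite field F_q, its algebraic closure and roots of unity *)
  (F : finFieldType) (semisimpleFG : semisimple_galg F G)
  (Fbar : closedFieldType) (iota : {rmorphism F -> Fbar})
  (algFbar : integralRange iota)
  (xi : nat -> Fbar)
  (xi_prim : forall m : nat, coprime m #|F| -> m.-primitive_root (xi m))
  (* i_0 *)
  (i0 delta' : nat) (i0_range : (1 <= i0 <= n)%N)
  (delta'_coprime : coprime delta' p)
  (i0_def : (#[unitZ (p ^ n) #|F|]%g * (p ^ i0.-1 * delta') =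
             totient (p ^ n))%N)
  (* omega_0 and the transversal T *)
  (w0 : nat) (w0_gt0 : (0 < w0)%N)
  (w0_in : (unitZ (p ^ n) (1 + p ^ n.-1) ^+ w0
              \in <[unitZ (p ^ n) #|F|]>)%g)
  (w0_min : forall w : nat, (0 < w)%N ->
     (unitZ (p ^ n) (1 + p ^ n.-1) ^+ w \in <[unitZ (p ^ n) #|F|]>)%g ->
     (w0 <= w)%N)
  (T : {set {unit 'Z_(p ^ n)%N}})
  (T_transversal :
     let u := unitZ (p ^ n) (1 + p ^ n.-1) in
     is_transversal T (lcosets <[u ^+ w0]>%g <[u]>%g) <[u]>%g) :
  let pair := pair_of G a b p n in
  let idem := @listed_idem F Fbar iota xi gT G a b p n i0 T in
  [/\ (* the listed pairs are strong Shoda pairs *)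
      forall l : label, label_ok p n l ->
        strong_shoda_pair G (pair l).1 (pair l).2,
      (* their idempotents e_C(G, H, K), C = C_q(gamma^k), are as listed *)
      forall l : label, label_ok p n l ->
        exists2 gamma : coset_of (pair l).2 -> Fbar,
          faithful_char (pair l).1 gamma &
          forall k : int, coprimez k p ->
            e_ssp iota xi G (pair l).1 (fun h => gamma h ^ k) = idem l k,
      (* the listed pairs are pairwise inequivalent *)
      forall l1 l2 : label, label_ok p n l1 -> label_ok p n l2 -> l1 <> l2 ->
        inequivalent iota xi G (pair l1) (pair l2),
      (* every strong Shoda pair is equivalent to a listed one *)
      forall H K : {group gT}, strong_shoda_pair G H K ->
        exists2 l : label, label_ok p n l &
          equivalent iota xi G (H, K) (pair l) &
      (* the listed idempotents are all the primitive central idempotents *)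
      forall e : galg F G,
        primitive_central_idem e <->
        exists l : label, exists k : int,
          [/\ label_ok p n l, coprimez k p & e = idem l k]].
Proof.
have modG := modular_generators p_prime p_odd n_ge2 isoG genG relG.
have ab : (a ^ b = a ^+ (1 + p ^ n.-1)%N)%g.
  by case: relG => _ _ ->; rewrite addnC.
have coGq := semisimple_coprime semisimpleFG.
move=> pair idem; split.
- by move=> l; apply: label_shoda modG l.
- move=> l; exact: (label_idem modG ab p_odd algFbar xi_prim coGq i0_range
    delta'_coprime i0_def w0_gt0 w0_in w0_min T_transversal).
- by move=> l1 l2; apply: (labels_inequivalent modG algFbar xi_prim coGq).
- by move=> H K; apply: (shoda_equivalent modG algFbar xi_prim coGq).
move=> e; split=> [e_prim | [l [k [ok_l co_kp ->]]]].
  exact: (primitive_listed modG ab p_odd algFbar xi_prim coGq i0_range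
    delta'_coprime i0_def w0_gt0 w0_in w0_min T_transversal).
exact: (listed_primitive modG ab p_odd algFbar xi_prim coGq i0_range
  delta'_coprime i0_def w0_gt0 w0_in w0_min T_transversal).
Qed.
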